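(* Let $n\ge3$ and $1\le k_1\leq\dots\leq k_n$. Consider the tangential variety of the Segre embedding of $\mathbb{P}^{k_1}\times\dots\times\mathbb{P}^{k_n}$. Its singular locus has $\binom n2$ irreducible components, corresponding to the two-element subsets of $\{1,\dots,n\}$. The codimension (in the tangential variety) of the component corresponding to the subset $\{i,j\}$ equals $1+\sum_{l\ne i,j}k_l$. Specifically, the component of the singular locus corresponding to the subset $\{i,j\}$, $i<j$, is isomorphic to $${\rm Tan}(\mathbb{P}^{k_{i}}\times\mathbb{P}^{k_{j}}) \times \mathbb{P}^{k_{1}}\times\dots\times \widehat{\mathbb{P}^{k_{i}}} \times \dots \times \widehat{\mathbb{P}^{k_{j}}} \times\dots \times \mathbb{P}^{k_{n}},$$ where $\widehat{\cdot}$ denotes omission.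
   Context: The ground field is $\mathbb{C}$. The Segre variety $\mathbb{P}^{k_1}\times\dots\times\mathbb{P}^{k_n}$ is embedded in $\mathbb{P}(\mathbb{C}^{k_1+1}\otimes\dots\otimes\mathbb{C}^{k_n+1})$ by $([v_1],\dots,[v_n])\mapsto[v_1\otimes\dots\otimes v_n]$. The tangential variety ${\rm Tan}(X)$ of a (smooth) projective variety $X$ is the union of all projective lines tangent to $X$. *)

(* Defs.v *)
From HB Require Import structures.
From mathcomp Require Import all_boot all_order all_algebra.
From mathcomp Require Import boolp classical_sets functions cardinality reals.
From mathcomp Require Import complex.
From mathcomp Require Import mpoly.

Set Implicit Arguments.
Unset Strict Implicit.
Unset Printing Implicit Defensive.

Import GRing.Theory.

Local Open Scope classical_set_scope.
Local Open Scope ring_scope.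

(* Classical projective geometry in finite products of projective spaces.
   An [ambient] A stands for the product, over b : blocks A, of the projective
   spaces whose homogeneous coordinates are the x with blk x = b.  The points
   of this product are handled through their coordinate vectors: a subset of
   the product is a set of vectors v in [points A], stable under [peq]. *)
Record ambient := Ambient {
  coord : finType;
  blocks : finType;
  blk : coord -> blocks }.

Definition PP (I : finType) : ambient := @Ambient I unit (fun=> tt).

Definition ambient_prod (A B : ambient) : ambient :=
  @Ambient (coord A + coord B)%type (blocks A + blocks B)%type
    (fun x => match x with inl y => inl (blk y) | inr y => inr (blk y) end).

Section Zariski.
Variable K : fieldType.

(* K^o rather than K, so that vec A is a vectType over K. *)
Definition vec (A : ambient) := {ffun coord A -> K^o}.

Definition points (A : ambient) : set (vec A) :=
  [set v | forall b : blocks A, exists2 x, blk x = b & v x != 0].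

Definition peq (A : ambient) (u v : vec A) : Prop :=
  exists2 c : blocks A -> K, (forall b, c b != 0) &
    forall x, u x = c (blk x) * v x.

(* The variables of a mpoly are ordinals: variable t is coordinate enum_val t. *)
Definition pol (A : ambient) := {mpoly K[#|coord A|]}.

Definition evalp (A : ambient) (f : pol A) (v : vec A) : K :=
  f.@[fun t => v (enum_val t)].

Definition multihomog (A : ambient) (d : blocks A -> nat) (f : pol A) : Prop :=
  forall m, m \in msupp f ->
    forall b, (\sum_(t | blk (enum_val t) == b) m t)%N = d b.

Definition is_multihomog (A : ambient) (f : pol A) : Prop :=
  exists d, multihomog d f.

Definition zclosed (A : ambient) (Z : set (vec A)) : Prop :=
  exists2 S : set (pol A), S `<=` [set f | is_multihomog f] &
    Z = [set v | points v /\ forall f, S f -> evalp f v = 0].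

Definition irreducible (A : ambient) (Z : set (vec A)) : Prop :=
  Z !=set0 /\ forall Z1 Z2, zclosed Z1 -> zclosed Z2 ->
    Z `<=` Z1 `|` Z2 -> Z `<=` Z1 \/ Z `<=` Z2.

Definition irr_components (A : ambient) (X : set (vec A)) :
    set (set (vec A)) :=
  [set Z | [/\ irreducible Z, Z `<=` X &
    forall Z', irreducible Z' -> Z `<=` Z' -> Z' `<=` X -> Z' = Z]].

Definition chain_between (A : ambient) (Z X : set (vec A)) (r : nat) : Prop :=
  exists F : nat -> set (vec A),
    [/\ F 0%N = Z,
        forall i, (i <= r)%N -> [/\ zclosed (F i), irreducible (F i) & F i `<=` X]
      & forall i, (i < r)%N -> F i `<` F i.+1].

(* The codimension of Z in X is the supremum of the lengths of the chains of
   irreducible closed subsets of X starting at Z. *)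
Definition is_codim (A : ambient) (Z X : set (vec A)) (r : nat) : Prop :=
  chain_between Z X r /\ forall s, chain_between Z X s -> (s <= r)%N.

(* phi is given on representatives; near each point of X it is given by
   multihomogeneous polynomials F, of the same multidegree within each block
   of B.  The neighbourhood is the set of x' where F x' is a point. *)
Definition regular_map (A B : ambient) (X : set (vec A)) (Y : set (vec B))
    (phi : vec A -> vec B) : Prop :=
  (forall x, X x -> Y (phi x)) /\
  forall x, X x ->
    exists F : coord B -> pol A,
      let Fv (u : vec A) : vec B := [ffun y => evalp (F y) u] in
      [/\ exists d : blocks B -> blocks A -> nat,
            forall y, multihomog (d (blk y)) (F y),
          points (Fv x)
        & forall x', X x' -> points (Fv x') -> peq (phi x') (Fv x')].

Definition isomorphic (A B : ambient) (X : set (vec A)) (Y : set (vec B)) :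
    Prop :=
  exists phi psi,
    [/\ regular_map X Y phi, regular_map Y X psi,
        forall x, X x -> peq (psi (phi x)) x
      & forall y, Y y -> peq (phi (psi y)) y].

Definition var_prod (A B : ambient) (X : set (vec A)) (Y : set (vec B)) :
    set (vec (ambient_prod A B)) :=
  [set v | X [ffun x => v (inl x)] /\ Y [ffun y => v (inr y)]].

Section Projective.
Variable I : finType.
Implicit Types (X : set (vec (PP I))) (v w : vec (PP I)).

(* Zariski tangent space at v of the affine cone over X, cut out by the
   differentials at v of the homogeneous ideal of X.  Its projectivization is
   the embedded projective tangent space of X at [v]. *)
Definition cone_tangent X v : set (vec (PP I)) :=
  [set w | forall f : pol (PP I), is_multihomog f ->
     (forall u, X u -> evalp f u = 0) ->
     \sum_t evalp (f^`M(t)) v * w (enum_val t) = 0].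

Definition has_vdim (S : set (vec (PP I))) (d : nat) : Prop :=
  exists2 U : {vspace vec (PP I)}, S = [set` U] & \dim U = d.

(* dim T_[v] X = dim_[v] X, where the local dimension of X at [v] is the
   codimension of the point [v] in X; the cone adds one to the left side. *)
Definition smooth_at X v : Prop :=
  exists2 d, is_codim [set u | peq u v] X d & has_vdim (cone_tangent X v) d.+1.

Definition sing X : set (vec (PP I)) := [set v | X v /\ ~ smooth_at X v].

(* The line through [v] and [w] is tangent to X at [v]. *)
Definition tangent_line X v w : Prop :=
  [/\ X v, cone_tangent X v w & ~ exists c : K, w = c *: v].

Definition tan X : set (vec (PP I)) :=
  [set u | points u /\ exists v w, tangent_line X v w /\
     exists a b : K, u = a *: v + b *: w].

End Projective.

Section Segre.
Variables (J : finType) (k : J -> nat).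

Definition multiproj : ambient :=
  @Ambient {l : J & 'I_(k l).+1} J (fun x => tag x).

(* Coordinates of the tensor product of the K^(k l + 1): one index per factor. *)
Definition tensor_index : finType := {dffun forall l : J, 'I_(k l).+1}.

Definition tensor_of (v : vec multiproj) : vec (PP tensor_index) :=
  [ffun x : tensor_index =>
     \prod_(l : J) v (Tagged (fun l => 'I_(k l).+1) (x l))].

Definition segre : set (vec (PP tensor_index)) :=
  [set u | exists2 v, points v & peq u (tensor_of v)].

End Segre.
End Zariski.

Arguments points K A _ : clear implicits.
Arguments segre K {J} k _.

(* Main.v *)
Require Import Defs.
From HB Require Import structures.
From mathcomp Require Import all_boot all_order all_algebra.
From mathcomp Require Import boolp classical_sets functions cardinality reals.
From mathcomp Require Import complex.
From mathcomp Require Import mpoly.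
From mathcomp Require Import ring zify.

(* Over a field of characteristic 0, a point of the tangential variety T is a
   tensor [dten v w], the sum over l of the tensors obtained from v_1 x ... x v_n
   by replacing v_l with w_l.  Near a coordinate [o] at which no v_l vanishes it
   takes the form [par a X Y], with X_l = 1 and Y_l = 0 at [o], and quadratic
   combinations of its entries give the products Y_p Y_q for p, q in distinct
   factors.  If Y is nonzero in three factors, then a, X and Y are rational
   functions of the entries.  This bounds the tangent space, so that such points
   are smooth, of local dimension 2 (k_1 + ... + k_n).  Relations between the
   products Y_p Y_q pass to the Zariski closure of T, where they force every other
   point to have rank one outside two factors i, j and rank at most two in these;
   such points form a closed set [secants k K (i |: [set j])], contained in T.
   Hence T is closed.  At a point of [secants], a third factor provides enough
   tangent vectors for the tangent space to be too large, so sing T is the union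
   of these sets, which are irreducible and not contained in one another.

   For dimensions, successive members of a chain of irreducible closed sets are
   separated by forms which are algebraically independent on the largest member,
   so that a chain in a variety parametrized by N variables has length less than
   N.  Chains of the expected length come from freeing one after the other the
   variables of a parametrization of T.

   The isomorphism sends a tensor to its slices through a nonzero entry. *)

Set Implicit Arguments.
Unset Strict Implicit.
Unset Printing Implicit Defensive.

Import GRing.Theory.

Local Open Scope classical_set_scope.
Local Open Scope ring_scope.

(** * Evaluation of polynomials and dual numbers *)

(** The chart identities hold over every commutative ring and are stated so. Read in [{mpoly K[_]}]
    they are relations, which vanish on [T] and hence on its closure; read in the dual numbers they
    apply to a point together with a tangent vector, so that inverting a chart and bounding a
    tangent space are one computation; read in [{poly K}] they describe curves. Density and limit
    arguments go along such curves and end with a polynomial in one variable over an infinite field.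

    The obstacle to closedness is that a limit of tensors [dten v w] need not visibly be one. The
    deciding relation is [cubic ^+ 2 = 4 * (quad * quad * quad)]: it lets the base point be moved
    until either three factors interact pairwise or at most two interact at all.

    The count behind singularity: on cones [T] has dimension [1 + 2 \sum_l k l], while at a point of
    [secants] for [{i, j}] the tangent space has dimension at least [2 (k i + k j) + 4 \sum_l k l],
    the last sum being over [l] outside [{i, j}]. The second number is larger as soon as a third
    factor exists. *)

Section Dual.
Variable K : fieldType.

(** The pair [(a, b)] stands for [a + b e] with [e ^ 2 = 0]. The carrier has its own name because
    pairs of ring elements already multiply componentwise. *)
Definition dual := (K^o * K^o)%type.
HB.instance Definition _ := GRing.Lmodule.on dual.

Definition dual_mul (a b : dual) : dual := (a.1 * b.1, a.1 * b.2 + a.2 * b.1).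

Lemma dual_mulA : associative dual_mul.
Proof. by move=> [a b] [c d] [e f]; rewrite /dual_mul /=; congr pair; ring. Qed.
Lemma dual_mulC : commutative dual_mul.
Proof. by move=> [a b] [c d]; rewrite /dual_mul /=; congr pair; ring. Qed.
Lemma dual_mul1 : left_id ((1, 0) : dual) dual_mul.
Proof. by move=> [a b]; rewrite /dual_mul /=; congr pair; ring. Qed.
Lemma dual_mulD : left_distributive dual_mul +%R.
Proof.
move=> [a b] [c d] [e f]; rewrite /dual_mul /=; congr pair => /=;
  by rewrite ?mulrDl // addrACA.
Qed.
Lemma dual_1_neq0 : ((1, 0) : dual) != 0.
Proof. by apply/eqP => -[] /eqP; rewrite oner_eq0. Qed.

HB.instance Definition _ := GRing.Zmodule_isComNzRing.Build dual
  dual_mulA dual_mulC dual_mul1 dual_mulD dual_1_neq0.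

Lemma dual_scaleAl (k : K) (a b : dual) : k *: (a * b) = (k *: a : dual) * b.
Proof.
case: a b => [a b] [c d]; rewrite /GRing.mul /= /dual_mul /=.
by rewrite /GRing.scale /= /scale_pair /= /GRing.scale /=; congr pair; ring.
Qed.
HB.instance Definition _ := GRing.Lmodule_isLalgebra.Build K dual dual_scaleAl.
HB.instance Definition _ := GRing.Lalgebra_isComAlgebra.Build K dual.

Lemma dualM (a b : dual) : a * b = (a.1 * b.1, a.1 * b.2 + a.2 * b.1).
Proof. by []. Qed.
Lemma dualM2 (a b : dual) : (a * b).2 = a.1 * b.2 + a.2 * b.1.
Proof. by []. Qed.
Lemma dualA (c : K) : c%:A = (c, 0) :> dual.
Proof. by congr pair; rewrite /= /GRing.scale /= ?mulr1 ?mulr0. Qed.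

Definition dfst (a : dual) : K := a.1.
Definition dsnd (a : dual) : K := a.2.
Fact dfst_additive : zmod_morphism dfst. Proof. by []. Qed.
Fact dsnd_additive : zmod_morphism dsnd. Proof. by []. Qed.
Fact dfst_multiplicative : monoid_morphism dfst. Proof. by []. Qed.
HB.instance Definition _ := GRing.isZmodMorphism.Build dual K dfst dfst_additive.
HB.instance Definition _ := GRing.isZmodMorphism.Build dual K dsnd dsnd_additive.
HB.instance Definition _ := GRing.isMonoidMorphism.Build dual K dfst dfst_multiplicative.
End Dual.

Section Ev.
Variables (K : fieldType) (I : finType).
Local Notation mp := {mpoly K[#|I|]}.

Definition ev (A : comAlgType K) (u : I -> A) (f : mp) : A :=
  mmap (in_alg A) (fun t => u (enum_val t)) f.

Definition mvar (x : I) : mp := 'X_(enum_rank x).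

Section EvAlg.
Variables (A : comAlgType K) (u : I -> A).
HB.instance Definition _ := GRing.RMorphism.copy (ev u)
  (mmap (in_alg A) (fun t => u (enum_val t))).

Lemma ev_var x : ev u (mvar x) = u x.
Proof. by rewrite /ev /mvar mmapX mmap1U enum_rankK. Qed.
Lemma ev_const c : ev u c%:MP = c%:A.
Proof. by rewrite /ev mmapC. Qed.
Lemma ev_scale c f : ev u (c *: f) = c *: ev u f.
Proof. by rewrite -mul_mpolyC rmorphM /= ev_const -scalerAl mul1r. Qed.
End EvAlg.

Lemma ev_ext (A : comAlgType K) (u v : I -> A) f : u =1 v -> ev u f = ev v f.
Proof.
move=> uv; apply: eq_bigr => m _; congr (_ * _).
by apply: eq_bigr => i _; rewrite uv.
Qed.

Lemma ev_morph (A B : comAlgType K) (g : {rmorphism A -> B}) (u : I -> A) f :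
  (forall c, g c%:A = c%:A) -> g (ev u f) = ev (g \o u) f.
Proof.
move=> gA; rewrite /ev /mmap rmorph_sum; apply: eq_bigr => m _.
rewrite rmorphM /= gA; congr (_ * _).
by rewrite rmorph_prod; apply: eq_bigr => i _; rewrite rmorphXn.
Qed.

Lemma evalpE (f : pol K (PP I)) (v : vec K (PP I)) :
  evalp f v = ev (v : I -> K^o) f.
Proof.
rewrite /evalp /meval /ev /mmap; apply: eq_bigr => m _; congr (_ * _).
by rewrite /= /GRing.scale /= mulr1.
Qed.

Lemma mpoly_gen_ind (P : mp -> Prop) :
  (forall c, P c%:MP) -> (forall x, P (mvar x)) ->
  (forall f g, P f -> P g -> P (f + g)) ->
  (forall f g, P f -> P g -> P (f * g)) -> forall f, P f.
Proof.
move=> Pc Px PD PM; elim/mpolyind => [|c m p _ _ Pp]; first by rewrite -mpolyC0.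
apply: (PD) => //; rewrite -mul_mpolyC; apply: (PM) => //.
rewrite mpolyXE_id; elim/big_ind: _ => [|f g Pf Pg|i _]; first by rewrite -mpolyC1.
  exact: PM.
elim: (m i) => [|k IH]; first by rewrite expr0 -mpolyC1.
by rewrite exprS; apply: PM => //; rewrite -(enum_valK i); exact: Px.
Qed.

Definition dird (p w : I -> K) (f : mp) : K :=
  \sum_t ev (p : I -> K^o) (f^`M(t)) * w (enum_val t).

(** Taylor's formula [f(p + e w) = f(p) + e df_p(w)]: both sides are compatible with sums and
    products, so constants and variables suffice. Tangent vectors thereby become points over the
    dual numbers. *)
Lemma ev_dual (p w : I -> K) (f : mp) :
  ev (fun x => (p x, w x) : dual K) f = (ev (p : I -> K^o) f, dird p w f).
Proof.
elim/mpoly_gen_ind: f => [c|x|f g IHf IHg|f g IHf IHg].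
- rewrite !ev_const dualA; congr pair; first by rewrite /GRing.scale /= mulr1.
  by rewrite /dird big1 // => t _; rewrite mderivC rmorph0 mul0r.
- rewrite !ev_var; congr pair; rewrite /dird (bigD1 (enum_rank x)) //=.
  rewrite /mvar mderivX mnmE eqxx /= scale1r big1 ?addr0.
    rewrite enum_rankK (_ : (_ - _)%MM = 0%MM) ?mpolyX0 ?rmorph1 ?mul1r //.
    by apply/mnmP => j; rewrite mnmBE mnm0E subnn.
  move=> t ne; rewrite mderivX mnmE eq_sym (negPf ne) scale0r.
  by rewrite rmorph0 mul0r.
- rewrite !rmorphD /= IHf IHg; congr pair.
  rewrite /= /dird -big_split /=; apply: eq_bigr => t _.
  by rewrite mderivD rmorphD mulrDl.
- rewrite !rmorphM /= IHf IHg; congr pair.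
  rewrite /= /dird mulr_sumr mulr_suml -big_split /=; apply: eq_bigr => t _.
  by rewrite mderivM rmorphD !rmorphM /=; ring.
Qed.

Lemma ev_horner (g : I -> {poly K}) (f : mp) t :
  (ev g f).[t] = ev ((fun x => (g x).[t]) : I -> K^o) f.
Proof.
elim/mpoly_gen_ind: f => [c|x|f h IHf IHh|f h IHf IHh].
- by rewrite !ev_const hornerZ hornerC.
- by rewrite !ev_var.
- by rewrite !rmorphD hornerD IHf IHh.
- by rewrite !rmorphM hornerM IHf IHh.
Qed.

(** The chain rule: sending a polynomial to its value and derivative at 0 is an algebra morphism to
    the dual numbers, and [ev_dual] reads off the second component. *)
Lemma ev_deriv0 (g : I -> {poly K}) (f : mp) :
  ((ev g f)^`()).[0] = dird (fun x => (g x).[0]) (fun x => ((g x)^`()).[0]) f.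
Proof.
suff: ((ev g f).[0], ((ev g f)^`()).[0]) =
  ev (fun x => ((g x).[0], ((g x)^`()).[0]) : dual K) f by rewrite ev_dual => -[].
elim/mpoly_gen_ind: f => [c|x|f h IHf IHh|f h IHf IHh].
- by rewrite !ev_const dualA derivZ derivC !hornerZ !hornerC !mulr0 mulr1.
- by rewrite !ev_var.
- by rewrite !rmorphD /= derivD !hornerD -IHf -IHh.
- rewrite !rmorphM /= derivM !hornerE -IHf -IHh dualM /=.
  by congr pair; rewrite addrC.
Qed.

End Ev.

(** * Closures and irreducibility *)

Section Zariski.
Variables (K : fieldType) (ch0 : forall n, n.+1%:R != 0 :> K).

Lemma natr_inj (a b : nat) : a%:R = b%:R :> K -> a = b.
Proof.
wlog le_ab : a b / (a <= b)%N => [H ab|].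
  by case: (leqP a b) => [/H|/ltnW/H]; [exact|move=> /(_ (esym ab)) ->].
move/eqP; rewrite eq_sym -subr_eq0 -natrB // => h.
apply/eqP; rewrite eqn_leq le_ab /= -subn_eq0; move: h.
by case: (b - a)%N => // n; rewrite (negPf (ch0 n)).
Qed.

Lemma poly_inf_eq0 (h : {poly K}) : (forall t, h.[t] = 0) -> h = 0.
Proof.
move=> h0; apply/eqP; apply: contraT => nz.
have := @max_poly_roots _ h [seq i%:R | i <- iota 0 (size h)] nz.
rewrite size_map size_iota ltnn; apply.
  by apply/allP => _ /mapP[i _ ->]; rewrite /root h0.
by rewrite map_inj_uniq ?iota_uniq //; exact: natr_inj.
Qed.

(** The substitute for density of nonempty open sets: along a curve, an identity need only be
    checked away from the zeros of some nonzero [q]. *)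
Lemma poly_generic_eq0 (h q : {poly K}) :
  q != 0 -> (forall t, q.[t] != 0 -> h.[t] = 0) -> h = 0.
Proof.
move=> q0 hq; apply/eqP; have: h * q = 0.
  apply: poly_inf_eq0 => t; rewrite hornerM.
  by case: (eqVneq q.[t] 0) => [->|/hq ->]; rewrite ?mulr0 ?mul0r.
by move/eqP; rewrite mulf_eq0 (negPf q0) orbF.
Qed.

Section PPI.
Variable I : finType.
Local Notation mp := {mpoly K[#|I|]}.
Local Notation V := (vec K (PP I)).
Implicit Types (Z X : set V) (u v : V) (f g h : mp).

Definition pev (u : I -> K) (f : mp) : K := ev (u : I -> K^o) f.
HB.instance Definition _ (u : I -> K) :=
  GRing.RMorphism.copy (pev u) (ev (u : I -> K^o)).

Lemma pevE f (v : V) : evalp (A := PP I) f v = pev v f.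
Proof. exact: evalpE. Qed.
Lemma pev_var (u : I -> K) x : pev u (mvar K x) = u x.
Proof. exact: (@ev_var K I K^o u x). Qed.
Lemma pev_scale (u : I -> K) c f : pev u (c *: f) = c * pev u f.
Proof. by rewrite /pev ev_scale. Qed.
Lemma pev_ext (u v : I -> K) f : u =1 v -> pev u f = pev v f.
Proof. exact: (@ev_ext K I K^o u v f). Qed.
Lemma pev_horner (g : I -> {poly K}) f t :
  (ev g f).[t] = pev (fun x => (g x).[t]) f.
Proof. exact: (@ev_horner K I g f t). Qed.

Lemma mhomogP d f :
  @multihomog K (PP I) (fun _ => d) f <-> f \is d.-homog.
Proof.
have E (m : 'X_{1..#|I|}) (b : unit) :
  \sum_(t < #|I| | blk (a := PP I) (enum_val t) == b) m t = mdeg m.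
  by rewrite mdegE; apply: eq_bigl => t; case: b.
split=> [H|/dhomogP H m /H /= mE b]; last by rewrite E.
by apply/dhomogP => m /H /(_ tt); rewrite E.
Qed.

Lemma is_mhomogP f :
  @is_multihomog K (PP I) f <-> exists d, f \is d.-homog.
Proof.
split=> [[d H]|[d /mhomogP H]]; last by exists (fun _ => d).
by exists (d tt); apply/mhomogP => m /H mE [].
Qed.

Lemma homog_scale d f (c : K) (u v : I -> K) : f \is d.-homog ->
  (forall x, v x = c * u x) -> pev v f = c ^+ d * pev u f.
Proof.
move/dhomogP => fd vu; rewrite /pev /ev /mmap mulr_sumr !big_seq.
apply: eq_bigr => m /fd /= mE; rewrite /GRing.scale /= !mulr1 mulrCA.
congr (_ * _); rewrite -mE mdegE -prodrXr -big_split /=.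
by apply: eq_bigr => t _; rewrite vu exprMn.
Qed.

Lemma scaleffE (c : K) u x : (c *: u) x = c * u x.
Proof. by rewrite ffunE. Qed.

Lemma pointsPP u : points K (PP I) u <-> exists x, u x != 0.
Proof.
split=> [/(_ tt) [x _ ux]|[x ux] []]; first by exists x.
by exists x => //=; case: (blk _).
Qed.

Lemma peqPP u v : peq u v <-> exists2 c : K, c != 0 & u = c *: v.
Proof.
split=> [[c c0 E]|[c c0 ->]].
  by exists (c tt) => //; apply/ffunP => x; rewrite scaleffE E; case: (blk _).
by exists (fun _ => c) => // x; rewrite scaleffE.
Qed.

Definition cone Z := forall c u, c != 0 -> Z u -> Z (c *: u).
Definition vanish Z f := forall u, Z u -> pev u f = 0.

(** The value of [f] at [t *: u] is a polynomial in [t] whose coefficients are the values at [u] of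
    the homogeneous components. On a cone it vanishes for all [t != 0], hence identically. *)
Lemma vanish_pihomog Z f d : cone Z -> vanish Z f ->
  vanish Z (pihomog mdeg d f).
Proof.
move=> cZ vf u Zu; pose n := (maxn d (msize f)).+1.
pose q := \poly_(i < n) pev u (pihomog mdeg i f).
have: q = 0.
  apply: (@poly_generic_eq0 _ 'X); first by rewrite polyX_eq0.
  move=> t; rewrite hornerX => t0; have := vf _ (cZ _ _ t0 Zu).
  rewrite [f in pev _ f](@pihomog_partitionE _ _ mdeg n); last first.
    by rewrite /n; lia.
  move=> E; rewrite -[RHS]E rmorph_sum /= horner_poly; apply: eq_bigr => i _.
  rewrite (@homog_scale i _ t u (t *: u)) ?pihomogP // => [|x]; last exact: scaleffE.
  exact: mulrC.
move/(congr1 (fun p : {poly K} => p`_d)); rewrite coef_poly coef0 ifT //.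
by rewrite /n; lia.
Qed.

Definition zclosure Z : set V :=
  [set u | points K (PP I) u /\
     forall f, @is_multihomog K (PP I) f -> vanish Z f -> pev u f = 0].

Lemma zclosure_closed Z : zclosed (zclosure Z).
Proof.
exists [set f | @is_multihomog K (PP I) f /\ vanish Z f] => [f []//|].
apply/seteqP; split=> u [pu H]; split=> // f.
  by case=> hf vf; rewrite pevE; exact: H.
by move=> hf vf; rewrite -pevE; exact: H.
Qed.

Lemma zclosed_points Z : zclosed Z -> Z `<=` points K (PP I).
Proof. by case=> S _ -> u []. Qed.

Lemma subset_zclosure Z : Z `<=` points K (PP I) -> Z `<=` zclosure Z.
Proof. by move=> pZ u Zu; split; [exact: pZ|move=> f _; apply]. Qed.

Lemma zclosure_min Z X : zclosed X -> Z `<=` X -> zclosure Z `<=` X.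
Proof.
case=> S hS -> ZX u [pu H]; split=> // f Sf; rewrite pevE; apply: H.
  exact: hS.
by move=> v /ZX [_ /(_ f Sf)]; rewrite pevE.
Qed.

Lemma zclosed_sep Z u : zclosed Z -> points K (PP I) u -> ~ Z u ->
  exists f, [/\ @is_multihomog K (PP I) f, vanish Z f & pev u f != 0].
Proof.
case=> S hS -> pu nZ; have : exists f, S f /\ evalp (A := PP I) f u <> 0.
  by apply: contrapT => H; apply: nZ; split=> // f Sf; apply: contrapT => ne;
    apply: H; exists f.
case=> f [Sf /eqP]; rewrite pevE => ne; exists f; split=> //; first exact: hS.
by move=> v [_ /(_ f Sf)]; rewrite pevE.
Qed.

Lemma zclosed_cone Z : zclosed Z -> cone Z.
Proof.
case=> S hS -> c u c0 [/pointsPP[x ux] H]; split.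
  by apply/pointsPP; exists x; rewrite scaleffE mulf_neq0.
move=> f Sf; rewrite pevE; have /is_mhomogP [d hf] := hS _ Sf.
rewrite (@homog_scale d _ c u (c *: u)) // => [|y]; last exact: scaleffE.
by rewrite -pevE H // mulr0.
Qed.

(** On a cone the relations that pass to the closure need not be homogeneous, which spares a degree
    computation for each of them. *)
Lemma zclosure_vanish Z f u : cone Z -> vanish Z f -> zclosure Z u ->
  pev u f = 0.
Proof.
move=> cZ vf [_ H].
rewrite (@pihomog_partitionE _ _ mdeg (msize f) f) //.
rewrite rmorph_sum big1 //= => d _; apply: H; last exact: vanish_pihomog.
by apply/is_mhomogP; exists d; exact: pihomogP.
Qed.

Lemma zclosedU Z1 Z2 : zclosed Z1 -> zclosed Z2 -> zclosed (Z1 `|` Z2).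
Proof.
move=> c1 c2; have -> : Z1 `|` Z2 = zclosure (Z1 `|` Z2).
  have pU : Z1 `|` Z2 `<=` points K (PP I).
    by move=> u [/zclosed_points|/zclosed_points]; apply.
  apply/seteqP; split; first exact: subset_zclosure.
  move=> u [pu H]; apply: contrapT => /not_orP [n1 n2].
  have [f [/is_mhomogP[d hf] vf fu]] := zclosed_sep c1 pu n1.
  have [g [/is_mhomogP[e hg] vg gu]] := zclosed_sep c2 pu n2.
  have : pev u (f * g) = 0.
    apply: H => [|v []]; first by apply/is_mhomogP; exists (d + e)%N; apply: dhomogM.
      by rewrite rmorphM /= => /vf ->; rewrite mul0r.
    by rewrite rmorphM /= => /vg ->; rewrite mulr0.
  by move/eqP; rewrite rmorphM /= mulf_eq0 (negPf fu) (negPf gu).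
exact: zclosure_closed.
Qed.

Lemma irreducible_bigcup (T : finType) (F : T -> set V) (s : seq T) Z :
  irreducible Z -> (forall a, zclosed (F a)) ->
  Z `<=` [set u | exists2 a, a \in s & F a u] -> exists2 a, a \in s & Z `<=` F a.
Proof.
move=> [[z Zz] irr] cF; have c0 : zclosed (set0 : set V).
  exists [set 1] => [f ->|].
    by apply/is_mhomogP; exists 0%N; exact: dhomog1.
  apply/seteqP; split=> // u [_ /(_ 1 erefl)].
  by rewrite pevE rmorph1 => /eqP; rewrite oner_eq0.
have cU (r : seq T) : zclosed [set u | exists2 a, a \in r & F a u].
  elim: r => [|a r IH].
    by rewrite (_ : [set _ | _] = set0) //; apply/seteqP; split=> // u [].
  rewrite (_ : [set _ | _] = F a `|` [set u | exists2 a, a \in r & F a u]).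
    exact: zclosedU.
  apply/seteqP; split=> u.
    by case=> b; rewrite inE => /predU1P[->|br] Fu; [left|right; exists b].
  case=> [Fu|[b br Fu]]; first by exists a; rewrite ?mem_head.
  by exists b; rewrite // inE br orbT.
elim: s => [/(_ z Zz)[]//|a s IH] sub.
case: (irr _ _ (cF a) (cU s)).
- move=> u /sub [b]; rewrite inE => /predU1P[->|br] Fu; first by left.
  by right; exists b.
- by move=> h; exists a; rewrite ?mem_head.
- by move=> /IH [b bs h]; exists b; rewrite // inE bs orbT.
Qed.

(** Irreducibility speaks of forms only. For arbitrary [g] it is applied to each component: [f]
    times the component of degree [d] is the component of degree [e + d] of [f * g]. *)
Lemma irreducible_prime Z f g : irreducible Z -> cone Z ->
  Z `<=` points K (PP I) -> @is_multihomog K (PP I) f ->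
  vanish Z (f * g) -> vanish Z f \/ vanish Z g.
Proof.
move=> [Z0 irr] cZ pZ /is_mhomogP[e hf] vfg.
case: (pselect (vanish Z f)) => [|nf]; [by left|right].
have cl h : (exists d, h \is d.-homog) ->
    zclosed [set u | points K (PP I) u /\ pev u h = 0].
  move=> hh; exists [set h] => [_ ->|]; first exact/is_mhomogP.
  apply/seteqP; split=> u [pu H]; split=> //; first by move=> _ ->; rewrite pevE.
  by rewrite -pevE; exact: H.
have hom d : vanish Z (pihomog mdeg d g).
  have hd : pihomog mdeg d g \is d.-homog by exact: pihomogP.
  case: (irr _ _ (cl f (ex_intro _ e hf)) (cl _ (ex_intro _ d hd))).
  - move=> u Zu; have := vanish_pihomog (e + d) cZ vfg Zu.
    suff -> : pihomog mdeg (e + d) (f * g) = f * pihomog mdeg d g.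
      rewrite rmorphM /= => /eqP; rewrite mulf_eq0 => /orP[] /eqP E; [left|right];
        by split=> //; exact: pZ.
    rewrite [g in f * g](@pihomog_partitionE _ _ mdeg (maxn (msize g) d.+1)); last first.
      exact: leq_maxl.
    have dl : (d < maxn (msize g) d.+1)%N by rewrite leq_max ltnSn orbT.
    rewrite mulr_sumr linear_sum /= (bigD1 (Ordinal dl)) //= big1 ?addr0.
      by rewrite pihomog_dE // dhomogM // pihomogP.
    move=> i ni; apply: (@pihomog_ne0 _ _ _ (e + i)).
      by rewrite eqn_add2l; apply: contraNneq ni => E; apply/eqP/val_inj.
    by rewrite dhomogM // pihomogP.
  - by move=> sub; case: nf => u /sub [].
  - by move=> sub u /sub [].
move=> u Zu; rewrite (@pihomog_partitionE _ _ mdeg (msize g) g) //.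
by rewrite rmorph_sum big1 //= => d _; exact: hom.
Qed.

(** A criterion for irreducibility suited to parametrized sets: the parameters of two points are
    joined by a segment. The curve may pass through the zero vector, which is no point of projective
    space. *)
Definition curve_conn Z := forall u1 u2, Z u1 -> Z u2 ->
  exists g : I -> {poly K}, [/\ forall x, (g x).[0] = u1 x,
    forall x, (g x).[1] = u2 x &
    forall t u, (forall x, u x = (g x).[t]) -> (exists x, u x != 0) -> Z u].

(** Along the curve [f1] and [f2] restrict to nonzero polynomials in [t], and so does a coordinate
    nonzero at [u1], which keeps the vector nonzero. Their product has a nonroot. *)
Lemma curve_conn_mul Z f1 f2 u1 u2 : curve_conn Z ->
  Z `<=` points K (PP I) ->
  Z u1 -> Z u2 -> pev u1 f1 != 0 -> pev u2 f2 != 0 ->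
  exists u, [/\ Z u, pev u f1 != 0 & pev u f2 != 0].
Proof.
move=> cZ pZ Z1 Z2 n1 n2; have [g [g1 g2 gZ]] := cZ _ _ Z1 Z2.
have /pointsPP [x ux] := pZ _ Z1.
have q0 (h : {poly K}) t : h.[t] != 0 -> h != 0.
  by apply: contra => /eqP ->; rewrite horner0.
pose q := ev g f1 * ev g f2 * g x.
have: q != 0.
  rewrite !mulf_neq0 //; [apply: (q0 _ 0)|apply: (q0 _ 1)|apply: (q0 _ 0)].
  - by rewrite pev_horner (pev_ext _ g1).
  - by rewrite pev_horner (pev_ext _ g2).
  - by rewrite g1.
move/eqP => qn; have [t qt] : exists t, q.[t] != 0.
  apply: contrapT => H; apply/qn/poly_inf_eq0 => t.
  by apply/eqP; apply: contraT => ne; case: H; exists t.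
move: qt; rewrite !hornerM !mulf_eq0 !negb_or !pev_horner => /andP[/andP[h1 h2] hx].
have E : (fun y => (g y).[t]) =1 ([ffun y => (g y).[t]] : V).
  by move=> y; rewrite ffunE.
exists [ffun y => (g y).[t]]; rewrite -!(pev_ext _ E); split=> //.
by apply: (gZ t) => [y|]; [rewrite ffunE|exists x; rewrite ffunE].
Qed.

Lemma curve_conn_irr Z : curve_conn Z -> Z `<=` points K (PP I) -> Z !=set0 ->
  irreducible Z.
Proof.
move=> cZ pZ Z0; split=> // Z1 Z2 c1 c2 sub.
case: (pselect (Z `<=` Z1)) => [|/existsNP[u1 /not_implyP[Zu1 n1]]]; first by left.
case: (pselect (Z `<=` Z2)) => [|/existsNP[u2 /not_implyP[Zu2 n2]]]; first by right.
have [f1 [_ v1 h1]] := zclosed_sep c1 (pZ _ Zu1) n1.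
have [f2 [_ v2 h2]] := zclosed_sep c2 (pZ _ Zu2) n2.
have [u [Zu]] := curve_conn_mul cZ pZ Zu1 Zu2 h1 h2.
by case: (sub u Zu) => [/v1|/v2] ->; rewrite eqxx.
Qed.

Lemma irreducible_closure Z : Z `<=` points K (PP I) -> irreducible Z ->
  irreducible (zclosure Z).
Proof.
move=> pZ [[z Zz] irr]; split; first by exists z; exact: subset_zclosure.
move=> Z1 Z2 c1 c2 sub.
have sub' : Z `<=` Z1 `|` Z2 by move=> u /(subset_zclosure pZ)/sub.
by case: (irr _ _ c1 c2 sub') => h; [left|right]; apply: zclosure_min.
Qed.

End PPI.
End Zariski.

(** * Chains of irreducible closed sets *)

Section Dimension.
Variables (K : fieldType) (ch0 : forall n, n.+1%:R != 0 :> K) (I : finType).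
Local Notation mp := {mpoly K[#|I|]}.
Local Notation V := (vec K (PP I)).
Implicit Types (Z X : set V) (u v : V) (f g h : mp).

(** Exponent vectors with [n] entries below [D], as a nested product so that [monom] can recurse
    along the list of polynomials. *)
Fixpoint midx (n D : nat) : finType :=
  if n is n'.+1 then (midx n' D * 'I_D)%type : finType else unit.

Fixpoint monom (gs : seq mp) (D : nat) : midx (size gs) D -> mp :=
  match gs return midx (size gs) D -> mp with
  | [::] => fun _ => 1
  | g :: gs' => fun a => monom a.1 * g ^+ a.2
  end.
Arguments monom : clear implicits.

Definition alg_indep (gs : seq mp) Z := forall D (c : midx (size gs) D -> K),
  vanish Z (\sum_a c a *: monom gs D a) -> forall a, c a = 0.

Lemma card_midx n D : #|midx n D| = (D ^ n)%N.
Proof.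
elim: n => [|n IH] /=; first by rewrite card_unit.
by rewrite card_prod IH card_ord expnSr.
Qed.

(** Sets are handled as cones, so that even a single point carries one independent function; this is
    the start of the count along a chain. *)
Lemma alg_indep_point Z u x : cone Z -> Z u -> u x != 0 ->
  alg_indep [:: mvar K x] Z.
Proof.
move=> cZ Zu ux D c vc [[] j].
pose q := \poly_(i < D) (if insub i is Some i' then c (tt, i') else 0).
suff /(congr1 (fun p : {poly K} => p`_j)) : q = 0.
  by rewrite coef_poly ltn_ord coef0 valK.
apply: (poly_generic_eq0 ch0 (q := 'X)); first by rewrite polyX_eq0.
move=> t; rewrite hornerX => t0.
have lx : t / u x != 0 by rewrite mulf_neq0 ?invr_eq0.
have <- := vc _ (cZ _ _ lx Zu).
rewrite rmorph_sum /= horner_poly.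
rewrite (reindex (fun j : 'I_D => (tt, j))) /=; last first.
  by exists (fun p => p.2) => [//|[[] i]].
apply: eq_bigr => i _; rewrite pev_scale mul1r rmorphXn /= pev_var.
by rewrite scaleffE divfK // valK.
Qed.

(** Write a relation on [Z'] as the sum of the [f ^+ i * h i], with [h i] in the [gs]. If the [h j]
    with [j < i] are zero, [f ^+ i] cancels by primality; restricting to [Z], where [f] vanishes,
    leaves [h i], whose coefficients are zero by independence on [Z]. *)
Lemma alg_indep_step gs f Z Z' : alg_indep gs Z -> Z `<=` Z' ->
  irreducible Z' -> zclosed Z' -> @is_multihomog K (PP I) f ->
  vanish Z f -> ~ vanish Z' f -> alg_indep (f :: gs) Z'.
Proof.
move=> aZ ZZ' iZ' cZ' hf vf nvf D c vc.
pose h (i : 'I_D) := \sum_a c (a, i) *: monom gs D a.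
have E : \sum_a c a *: monom (f :: gs) D a = \sum_(i < D) f ^+ i * h i.
  transitivity (\sum_(i < D) \sum_(a : midx (size gs) D) c (a, i) *: monom (f :: gs) D (a, i)).
    rewrite exchange_big pair_bigA /=; apply: eq_bigr => a _.
    by rewrite -surjective_pairing.
  apply: eq_bigr => i _; rewrite /h mulr_sumr; apply: eq_bigr => a _ /=.
  by rewrite [RHS]mulrC scalerAl.
have dv k g : vanish Z' (f ^+ k * g) -> vanish Z' g.
  elim: k g => [|k IH] g; first by rewrite expr0 mul1r.
  rewrite exprS -mulrA => vg; apply: IH.
  by case: (irreducible_prime ch0 iZ' (zclosed_cone cZ') (zclosed_points cZ') hf vg).
suff H (m : nat) (i : 'I_D) : i = m :> nat -> forall a, c (a, i) = 0.
  by move=> [a i]; exact: (H i).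
elim/ltn_ind: m i => m IH i im; apply: aZ => u Zu.
pose r := \sum_(j < D | (i < j)%N) f ^+ (j - i).-1 * h j.
have /dv v1 : vanish Z' (f ^+ i * (h i + f * r)).
  move=> v Z'v; rewrite -[RHS](vc _ Z'v) E; congr (pev v).
  rewrite mulrDr (bigD1 i) //=; congr (_ + _).
  rewrite [RHS](bigID (fun j : 'I_D => (i < j)%N)) /= [X in _ = _ + X]big1 ?addr0.
    rewrite !mulr_sumr; apply: eq_big => j; first by rewrite -val_eqE /=; lia.
    move=> ij; rewrite !mulrA -exprSr -exprD; congr (_ ^+ _ * _).
    by lia.
  move=> j /andP[ji jli]; rewrite /h big1 ?mulr0 // => a _.
  by rewrite (IH j) ?scale0r //; move: ji jli; rewrite -val_eqE /=; lia.
have := v1 u (ZZ' _ Zu); rewrite rmorphD rmorphM /= (vf _ Zu) mul0r addr0.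
by move=> <-.
Qed.

Lemma msize_prod_le n (R : idomainType) (p q : {mpoly R[n]}) a b :
  (msize p <= a.+1)%N -> (msize q <= b.+1)%N -> (msize (p * q) <= (a + b).+1)%N.
Proof.
case: (eqVneq p 0) => [->|p0]; first by rewrite mul0r msize0.
case: (eqVneq q 0) => [->|q0]; first by rewrite mulr0 msize0.
by rewrite msizeM //; lia.
Qed.

(** A count of monomials replaces transcendence degree: the [D ^ size gs] monomials pull back to
    linearly independent polynomials in [#|P|] variables whose degree grows linearly in [D], so
    their number is at most of order [D ^ #|P|]. *)
Lemma alg_indep_size gs X (P : finType) (phi : I -> {mpoly K[#|P|]}) :
  alg_indep gs X -> (forall f, ev phi f = 0 -> vanish X f) ->
  (size gs <= #|P|)%N.
Proof.
move=> aX dX.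
have [c cP] : exists c, forall g, g \in gs -> (msize (ev phi g) <= c.+1)%N.
  exists (\max_(g <- gs) msize (ev phi g)) => g ggs.
  by apply: leqW; apply: (leq_bigmax_seq (F := fun g => msize (ev phi g))).
have sz D a : (msize (ev phi (monom gs D a)) <= (size gs * (D * c)).+1)%N.
  elim: (gs) cP a => [|g s IH] sP a /=; first by rewrite rmorph1 msize1.
  rewrite rmorphM /= mulSn addnC; apply: msize_prod_le.
    by apply: IH => h hs; apply: sP; rewrite inE hs orbT.
  have aD : (a.2 * c <= D * c)%N by rewrite leq_mul2r ltnW ?orbT.
  apply: (@leq_trans (a.2 * c).+1) => //.
  elim: (nat_of_ord a.2) => [|k IHk]; first by rewrite expr0 rmorph1 msize1.
  by rewrite exprS rmorphM mulSn; apply: msize_prod_le => //; apply: sP; exact: mem_head.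
have card_le D : (D ^ size gs <= (size gs * (D * c)).+1 ^ #|P|)%N.
  (* Every single exponent is below [B], so the pulled back monomials lie in a space of dimension
     [B ^ #|P|]; this cruder box is enough. *)
  set B := (size gs * (D * c)).+1.
  pose T := {ffun 'I_#|P| -> 'I_B}.
  rewrite -card_midx -[X in (_ <= X ^ _)%N]card_ord -[X in (_ <= _ ^ X)%N]card_ord.
  rewrite -card_ffun.
  pose mu (t : 'I_#|T|) : 'X_{1..#|P|} := [multinom (enum_val t i : nat) | i < #|P|].
  pose M := \matrix_(a < #|midx (size gs) D|, t < #|T|)
    (ev phi (monom gs D (enum_val a)))@_(mu t).
  suff : row_free M by rewrite /row_free => /eqP <-; exact: rank_leq_col.
  rewrite -kermx_eq0; apply/rowV0P => w /sub_kermxP wM; apply/rowP => a.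
  rewrite mxE -(enum_valK a); move: (enum_val a) => {}a.
  apply: (aX D (fun a => w 0 (enum_rank a))); apply: dX.
  apply/mpolyP => m; rewrite mcoeff0 rmorph_sum /=.
  have -> : (\sum_a0 ev phi (w 0 (enum_rank a0) *: monom gs D a0))@_m =
      \sum_a0 w 0 (enum_rank a0) * (ev phi (monom gs D a0))@_m.
    by rewrite raddf_sum; apply: eq_bigr => b _; rewrite /= ev_scale mcoeffZ.
  have [mB|mB] := ltnP (mdeg m) B; last first.
    rewrite big1 // => b _; rewrite memN_msupp_eq0 ?mulr0 //.
    by apply: msize_mdeg_ge; apply: leq_trans mB; exact: sz.
  have mi i : (m i < B)%N.
    by apply: leq_ltn_trans mB; rewrite mdegE (bigD1 i) //= leq_addr.
  have := congr1 (fun v : 'rV_#|T| => v 0 (enum_rank [ffun i => Ordinal (mi i)])) wM.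
  rewrite !mxE => E; rewrite -[RHS]E (reindex _ (onW_bij _ (enum_val_bij _))) /=.
  apply: eq_bigr => b _; rewrite enum_valK mxE; congr (_ * _@__).
  by apply/mnmP => i; rewrite mnmE enum_rankK ffunE.
rewrite leqNgt; apply/negP => lt.
(* At [D = C.+1] the bound is at most [C * C.+1 ^ #|P|], whereas [size gs > #|P|] would force it to
   be at least [C.+1 ^ #|P|.+1]. *)
pose C := ((size gs * c).+1 ^ #|P|)%N.
have := card_le C.+1.
have h1 : (C.+1 ^ (#|P|.+1) <= C.+1 ^ size gs)%N by rewrite leq_pexp2l.
have h2 : ((size gs * (C.+1 * c)).+1 ^ #|P| <= C * C.+1 ^ #|P|)%N.
  rewrite /C -expnMn; case: #|P| => [|e]; first by rewrite !expn0.
  by rewrite leq_exp2r //; nia.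
move=> h3; have := leq_trans h1 (leq_trans h3 h2).
by rewrite expnS leq_pmul2r ?expn_gt0 // ltnn.
Qed.

Lemma chain_bound Z X r (P : finType) (phi : I -> {mpoly K[#|P|]}) :
  chain_between Z X r -> (forall f, ev phi f = 0 -> vanish X f) ->
  (r < #|P|)%N.
Proof.
case=> F [_ HF SF] dX.
suff [gs [sgs ags]] : exists gs, size gs = r.+1 /\ alg_indep gs (F r).
  rewrite -sgs; apply: (alg_indep_size (X := X) _ dX) => D c vc; apply: ags.
  by move=> u Fu; apply: vc; case: (HF r) => // _ _; apply.
have: forall i, (i <= r)%N -> exists gs, size gs = i.+1 /\ alg_indep gs (F i).
  elim=> [|i IH] ir.
    have [cF [[u Fu] _] _] := HF 0%N ir; have /pointsPP[x ux] := zclosed_points cF Fu.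
    by exists [:: mvar K x]; split=> //; apply: alg_indep_point Fu ux; exact: zclosed_cone.
  have [gs [sgs ags]] := IH (ltnW ir).
  have [sub /existsNP[u /not_implyP[Fu nFu]]] := SF i ir.
  have [cF1 iF1 _] := HF _ ir; have [cF0 _ _] := HF _ (ltnW ir).
  have [f [hf vf fu]] := zclosed_sep cF0 (zclosed_points cF1 Fu) nFu.
  exists (f :: gs); split; first by rewrite /= sgs.
  apply: alg_indep_step ags _ iF1 cF1 hf vf _ => // /(_ _ Fu) E.
  by rewrite E eqxx in fu.
by apply.
Qed.

Definition chain (F : nat -> set V) X r :=
  (forall i, (i <= r)%N -> [/\ zclosed (F i), irreducible (F i) & F i `<=` X]) /\
  (forall i, (i < r)%N -> F i `<` F i.+1).

Lemma chain_cat G X r s : chain G X s ->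
  chain_between (G s) X r -> chain_between (G 0%N) X (s + r).
Proof.
move=> [HG SG] [F [F0 HF SF]].
exists (fun i => if (i < s)%N then G i else F (i - s)%N); split.
- by case: s HG SG F0 => [|s] HG SG //=.
- by move=> i ile; case: ltnP => h; [apply: HG; exact: ltnW|apply: HF; lia].
move=> i ilt; case: ltnP => h; case: ltnP => h'.
- exact: SG.
- have -> : i.+1 = s by lia.
  by rewrite subnn F0 (_ : G s = G i.+1); [exact: SG|congr G; lia].
- lia.
- by rewrite subSn //; apply: SF; lia.
Qed.

Lemma chain_drop F X r i : chain F X r -> (i <= r)%N ->
  chain_between (F i) X (r - i).
Proof.
move=> [HF SF] ir; exists (fun j => F (i + j)%N); split; first by rewrite addn0.
  by move=> j jr; apply: HF; lia.
by move=> j jr; rewrite addnS; apply: SF; lia.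
Qed.

Lemma chain_take F X r i : chain F X r -> (i <= r)%N -> chain F X i.
Proof.
by move=> [HF SF] ir; split=> j ji; [apply: HF|apply: SF]; lia.
Qed.

(** * Chains obtained by freeing the variables of a parametrization *)

Section Flag.
Variables (P : finType) (Psi : I -> {mpoly K[#|P|]}) (b : P -> K) (s : seq P).

Definition fslice i : set (P -> K) :=
  [set z | forall p, p \notin take i s -> z p = b p].

(* The projective image under [Psi] of the affine space obtained by letting the
   first [i] coordinates of [s] vary, the others being those of [b]. *)
Definition fimage i : set V :=
  [set u | points K (PP I) u /\
     exists l z, fslice i z /\ forall x, u x = l * pev z (Psi x)].

Lemma fslice_sub i : fslice i `<=` fslice i.+1.
Proof.
move=> z h p pj; apply: h; apply: contra pj => pi.
by rewrite -addn1 takeD mem_cat pi.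
Qed.

Variable X : set V.
Hypothesis cX : zclosed X.
Hypothesis PX : forall u l z,
  points K (PP I) u -> (forall x, u x = l * pev z (Psi x)) -> X u.
Hypothesis b0 : exists x, pev b (Psi x) != 0.
Hypothesis sep : forall i, (i < size s)%N -> exists f,
  [/\ @is_multihomog K (PP I) f,
      forall z, fslice i z -> pev (fun x => pev z (Psi x)) f = 0 &
      exists2 z, fslice i.+1 z & pev (fun x => pev z (Psi x)) f != 0].

Lemma fimage_points i : fimage i `<=` points K (PP I).
Proof. by move=> u []. Qed.

(** The parameters [z] and the scalar [l] of two points are joined by segments; a slice is affine,
    hence contains the segment. *)
Lemma fimage_irr i : irreducible (fimage i).
Proof.
apply: (curve_conn_irr ch0) => [|u []//|].
  move=> u1 u2 [p1 [l1 [z1 [h1 E1]]]] [p2 [l2 [z2 [h2 E2]]]].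
  pose zt (p : P) := (z1 p)%:P + 'X * (z2 p - z1 p)%:P.
  exists (fun x => (l1%:P + 'X * (l2 - l1)%:P) * ev zt (Psi x)); split.
  - move=> x; rewrite E1 !hornerE pev_horner; congr (_ * _).
    by apply: pev_ext => p; rewrite /zt !hornerE.
  - move=> x; rewrite E2 !hornerE pev_horner; congr (_ * _).
      by rewrite /=; ring.
    by apply: pev_ext => p; rewrite /zt !hornerE /=; ring.
  move=> t u uE pu; split; first exact/pointsPP.
  exists (l1 + t * (l2 - l1)), (fun p => z1 p + t * (z2 p - z1 p)); split.
    by move=> p hp; rewrite h1 // h2 // subrr mulr0 addr0.
  move=> x; rewrite uE !hornerE pev_horner; congr (_ * _).
  by apply: pev_ext => p; rewrite /zt !hornerE.
have [x bx] := b0.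
exists [ffun x => pev b (Psi x)]; split; first by apply/pointsPP; exists x; rewrite ffunE.
by exists 1, b; split=> [p _//|y]; rewrite ffunE mul1r.
Qed.

Lemma flag_chain : chain (fun i => zclosure (fimage i)) X (size s).
Proof.
split=> [i _|i ilt].
  split; first exact: zclosure_closed.
    by apply: irreducible_closure; [exact: fimage_points|exact: fimage_irr].
  by apply: zclosure_min => // u [pu [l [z [_ E]]]]; exact: PX E.
have sub : fimage i `<=` fimage i.+1.
  move=> u [pu [l [z [hz E]]]]; split=> //; exists l, z; split=> //.
  exact: fslice_sub.
split.
  apply: zclosure_min; first exact: zclosure_closed.
  by move=> u /sub; apply: subset_zclosure; exact: fimage_points.
have [f [hf v0 [z hz nz]]] := sep ilt.
have [d fd] := (is_mhomogP f).1 hf.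
pose u : V := [ffun x => pev z (Psi x)].
have uE : u =1 (fun x => pev z (Psi x)) by move=> x; rewrite ffunE.
have pu : points K (PP I) u.
  (* Were the image of [z] the zero vector, [f] would take there [0 ^+ d] times its value at the
     image of [b], and the latter is zero since [b] lies in every slice. This covers degree 0 as
     well. *)
  apply/pointsPP; apply: contrapT => H; move: nz.
  rewrite (homog_scale (c := 0) (u := fun x => pev b (Psi x)) fd) ?v0 ?mulr0 ?eqxx //.
  move=> x; rewrite mul0r -uE; apply/eqP; apply: contraT => ne.
  by case: H; exists x.
have gu : fimage i.+1 u by split=> //; exists 1, z; split=> // x; rewrite mul1r uE.
move=> /(_ u (subset_zclosure (@fimage_points _) gu)) [_ /(_ f hf) E].
move: nz; rewrite -(pev_ext f uE) E ?eqxx // => v [_ [l [y [hy vE]]]].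
by rewrite (homog_scale fd vE) v0 // mulr0.
Qed.

End Flag.

End Dimension.

(** * Tensors and charts *)

Section Tensors.
Variables (J : finType) (k : J -> nat).
Local Notation idx := (tensor_index k).
Local Notation pt := {l : J & 'I_(k l).+1}.
Implicit Types (x o : idx) (l m : J) (p q r : pt).

Definition upd x (p : pt) : idx :=
  finfun (dfwith (fun m => x m) (tagged p)).

Lemma upd_in x p : upd x p (tag p) = tagged p.
Proof. by rewrite ffunE dfwith_in. Qed.

Lemma upd_out x p m : tag p != m -> upd x p m = x m.
Proof. by move=> h; rewrite ffunE dfwith_out. Qed.

(** Thus [upd x (at_ o l)] resets the factor [l] of [x] to its index in [o]. *)
Definition at_ x l : pt := Tagged _ (x l).

Lemma upd_id x l : upd x (at_ x l) = x.
Proof.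
apply/ffunP => m; case: (eqVneq l m) => [<-|lm]; first by rewrite (upd_in x (at_ x l)).
by rewrite upd_out.
Qed.

Lemma upd_upd x p q : tag p = tag q -> upd (upd x p) q = upd x q.
Proof.
move=> e; apply/ffunP => m; case: (eqVneq (tag q) m) => [<-|lm].
  by rewrite !upd_in.
by rewrite !upd_out // e.
Qed.

Lemma updC x p q : tag p != tag q -> upd (upd x p) q = upd (upd x q) p.
Proof.
move=> ne; apply/ffunP => m; case: (eqVneq (tag q) m) => [<-|qm].
  by rewrite upd_in upd_out // upd_in.
case: (eqVneq (tag p) m) => [<-|pm]; last by rewrite !upd_out.
by rewrite upd_in upd_out 1?eq_sym // upd_in.
Qed.

Section Ring.
Variable A : comNzRingType.
Definition mvec := forall l, 'I_(k l).+1 -> A.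
Implicit Types (X Y v w : mvec) (u : idx -> A) (Q : pred J).

Definition tensP Q v x := \prod_(l | Q l) v l (x l).
Definition dtenP Q v w x :=
  \sum_(l | Q l) w l (x l) * \prod_(m | Q m && (m != l)) v m (x m).
Definition tens := tensP predT.
Definition dten := dtenP predT.
Definition par a X Y x := a * tens X x + dten X Y x.

Lemma tensP_ext Q v v' x : (forall l, Q l -> v l =1 v' l) -> tensP Q v x = tensP Q v' x.
Proof. by move=> h; apply: eq_bigr => l /h ->. Qed.

Lemma dtenP_ext Q v v' w w' x : (forall l, Q l -> v l =1 v' l) ->
  (forall l, Q l -> w l =1 w' l) -> dtenP Q v w x = dtenP Q v' w' x.
Proof.
move=> h h'; apply: eq_bigr => l Ql; rewrite h' //; congr (_ * _).
by apply: eq_bigr => m /andP[Qm _]; rewrite h.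
Qed.

Lemma tensP_eq Q v (x y : idx) : (forall l, Q l -> x l = y l) -> tensP Q v x = tensP Q v y.
Proof. by move=> h; apply: eq_bigr => l /h ->. Qed.

Lemma dtenP_eq Q v w (x y : idx) : (forall l, Q l -> x l = y l) ->
  dtenP Q v w x = dtenP Q v w y.
Proof.
move=> h; apply: eq_bigr => l Ql; rewrite h //; congr (_ * _).
by apply: eq_bigr => m /andP[Qm _]; rewrite h.
Qed.

Lemma tensP_pred Q Q' v x : Q =1 Q' -> tensP Q v x = tensP Q' v x.
Proof. exact: eq_bigl. Qed.

Lemma dtenP_pred Q Q' v w x : Q =1 Q' -> dtenP Q v w x = dtenP Q' v w x.
Proof.
move=> h; rewrite /dtenP (eq_bigl _ _ h); apply: eq_bigr => l _; congr (_ * _).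
by apply: eq_bigl => m; rewrite h.
Qed.

Definition less Q l : pred J := fun m => Q m && (m != l).

Lemma tensP_D1 Q v x l : Q l -> tensP Q v x = v l (x l) * tensP (less Q l) v x.
Proof. by move=> Ql; rewrite /tensP (bigD1 l). Qed.

Lemma dtenP_D1 Q v w x l : Q l ->
  dtenP Q v w x = w l (x l) * tensP (less Q l) v x + v l (x l) * dtenP (less Q l) v w x.
Proof.
move=> Ql; rewrite /dtenP (bigD1 l) //=; congr (_ + _).
rewrite mulr_sumr; apply: eq_bigr => m /andP[Qm ml].
rewrite mulrCA (bigD1 l) /= ?Ql 1?eq_sym //; congr (_ * (_ * _)).
by apply: eq_bigl => r; rewrite /less andbAC.
Qed.

Lemma tensP_upd Q v x p : Q (tag p) ->
  tensP Q v (upd x p) = v _ (tagged p) * tensP (less Q (tag p)) v x.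
Proof.
move=> Qp; rewrite (tensP_D1 _ _ Qp) upd_in; congr (_ * _).
by apply: tensP_eq => l /andP[_ lp]; rewrite upd_out // eq_sym.
Qed.

Lemma dtenP_upd Q v w x p : Q (tag p) ->
  dtenP Q v w (upd x p) = w _ (tagged p) * tensP (less Q (tag p)) v x
    + v _ (tagged p) * dtenP (less Q (tag p)) v w x.
Proof.
move=> Qp; rewrite (dtenP_D1 _ _ _ Qp) upd_in; congr (_ * _ + _ * _).
  by apply: tensP_eq => l /andP[_ lp]; rewrite upd_out // eq_sym.
by apply: dtenP_eq => l /andP[_ lp]; rewrite upd_out // eq_sym.
Qed.

Lemma tensP_out Q v x p : ~~ Q (tag p) -> tensP Q v (upd x p) = tensP Q v x.
Proof.
move=> nQ; apply: tensP_eq => l Ql; rewrite upd_out //.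
by apply: contraNneq nQ => ->.
Qed.

Lemma tensP_scale Q (c : J -> A) v x :
  tensP Q (fun l i => c l * v l i) x = \prod_(l | Q l) c l * tensP Q v x.
Proof. exact: big_split. Qed.

Lemma dtenP_scale Q (c : J -> A) v w x :
  dtenP Q (fun l i => c l * v l i) (fun l i => c l * w l i) x =
  \prod_(l | Q l) c l * dtenP Q v w x.
Proof.
rewrite /dtenP mulr_sumr; apply: eq_bigr => l Ql.
rewrite big_split /= (bigD1 (P := Q) l) //=; ring.
Qed.

Lemma dten_linear (c : A) v w w' x :
  dten v (fun l i => c * w l i + w' l i) x = c * dten v w x + dten v w' x.
Proof.
rewrite /dten /dtenP mulr_sumr -big_split; apply: eq_bigr => l _ /=; ring.
Qed.

Lemma dten_scale (c : A) v w x : dten v (fun l i => c * w l i) x = c * dten v w x.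
Proof. by rewrite /dten /dtenP mulr_sumr; apply: eq_bigr => l _; rewrite mulrA. Qed.

Lemma dtenD v w w' x :
  dten v (fun l i => w l i + w' l i) x = dten v w x + dten v w' x.
Proof. by rewrite /dten /dtenP -big_split; apply: eq_bigr => l _; rewrite mulrDl. Qed.

(* The multiple [a] of the point of tangency can be absorbed in any one of the
   tangent directions. *)
Lemma par_dten a X Y l : par a X Y =1
  dten X (fun m i => if m == l then a * X m i + Y m i else Y m i).
Proof.
move=> x; rewrite /par /tens /dten (tensP_D1 _ _ (isT : predT l)) !(dtenP_D1 _ _ _ (isT : predT l)).
rewrite eqxx (dtenP_ext (v' := X) (w' := Y)) => [||m /andP[_ /negPf ->]] //.
ring.
Qed.

(* Quadratic, cubic ... coordinates built from the entries of a tensor that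
   differ from the entry at [o] in at most three places.  On the chart
   [par a X Y] of the tangential variety they are monomials in [Y]. *)
Definition quad u o p q := u (upd o p) * u (upd o q) - u o * u (upd (upd o p) q).
Definition cubic u o p q r :=
  u o ^+ 2 * u (upd (upd (upd o p) q) r)
  - u o * (u (upd o p) * u (upd (upd o q) r) + u (upd o q) * u (upd (upd o p) r)
           + u (upd o r) * u (upd (upd o p) q))
  + 2 * (u (upd o p) * u (upd o q) * u (upd o r)).
Definition base u o p q r :=
  u (upd o q) * u (upd (upd o p) r) + u (upd o r) * u (upd (upd o p) q)
  - u (upd o p) * u (upd (upd o q) r) - u o * u (upd (upd (upd o p) q) r).
(** A 2x2 minor of the flattening of [u] that separates the factor [l] from all others; it vanishes
    when [u] splits off this factor. *)
Definition flat u o x l := u x * u o - u (upd x (at_ o l)) * u (upd o (at_ x l)).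
(** Built to equal [2 Y_l Y_m D] on a chart, where [D] is the derivative of the product over the
    remaining factors: an analogue of [cubic] with a whole block of factors in the third place. *)
Definition flat2 u o x l m :=
  u o * flat u o x l
  + u (upd (upd x (at_ o l)) (at_ o m)) * quad u o (at_ x l) (at_ x m)
  - u (upd o (at_ x m)) * flat u o (upd x (at_ o m)) l.

Definition chart o X Y := forall l, X l (o l) = 1 /\ Y l (o l) = 0.

Section Chart.
Variables (o : idx) (a : A) (X Y : mvec).
Hypothesis oXY : chart o X Y.
Local Notation f := (par a X Y).
Local Notation "X ![ p ]" := (X (tag p) (tagged p)) (at level 2, left associativity, format "X ![ p ]").

Lemma tensP_chart Q : tensP Q X o = 1.
Proof. by rewrite /tensP big1 // => l _; case: (oXY l). Qed.
Lemma dtenP_chart Q : dtenP Q X Y o = 0.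
Proof. by rewrite /dtenP big1 // => l _; case: (oXY l) => _ ->; rewrite mul0r. Qed.

Lemma par0 : f o = a.
Proof. by rewrite /par /tens /dten tensP_chart dtenP_chart; ring. Qed.

Lemma par1 p : f (upd o p) = a * X![p] + Y![p].
Proof.
rewrite /par /tens /dten tensP_upd // dtenP_upd // tensP_chart dtenP_chart; ring.
Qed.

Lemma par2 p q : tag p != tag q ->
  f (upd (upd o p) q) = a * (X![p] * X![q]) + X![p] * Y![q] + Y![p] * X![q].
Proof.
move=> pq; rewrite /par /tens /dten !(tensP_upd, dtenP_upd) /less //=.
rewrite tensP_chart dtenP_chart; ring.
Qed.

Lemma par3 p q r : tag p != tag q -> tag p != tag r -> tag q != tag r ->
  f (upd (upd (upd o p) q) r) = a * (X![p] * X![q] * X![r]) + Y![p] * X![q] * X![r]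
    + X![p] * Y![q] * X![r] + X![p] * X![q] * Y![r].
Proof.
move=> pq pr qr; rewrite /par /tens /dten !(tensP_upd, dtenP_upd) /less //= ?pq ?pr ?qr //.
rewrite tensP_chart dtenP_chart; ring.
Qed.

Lemma quad_par p q : tag p != tag q -> quad f o p q = Y![p] * Y![q].
Proof. by move=> pq; rewrite /quad par2 // !par1 par0; ring. Qed.

Lemma cubic_par p q r : tag p != tag q -> tag p != tag r -> tag q != tag r ->
  cubic f o p q r = 2 * (Y![p] * Y![q] * Y![r]).
Proof. by move=> pq pr qr; rewrite /cubic par3 // !par2 // !par1 par0; ring. Qed.

Lemma base_par p q r : tag p != tag q -> tag p != tag r -> tag q != tag r ->
  base f o p q r = X![p] * (2 * (Y![q] * Y![r])).
Proof. by move=> pq pr qr; rewrite /base par3 // !par2 // !par1 par0; ring. Qed.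

Lemma flat_par x l : flat f o x l = - (Y![at_ x l] * dtenP (less predT l) X Y x).
Proof.
rewrite /flat par1 par0 -{1}(upd_id x l) /par /tens /dten !(tensP_upd, dtenP_upd) //=.
case: (oXY l) => -> ->; ring.
Qed.

(** The left side is the square of [2 Y_l Y_m D]; on the right the two values of [flat] are
    [- Y_l D] and [- Y_m D], and [quad] is [Y_l Y_m]. *)
Lemma flat2_par x l m : l != m ->
  flat2 f o x l m ^+ 2 = 4 * flat f o (upd x (at_ o m)) l *
    quad f o (at_ x l) (at_ x m) * flat f o (upd x (at_ o l)) m.
Proof.
move=> lm; have ml : m != l by rewrite eq_sym.
have el : at_ (upd x (at_ o m)) l = at_ x l by rewrite /at_ upd_out.
have em : at_ (upd x (at_ o l)) m = at_ x m by rewrite /at_ upd_out.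
rewrite /flat2 quad_par // !flat_par el em par1 par0.
case: (oXY l) (oXY m) => Xl Yl [Xm Ym].
have Qm : less predT l m by rewrite /less ml.
have Ql : less predT m l by rewrite /less lm.
rewrite /par /tens /dten (dtenP_D1 X Y x Qm).
rewrite !(tensP_upd, dtenP_upd) //= ?/less /= ?lm ?ml //.
rewrite Xl Yl Xm Ym.
rewrite [dtenP (fun z => (z != m) && (z != l)) X Y x](dtenP_pred _ _ _ (Q' := fun z => (z != l) && (z != m))) => [|z]; last exact: andbC.
rewrite ?[tensP (fun z => (z != m) && (z != l)) X x](tensP_pred _ _ (Q' := fun z => (z != l) && (z != m))) => [|z]; last exact: andbC.
set w0 := tensP _ X x; set w1 := dtenP _ X Y x.
ring.
Qed.

End Chart.
End Ring.
End Tensors.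

Section Naturality.
Variables (J : finType) (k : J -> nat) (A B : comNzRingType) (g : {rmorphism A -> B}).
Local Notation idx := (tensor_index k).

Lemma rmorph_tensP Q (v : mvec k A) x :
  g (tensP Q v x) = tensP Q (fun l i => g (v l i)) x.
Proof. exact: rmorph_prod. Qed.

Lemma rmorph_dten (v w : mvec k A) x :
  g (dten v w x) = dten (fun l i => g (v l i)) (fun l i => g (w l i)) x.
Proof.
by rewrite /dten /dtenP rmorph_sum; apply: eq_bigr => l _; rewrite rmorphM rmorph_prod.
Qed.

Lemma rmorph_par a (v w : mvec k A) x :
  g (par a v w x) = par (g a) (fun l i => g (v l i)) (fun l i => g (w l i)) x.
Proof. by rewrite /par rmorphD rmorphM rmorph_tensP rmorph_dten. Qed.

Variables (u : idx -> A) (o : idx).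

Lemma rmorph_quad p q : g (quad u o p q) = quad (g \o u) o p q.
Proof. by rewrite /quad rmorphB !rmorphM. Qed.
Lemma rmorph_cubic p q r : g (cubic u o p q r) = cubic (g \o u) o p q r.
Proof.
by rewrite /cubic !(rmorphD, rmorphN, rmorphM, rmorphXn, rmorph1).
Qed.
Lemma rmorph_base p q r : g (base u o p q r) = base (g \o u) o p q r.
Proof. by rewrite /base !(rmorphD, rmorphN, rmorphM). Qed.
Lemma rmorph_flat x l : g (flat u o x l) = flat (g \o u) o x l.
Proof. by rewrite /flat rmorphB !rmorphM. Qed.
Lemma rmorph_flat2 x l m : g (flat2 u o x l m) = flat2 (g \o u) o x l m.
Proof.
by rewrite /flat2 rmorphB rmorphD !rmorphM !rmorph_flat rmorph_quad.
Qed.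
End Naturality.

(** Leibniz rule for a derivation over [g]. It serves both for the derivative of a curve and for the
    second component of a dual number. *)
Lemma tensP_derivation (J : finType) (k : J -> nat) (A B : comNzRingType)
    (g : {rmorphism A -> B}) (d : A -> B) Q (v : mvec k A) x :
  d 1 = 0 -> (forall a b, d (a * b) = d a * g b + g a * d b) ->
  d (tensP Q v x) = dtenP Q (fun l i => g (v l i)) (fun l i => d (v l i)) x.
Proof.
move=> d1 dM; move: {2}#|Q| (leqnn #|Q|) => n; elim: n Q => [|n IH] Q Qn.
  have Q0 l : Q l = false.
    by move: Qn; rewrite leqn0 => /eqP/card0_eq/(_ l).
  by rewrite /tensP /dtenP !big_pred0.
have [[l Ql]|nQ] := pselect (exists l, Q l); last first.
  have Q0 l : Q l = false by apply/negP => Ql; apply: nQ; exists l.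
  by rewrite /tensP /dtenP !big_pred0.
rewrite (tensP_D1 _ _ Ql) dM IH; last first.
  rewrite -ltnS; apply: leq_trans Qn; apply: proper_card; apply/properP; split.
    by apply/fintype.subsetP => m /andP[].
  by exists l; rewrite // unfold_in /less eqxx andbF.
by rewrite (dtenP_D1 _ _ _ Ql) rmorph_tensP.
Qed.

(** * The Segre cone and a parametric form of its tangential variety *)

Section Segre.
Variables (K : fieldType) (ch0 : forall n, n.+1%:R != 0 :> K).
Variables (J : finType) (k : J -> nat).
Local Notation idx := (tensor_index k).
Local Notation V := (vec K (PP idx)).
Local Notation pt := {l : J & 'I_(k l).+1}.
Implicit Types (v w X Y : mvec k K) (u : V) (o x : idx) (f : {mpoly K[#|idx|]}).

Definition nondeg v := forall l, exists i, v l i != 0.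

Lemma nondegP v : nondeg v -> exists o, forall l, v l (o l) != 0.
Proof.
move=> nv; exists (finfun (fun l => xchoose (nv l))) => l.
by rewrite ffunE (xchooseP (nv l)).
Qed.

Lemma tens_neq0 v o : (forall l, v l (o l) != 0) -> tens v o != 0.
Proof. by move=> h; apply/prodf_neq0 => l _. Qed.

Lemma tens_nondeg v x : tens v x != 0 -> nondeg v.
Proof. by move/prodf_neq0 => h l; exists (x l); exact: h. Qed.

Definition shift v o : mvec k {poly K} :=
  fun l i => (v l i)%:P + 'X * ((i == o l)%:R)%:P.
Arguments shift v o l i : clear implicits.

Lemma shift_horner v o t l i : (shift v o l i).[t] = v l i + t * (i == o l)%:R.
Proof. by rewrite /shift !hornerE. Qed.

Lemma prod_shift_neq0 v o : \prod_l ((v l (o l))%:P + 'X) != 0 :> {poly K}.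
Proof.
apply/prodf_neq0 => l _; apply/eqP => /(congr1 (fun p : {poly K} => p`_1)).
by rewrite coefD coefC coefX coef0 add0r => /eqP; rewrite oner_eq0.
Qed.

(* Tensors of the form [dten v w] are limits of those with [v] nonzero at [o]. *)
Lemma dten_dense f o :
  (forall v w, (forall l, v l (o l) != 0) -> pev (dten v w) f = 0) ->
  forall v w, pev (dten v w) f = 0.
Proof.
move=> H v w; pose wp : mvec k {poly K} := fun l i => (w l i)%:P.
pose h := ev (fun x => dten (shift v o) wp x) f.
have hE t : h.[t] = pev (dten (fun l i => v l i + t * (i == o l)%:R) w) f.
  rewrite /h pev_horner; apply: pev_ext => x.
  rewrite -/(horner_eval t _) rmorph_dten /=; congr (dten _ _ x).
    by apply: functional_extensionality_dep => l; apply/funext => i; exact: shift_horner.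
  by apply: functional_extensionality_dep => l; apply/funext => i; rewrite /= horner_evalE hornerC.
have /(congr1 (fun p : {poly K} => p.[0])) : h = 0.
  apply: (poly_generic_eq0 ch0 (prod_shift_neq0 v o)) => t qt.
  rewrite hE; apply: H => l; rewrite eqxx mulr1.
  by move: qt; rewrite horner_prod => /prodf_neq0 /(_ l isT); rewrite !hornerE.
rewrite hE horner0 => E; rewrite -[RHS]E; apply: pev_ext => x.
congr (dten _ _ x).
by apply: functional_extensionality_dep => l; apply/funext => i; rewrite mul0r addr0.
Qed.

(** Each [v l] is divided by its entry at [o], and [w l] loses the multiple of [v l] that clears its
    entry at [o]. Up to the common factor [M], these multiples add up to the scalar [a]. *)
Lemma dten_chart v w o : (forall l, v l (o l) != 0) ->
  exists a X Y, [/\ chart o X Y, dten v w =1 par a X Y &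
    forall l, (forall i, Y l i = 0) -> exists c, forall i, w l i = c * v l i].
Proof.
move=> vo; pose mu l := v l (o l); pose c l := w l (o l) / mu l.
pose M := \prod_l mu l.
have M0 : M != 0 by apply/prodf_neq0 => l _; exact: vo.
pose X : mvec k K := fun l i => v l i / mu l.
pose Y : mvec k K := fun l i => (w l i - c l * v l i) / mu l.
exists (M * \sum_l c l), X, (fun l i => M * Y l i); split.
- move=> l; rewrite /X /Y /c /mu divff //; split=> //.
  by rewrite divfK // subrr mul0r mulr0.
- move=> x; rewrite /par dten_scale -mulrA -mulrDr.
  have -> : dten v w x = dten (fun l i => mu l * X l i) (fun l i => mu l * (Y l i + c l * X l i)) x.
    congr (dten _ _ x); apply: functional_extensionality_dep => l; apply/funext => i.
      by rewrite /X mulrCA (divff (vo l)) mulr1.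
    by rewrite /Y /X mulrDr !(mulrCA (mu l)) (divff (vo l)) !mulr1 subrK.
  rewrite /dten dtenP_scale -/M; congr (_ * _); rewrite -!/(dten _ _) dtenD addrC; congr (_ + _).
  rewrite /dten /dtenP mulr_suml; apply: eq_bigr => l _.
  by rewrite -mulrA /tens (tensP_D1 _ _ (isT : predT l)).
move=> l Y0; exists (c l) => i; have /eqP := Y0 i.
rewrite !mulf_eq0 (negPf M0) invr_eq0 (negPf (vo l)) !orbF /= subr_eq0.
by move/eqP.
Qed.

Lemma chart_dense f o :
  (forall a X Y, chart o X Y -> pev (par a X Y) f = 0) ->
  forall v w, pev (dten v w) f = 0.
Proof.
move=> H; apply: (@dten_dense f o) => v w vo.
by have [a [X [Y [oXY E _]]]] := dten_chart w vo; rewrite (pev_ext _ E) H.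
Qed.

Variable l0 : J.

(** The scalar left free by [peq] is absorbed in the factor [l0]. *)
Lemma segreP u : segre K k u <-> exists2 v, nondeg v & u =1 tens v.
Proof.
split.
  case=> v pv /peqPP [c c0 ->].
  pose v' : mvec k K := fun l i => (if l == l0 then c else 1) * v (Tagged (fun l => 'I_(k l).+1) i).
  exists v'.
    move=> l; have [[m i] /= e ne] := pv l; subst m; exists i.
    by rewrite /v' /= mulf_neq0 //; case: ifP => // _; exact: oner_neq0.
  move=> x; rewrite scaleffE ffunE /v' /tens tensP_scale; congr (_ * _).
  by rewrite (bigD1 l0) //= eqxx big1 ?mulr1 // => l /negPf ->.
case=> v nv uE; exists [ffun p : pt => v (tag p) (tagged p)].
  by move=> l; have [i vi] := nv l; exists (Tagged (fun l => 'I_(k l).+1) i); rewrite ?ffunE.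
apply/peqPP; exists 1; first exact: oner_neq0.
rewrite scale1r; apply/ffunP => x; rewrite uE ffunE.
by apply: eq_bigr => l _; rewrite ffunE.
Qed.

Definition vanT f := forall v w, pev (dten v w) f = 0.

Definition tangents : set V :=
  [set u | points K (PP idx) u /\ exists v w, nondeg v /\ u =1 dten v w].

Lemma tangents_cone : cone tangents.
Proof.
move=> c u c0 [/pointsPP[x ux] [v [w [nv uE]]]]; split.
  by apply/pointsPP; exists x; rewrite scaleffE mulf_neq0.
by exists v, (fun l i => c * w l i); split=> // y; rewrite scaleffE uE dten_scale.
Qed.

Lemma tens_dten v : tens v =1 dten v (fun l i => if l == l0 then v l i else 0).
Proof.
move=> x; have := par_dten 1 v (fun _ _ => 0) l0 x.
rewrite /par mul1r [X in _ + X](_ : _ = 0); last first.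
  by rewrite /dten /dtenP big1 // => l _; rewrite mul0r.
rewrite addr0 => ->; congr (dten _ _ x).
apply: functional_extensionality_dep => l; apply/funext => i.
by case: eqP; rewrite ?mul1r ?addr0.
Qed.

Lemma tangents_neq0 : exists u, tangents u.
Proof.
pose v : mvec k K := fun _ _ => 1.
have v1 x : tens v x = 1 by rewrite /tens /tensP big1.
exists [ffun x => tens v x]; split.
  apply/pointsPP; exists (finfun (fun _ => ord0)).
  by rewrite ffunE v1 oner_neq0.
exists v, (fun l i => if l == l0 then v l i else 0).
split; first by move=> l; exists ord0; exact: oner_neq0.
by move=> x; rewrite ffunE tens_dten.
Qed.

(** The tensors [dten v w] missing from [tangents] are limits of its members: degenerate [v] by
    [dten_dense], the zero tensor by scaling a point to 0. *)
Lemma vanTP f : vanish tangents f <-> vanT f.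
Proof.
split=> [vf|vf u [_ [v [w [_ uE]]]]]; last by rewrite -(vf v w); exact: pev_ext.
have [u Tu] := tangents_neq0.
have v0 : pev (fun _ => 0) f = 0.
  pose h := ev (fun x => 'X * (u x)%:P) f.
  have /(congr1 (fun p : {poly K} => p.[0])) : h = 0.
    apply: (poly_generic_eq0 ch0 (q := 'X)); first by rewrite polyX_eq0.
    move=> t; rewrite hornerX => t0; rewrite -(vf _ (tangents_cone t0 Tu)) pev_horner.
    by apply: pev_ext => x; rewrite !hornerE scaleffE.
  by rewrite pev_horner horner0 => E; rewrite -[RHS]E; apply: pev_ext => x; rewrite !hornerE.
apply: (@dten_dense f (finfun (fun _ => ord0))) => v w nv.
have [[x ux]|nu] := pselect (exists x, dten v w x != 0).
  have E : dten v w =1 [ffun x => dten v w x] by move=> y; rewrite ffunE.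
  rewrite (pev_ext _ E); apply: vf; split; first by apply/pointsPP; exists x; rewrite ffunE.
  by exists v, w; split=> // l; eexists; exact: nv.
rewrite -v0; apply: pev_ext => x; apply/eqP; apply: contraT => ne.
by case: nu; exists x.
Qed.

End Segre.

Arguments tangents K {J} k _.

(** * The tangential variety *)

Section Tangency.
Variables (K : fieldType) (ch0 : forall n, n.+1%:R != 0 :> K) (I : finType).
Local Notation V := (vec K (PP I)).
Implicit Types (Z X : set V) (f : {mpoly K[#|I|]}).

Lemma dird_sum (p w : I -> K) (n : nat) (F : 'I_n -> {mpoly K[#|I|]}) :
  dird p w (\sum_i F i) = \sum_i dird p w (F i).
Proof.
have E f : dird p w f = dsnd (ev (fun x => (p x, w x) : dual K) f) by rewrite ev_dual.
rewrite E rmorph_sum raddf_sum.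
by apply: eq_bigr => i _; rewrite E.
Qed.

Lemma cone_tangentE X (v w : V) : cone X ->
  cone_tangent X v w <-> forall f, vanish X f -> @dird K I v w f = 0.
Proof.
move=> cX; have dE f : \sum_t evalp (A := PP I) (f^`M(t)) v * w (enum_val t) = @dird K I v w f.
  by apply: eq_bigr => t _; rewrite pevE.
split=> [H f vf|H f _ vf].
  rewrite (@pihomog_partitionE _ _ mdeg (msize f) f) // dird_sum big1 // => d _.
  rewrite -dE; apply: H; first by apply/is_mhomogP; exists d; exact: pihomogP.
  by move=> u Xu; rewrite pevE; apply: vanish_pihomog Xu.
by rewrite dE; apply: H => u Xu; rewrite -pevE; exact: vf.
Qed.

(** The velocity of a curve in a variety is a tangent vector. The zeros of [q], possibly including
    0, are parameters at which membership in the variety need not be known. *)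
Lemma curve_dird f (g : I -> {poly K}) (q : {poly K}) : q != 0 ->
  (forall t, q.[t] != 0 -> pev (fun x => (g x).[t]) f = 0) ->
  dird (fun x => (g x).[0]) (fun x => ((g x)^`()).[0]) f = 0.
Proof.
move=> q0 H; rewrite -ev_deriv0 (_ : ev g f = 0) ?deriv0 ?horner0 //.
by apply: (poly_generic_eq0 ch0 q0) => t qt; rewrite pev_horner H.
Qed.

Lemma line_dird f (p w : I -> K) :
  (forall t, pev (fun x => p x + t * w x) f = 0) -> dird p w f = 0.
Proof.
move=> H.
have := curve_dird (f := f) (g := fun x => (p x)%:P + 'X * (w x)%:P) (oner_neq0 _).
have -> : (fun x => ((p x)%:P + 'X * (w x)%:P).[0]) = p.
  by apply/funext => x; rewrite !hornerE.
have -> : (fun x => (((p x)%:P + 'X * (w x)%:P)^`()).[0]) = w.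
  by apply/funext => x; rewrite derivD derivM !derivC derivX !hornerE.
apply=> t _; rewrite -(H t); apply: pev_ext => x; by rewrite !hornerE.
Qed.

Lemma dird_dual f (p w : I -> K) : pev p f = 0 -> dird p w f = 0 ->
  ev (fun x => (p x, w x) : dual K) f = 0.
Proof. by move=> h h'; rewrite ev_dual h'; congr pair. Qed.

Definition dinv (a : dual K) : dual K := (a.1^-1, - a.2 / a.1 ^+ 2).

Lemma dinvP (a : dual K) : a.1 != 0 -> dinv a * a = 1.
Proof.
move=> a0; rewrite /dinv dualM /=; congr pair; first exact: mulVf.
by field.
Qed.

End Tangency.

Lemma tens_dual (K : fieldType) (J : finType) (k : J -> nat) (v : mvec k (dual K)) x :
  tens v x = (tens (fun l i => (v l i).1) x,
    dten (fun l i => (v l i).1) (fun l i => (v l i).2) x).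
Proof.
rewrite [LHS]surjective_pairing; congr pair.
  exact: (rmorph_tensP (@dfst K)).
apply: (tensP_derivation (g := @dfst K) (d := @dsnd K)) => // a b.
by rewrite /dsnd dualM /= addrC.
Qed.

Section TanSegre.
Variables (K : fieldType) (ch0 : forall n, n.+1%:R != 0 :> K).
Variables (J : finType) (k : J -> nat) (l0 : J).
Local Notation idx := (tensor_index k).
Local Notation V := (vec K (PP idx)).
Local Notation pt := {l : J & 'I_(k l).+1}.
Implicit Types (v w X Y : mvec k K) (u : V) (o x : idx) (f : {mpoly K[#|idx|]}).

Lemma segre_cone : cone (segre K k).
Proof.
move=> c u c0 /(segreP l0) [v nv uE]; apply/(segreP l0).
exists (fun l i => (if l == l0 then c else 1) * v l i).
  move=> l; have [i vi] := nv l; exists i.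
  by rewrite mulf_neq0 //; case: ifP => // _; exact: oner_neq0.
move=> x; rewrite scaleffE uE /tens tensP_scale; congr (_ * _).
by rewrite (bigD1 l0) //= eqxx big1 ?mulr1 // => l /negPf ->.
Qed.

(** Where [u o] is invertible, this relation expresses every entry through those next to [o] and so
    makes [u] a multiple of a product tensor. *)
Definition rank1_rel (A : comNzRingType) (u : idx -> A) o x :=
  u x * u o ^+ #|J| - u o * \prod_l u (upd o (at_ x l)).

Lemma rank1_rel_tens (A : comNzRingType) (v : mvec k A) o x :
  rank1_rel (tens v) o x = 0.
Proof.
apply/eqP; rewrite subr_eq0; apply/eqP.
rewrite [u in _ = u * _]/tens /tensP -big_split /= -prodr_const -big_split.
apply: eq_bigr => l _ /=; rewrite /tens tensP_upd //= (tensP_D1 v o (isT : predT l)).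
by rewrite mulrCA.
Qed.

Lemma rmorph_rank1_rel (A B : comNzRingType) (g : {rmorphism A -> B}) (u : idx -> A) o x :
  g (rank1_rel u o x) = rank1_rel (g \o u) o x.
Proof. by rewrite /rank1_rel rmorphB !rmorphM rmorphXn rmorph_prod. Qed.

(** A tangent vector makes [p + e u] satisfy [rank1_rel] over the dual numbers, where the entry at
    [o] is a unit. It is therefore a multiple of a product tensor [tens xi] there, whose second
    component is a [dten]. Conversely [dten v w] is the velocity of the curve [tens (v + t w)]. *)
Lemma tangent_segre v u (p : V) : nondeg v -> p =1 tens v ->
  cone_tangent (segre K k) p u <-> exists w, u =1 dten v w.
Proof.
move=> nv pE; split.
  move/(cone_tangentE ch0 p u segre_cone) => H; have [o vo] := nondegP nv.
  have c0 : tens v o != 0 by exact: tens_neq0.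
  pose U x : dual K := (p x, u x).
  have rel x : rank1_rel U o x = 0.
    have -> : rank1_rel U o x = ev U (rank1_rel (@mvar K idx) o x).
      rewrite rmorph_rank1_rel; congr (rank1_rel _ _ _); apply/funext => y.
      by rewrite /= ev_var.
    have vf : vanish (segre K k) (rank1_rel (@mvar K idx) o x).
      move=> z /(segreP l0) [v' _ zE]; rewrite rmorph_rank1_rel.
      rewrite -[RHS](rank1_rel_tens v' o x); congr (rank1_rel _ _ _); apply/funext => y.
      by rewrite /= pev_var zE.
    apply: dird_dual; last exact: H.
    by apply: vf; apply/(segreP l0); exists v.
  pose d := dinv (U o); have dU : d * U o = 1 by apply: dinvP; rewrite /= pE.
  pose xi l i := d * U (upd o (Tagged (fun l => 'I_(k l).+1) (i : 'I_(k l).+1))).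
  have UE x : U x = U o * tens xi x.
    have /eqP := rel x; rewrite subr_eq0 => /eqP E.
    have -> : U x = d ^+ #|J| * (U x * U o ^+ #|J|).
      by rewrite mulrCA -exprMn dU expr1n mulr1.
    rewrite E mulrCA; congr (_ * _).
    rewrite -prodr_const -big_split /=; apply: eq_bigr => l _.
    by [].
  pose X1 l i := (xi l i).1; pose X2 l i := (xi l i).2.
  have vE l i : v l i = v l (o l) * X1 l i.
    have -> : X1 l i = (tens v o)^-1 * tens v (upd o (Tagged (fun l => 'I_(k l).+1) i)).
      by rewrite /X1 /xi dualM /d /dinv /= !pE.
    rewrite /tens tensP_upd // (tensP_D1 v o (isT : predT l)) /=.
    have R0 : tensP (less predT l) v o != 0 by apply/prodf_neq0 => m _.
    by field; rewrite R0 vo.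
  have tE x : tens v x = tens v o * tens X1 x.
    rewrite -(tensP_scale predT (fun l => v l (o l)) X1 x).
    by apply: eq_bigr => l _; rewrite vE.
  have dE x : dten v (fun l i => v l (o l) * X2 l i) x = tens v o * dten X1 X2 x.
    rewrite -(dtenP_scale predT (fun l => v l (o l)) X1 X2 x).
    by apply: dtenP_ext => l _ i //; rewrite vE.
  (* The second component of the unit [U o] contributes a multiple of [tens v] itself, which is put
     into the direction of the factor [l0]. *)
  exists (fun m i => if m == l0 then (U o).2 / tens v o * v m i + v m (o m) * X2 m i
    else v m (o m) * X2 m i) => x.
  rewrite -(par_dten ((U o).2 / tens v o) v (fun l i => v l (o l) * X2 l i) l0).
  rewrite /par dE (tE x) -[u x]/((U x).2) UE dualM tens_dual /= -/X1 -/X2 pE addrC.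
  by congr (_ + _); rewrite mulrA divfK.
case=> w uE; apply/(cone_tangentE ch0 p u segre_cone) => f vf.
have [o vo] := nondegP nv.
pose vp : mvec k {poly K} := fun l i => (v l i)%:P + 'X * (w l i)%:P.
have vph t l i : (vp l i).[t] = v l i + t * w l i by rewrite /vp !hornerE.
pose q := \prod_l vp l (o l).
have q0 : q != 0.
  apply/eqP => /(congr1 (fun p : {poly K} => p.[0])).
  rewrite horner0 horner_prod => /eqP; apply/negP/prodf_neq0 => l _.
  by rewrite vph mul0r addr0.
have := curve_dird ch0 (f := f) (g := tens vp) q0.
have -> : (fun x => (tens vp x).[0]) = p.
  apply/funext => x; rewrite pE -horner_evalE rmorph_tensP.
  by apply: eq_bigr => l _; rewrite /= horner_evalE vph mul0r addr0.
have -> : (fun x => ((tens vp x)^`()).[0]) = u.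
  apply/funext => x; rewrite uE.
  rewrite /tens (tensP_derivation (g := idfun) (d := @deriv K)); last 2 first.
  - by rewrite -polyC1 derivC.
  - by move=> a b; rewrite derivM.
  rewrite -horner_evalE; rewrite -/(dten _ _ _) rmorph_dten; congr (dten _ _ x);
    apply: functional_extensionality_dep => l; apply/funext => i /=.
    by rewrite /= horner_evalE vph mul0r addr0.
  by rewrite /= horner_evalE /vp derivD derivM !derivC derivX !hornerE.
apply=> t qt; have E : (fun x => (tens vp x).[t]) =1
    ([ffun x => tens (fun l i => v l i + t * w l i) x] : V).
  move=> x; rewrite ffunE -horner_evalE rmorph_tensP.
  by apply: eq_bigr => l _; rewrite /= horner_evalE vph.
rewrite (pev_ext _ E); apply: vf; apply/(segreP l0).
exists (fun l i => v l i + t * w l i); last by move=> x; rewrite ffunE.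
move=> l; exists (o l); rewrite -vph.
by move: qt; rewrite horner_prod => /prodf_neq0; apply.
Qed.

End TanSegre.

Section TanE.
Variables (K : fieldType) (ch0 : forall n, n.+1%:R != 0 :> K).
Variables (J : finType) (k : J -> nat) (l0 : J).
Hypothesis k0 : (0 < k l0)%N.
Local Notation idx := (tensor_index k).
Local Notation V := (vec K (PP idx)).
Local Notation pt := {l : J & 'I_(k l).+1}.
Implicit Types (v w X Y : mvec k K) (u : V) (o x : idx) (f : {mpoly K[#|idx|]}).

Lemma other_index n (i : 'I_n.+1) : (0 < n)%N -> exists j : 'I_n.+1, j != i.
Proof.
move=> n0; case: (eqVneq i ord0) => [->|ni]; last by exists ord0; rewrite eq_sym.
by exists ord_max; rewrite -val_eqE /= -lt0n.
Qed.

Lemma tan_segre : tan (segre K k) = tangents K k.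
Proof.
apply/seteqP; split=> u.
  case=> pu [p [w [[/(segreP l0)[v nv pE] /(tangent_segre ch0 l0 _ nv pE) [w' wE] _]]]].
  case=> a [b uE]; split=> //; exists v.
  exists (fun m i => if m == l0 then a * v m i + b * w' m i else b * w' m i).
  split=> // x; rewrite uE ffunE !scaleffE pE wE.
  rewrite -(dten_scale b v w' x).
  exact: (par_dten a v (fun l i => b * w' l i) l0 x).
case=> pu [v [w [nv uE]]]; split=> //.
pose p : V := [ffun x => tens v x].
have pE : p =1 tens v by move=> x; rewrite ffunE.
have Xp : segre K k p by apply/(segreP l0); exists v.
have [[c uc]|nuc] := pselect (exists c : K, u = c *: p); last first.
  exists p, u; split.
    by split=> //; apply/(tangent_segre ch0 l0 _ nv pE); exists w.
  by exists 0, 1; rewrite scale0r add0r scale1r.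
(* Here [u] lies on the Segre variety itself, and a tangent line through it must be exhibited. Its
   direction replaces the factor [l0] by a basis vector other than that of [o]; this uses
   [0 < k l0]. *)
have [o vo] := nondegP nv; have [j jo] := other_index (o l0) k0.
pose e : mvec k K := fun l i => if l == l0 then
  (Tagged (fun l => 'I_(k l).+1) i == Tagged (fun l => 'I_(k l).+1) j)%:R else 0.
pose w' : V := [ffun x => dten v e x].
have eE x : dten v e x = (x l0 == j)%:R * tensP (less predT l0) v x.
  rewrite /dten (dtenP_D1 v e x (isT : predT l0)) /e eqxx eq_Tagged /=.
  rewrite [X in _ + _ * X](_ : _ = 0) ?mulr0 ?addr0 //.
  by rewrite /dtenP big1 // => l /andP[_ /negPf ->]; rewrite mul0r.
exists p, w'; split; last by exists c, 0; rewrite scale0r addr0.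
split=> //.
  by apply/(tangent_segre ch0 l0 _ nv pE); exists e => x; rewrite ffunE.
case=> c' w'c.
have h y : dten v e y = c' * tens v y.
  by have := congr1 (fun z : V => z y) w'c; rewrite scaleffE !ffunE.
have c'0 : c' = 0.
  have /esym/eqP := h o; rewrite eE [o l0 == j]eq_sym (negPf jo) mulr0n mul0r.
  by rewrite mulf_eq0 (negPf (tens_neq0 vo)) orbF => /eqP.
have := h (upd o (Tagged (fun l => 'I_(k l).+1) j)).
rewrite eE c'0 mul0r upd_in eqxx mulr1n mul1r tensP_out //=; last by rewrite /less eqxx.
by move/eqP; apply/negP/prodf_neq0 => l _.
Qed.

End TanE.

(** * Closedness of the tangential variety *)

Section LocalInverse.
Variables (J : finType) (k : J -> nat).
Local Notation idx := (tensor_index k).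
Local Notation pt := {l : J & 'I_(k l).+1}.
Definition pnt l (i : 'I_(k l).+1) : pt := Tagged (fun l => 'I_(k l).+1) i.
Variables (p1 p2 p3 : pt).
Hypotheses (t12 : tag p1 != tag p2) (t13 : tag p1 != tag p3) (t23 : tag p2 != tag p3).

(** Two of the three given points whose factors differ from [l] and from each other, as needed to
    divide by [Y_q * Y_r] when solving for the factor [l]. *)
Definition aux l : pt * pt :=
  if l == tag p1 then (p2, p3) else if l == tag p2 then (p1, p3) else (p1, p2).

Lemma auxP l : [/\ l != tag (aux l).1, l != tag (aux l).2 & tag (aux l).1 != tag (aux l).2].
Proof.
rewrite /aux; case: (eqVneq l (tag p1)) => [->|l1] //.
by case: (eqVneq l (tag p2)) => [->|l2]; rewrite // eq_sym.
Qed.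

Variable A : comNzRingType.
Implicit Types (u : idx -> A) (o x : idx) (X Y : mvec k A).

(** The rational inverse of the chart: [X_l] is [invX / invD] and [Y_l] is [invY / invD].
    Substituting back and clearing denominators gives [inv_rel]. *)
Definition invD u o l := 2 * quad u o (aux l).1 (aux l).2.
Definition invX u o : mvec k A := fun l i => base u o (pnt i) (aux l).1 (aux l).2.
Definition invY u o : mvec k A := fun l i => cubic u o (pnt i) (aux l).1 (aux l).2.
Definition inv_rel u o x := u x * \prod_l invD u o l
  - (u o * tens (invX u o) x + dten (invX u o) (invY u o) x).

Lemma invD_neq0 (F : fieldType) (u : idx -> F) o l : 2 != 0 :> F ->
  quad u o p1 p2 != 0 -> quad u o p1 p3 != 0 -> quad u o p2 p3 != 0 ->
  2 * quad u o (aux l).1 (aux l).2 != 0.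
Proof.
move=> n2 D12 D13 D23; rewrite mulf_neq0 // /aux.
by case: ifP => // _; case: ifP.
Qed.

Section InvPar.
Variables (o : idx) (a : A) (X Y : mvec k A).
Hypothesis oXY : chart o X Y.

Lemma invD_par l : invD (par a X Y) o l =
  2 * (Y (tagged (aux l).1) * Y (tagged (aux l).2)).
Proof. by have [_ _ h] := auxP l; rewrite /invD (quad_par _ oXY). Qed.

Lemma invX_par l (i : 'I_(k l).+1) :
  invX (par a X Y) o i = invD (par a X Y) o l * X i.
Proof.
by have [h h' h''] := auxP l; rewrite /invX (base_par _ oXY) //= invD_par mulrC.
Qed.

Lemma invY_par l (i : 'I_(k l).+1) :
  invY (par a X Y) o i = invD (par a X Y) o l * Y i.
Proof.
by have [h h' h''] := auxP l; rewrite /invY (cubic_par _ oXY) //= invD_par; ring.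
Qed.

Lemma inv_rel_par x : inv_rel (par a X Y) o x = 0.
Proof.
pose D := invD (par a X Y) o.
apply/eqP; rewrite subr_eq0; apply/eqP.
have tE : tens (invX (par a X Y) o) x = \prod_l D l * tens X x.
  rewrite -(tensP_scale predT D); apply: tensP_ext => l _ i; exact: invX_par.
have dE : dten (invX (par a X Y) o) (invY (par a X Y) o) x = \prod_l D l * dten X Y x.
  rewrite -(dtenP_scale predT D).
  by apply: dtenP_ext => l _ i; [exact: invX_par|exact: invY_par].
rewrite tE dE (par0 _ oXY) -/D /par; ring.
Qed.
End InvPar.

(** A formal identity, valid for every [u]: at the index [o l] itself [base] specializes to twice
    [quad] and [cubic] to 0. *)
Lemma inv_chart u o (d : J -> A) : (forall l, d l * invD u o l = 1) ->
  chart o (fun l i => d l * invX u o i) (fun l i => d l * invY u o i).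
Proof.
move=> dD l; rewrite -(dD l) /invX /invY /invD /base /cubic /quad.
have -> : upd o (pnt (o l)) = o by exact: upd_id.
by split; ring.
Qed.

Lemma inv_par u o (d : J -> A) : (forall x, inv_rel u o x = 0) ->
  (forall l, d l * invD u o l = 1) ->
  u =1 par (u o) (fun l i => d l * invX u o i) (fun l i => d l * invY u o i).
Proof.
move=> ur dD x; rewrite /par /tens /dten tensP_scale dtenP_scale -/(tens _) -/(dten _ _).
have /eqP := ur x; rewrite subr_eq0 => /eqP E.
have pd : \prod_l d l * \prod_l invD u o l = 1.
  by rewrite -big_split /= big1.
by rewrite mulrCA -mulrDr -E mulrCA pd mulr1.
Qed.

End LocalInverse.

Lemma rmorph_invX (J : finType) (k : J -> nat) (A B : comNzRingType)
    (g : {rmorphism A -> B}) p1 p2 p3 (u : tensor_index k -> A) o l (i : 'I_(k l).+1) :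
  g (invX p1 p2 p3 u o i) = invX p1 p2 p3 (g \o u) o i.
Proof. exact: rmorph_base. Qed.

Lemma rmorph_invY (J : finType) (k : J -> nat) (A B : comNzRingType)
    (g : {rmorphism A -> B}) p1 p2 p3 (u : tensor_index k -> A) o l (i : 'I_(k l).+1) :
  g (invY p1 p2 p3 u o i) = invY p1 p2 p3 (g \o u) o i.
Proof. exact: rmorph_cubic. Qed.

Lemma rmorph_invD (J : finType) (k : J -> nat) (A B : comNzRingType)
    (g : {rmorphism A -> B}) p1 p2 p3 (u : tensor_index k -> A) o l :
  g (invD p1 p2 p3 u o l) = invD p1 p2 p3 (g \o u) o l.
Proof. by rewrite /invD rmorphM rmorph_nat rmorph_quad. Qed.

Lemma rmorph_inv_rel (J : finType) (k : J -> nat) (A B : comNzRingType)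
    (g : {rmorphism A -> B}) p1 p2 p3 (u : tensor_index k -> A) o x :
  g (inv_rel p1 p2 p3 u o x) = inv_rel p1 p2 p3 (g \o u) o x.
Proof.
rewrite /inv_rel rmorphB rmorphD !rmorphM rmorph_prod rmorph_dten rmorph_tensP /=.
congr (_ * _ - (_ * _ + _)).
- by apply: eq_bigr => l _; exact: rmorph_invD.
- by apply: tensP_ext => l _ i; exact: rmorph_invX.
- by apply: dtenP_ext => l _ i; [exact: rmorph_invX|exact: rmorph_invY].
Qed.

(** * Tensors of rank at most two in a pair of factors *)

Section Secants.
Variables (J : finType) (k : J -> nat).
Local Notation idx := (tensor_index k).
Local Notation pt := {l : J & 'I_(k l).+1}.

(* Rank one in the factors outside [S], a sum of two rank one tensors in the
   factors of [S]. *)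
Definition secf (A : comNzRingType) (S : {set J}) (v s r : mvec k A) (x : idx) :=
  tensP (fun l => l \notin S) v x *
  (tensP (fun l => l \in S) s x + tensP (fun l => l \in S) r x).

Section Rel.
Variables (A : comNzRingType) (S : {set J}) (v s r : mvec k A) (o : idx).
Local Notation f := (secf S v s r).

Lemma secf_flat x l : l \notin S -> flat f o x l = 0.
Proof.
move=> lS; rewrite /flat -{1}(upd_id x l) -[in f o](upd_id o l) /secf.
rewrite !(tensP_upd (Q := fun l => l \notin S)) //.
rewrite !(tensP_out (Q := fun l => l \in S)) //; ring.
Qed.

Lemma tensP_pair i j (w : mvec k A) x : i != j ->
  tensP (fun l => l \in i |: [set j]) w x = w i (x i) * w j (x j).
Proof.
move=> ij; have Qi : (fun l => l \in i |: [set j]) i by rewrite !inE eqxx.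
have Qj : less (fun l => l \in i |: [set j]) i j.
  by rewrite /less !inE eqxx orbT eq_sym.
rewrite (tensP_D1 w x Qi) (tensP_D1 w x Qj) [tensP _ _ _]big_pred0 ?mulr1 // => m.
by rewrite /less !inE; case: (m == i); case: (m == j).
Qed.

(** In the factors [i] and [j], [quad] is up to sign and scalar a Schur complement at [o] of a
    matrix of rank at most two, hence has rank at most one. *)
Lemma secf_minor i j (a a' : 'I_(k i).+1) (b b' : 'I_(k j).+1) :
  S = i |: [set j] -> i != j ->
  quad f o (pnt a) (pnt b) * quad f o (pnt a') (pnt b') =
  quad f o (pnt a) (pnt b') * quad f o (pnt a') (pnt b).
Proof.
move=> SE ij; have ji : j != i by rewrite eq_sym.
have Si : i \in S by rewrite SE !inE eqxx.
have Sj : j \in S by rewrite SE !inE eqxx orbT.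
pose c := tensP (fun l => l \notin S) v o.
pose h (a : 'I_(k i).+1) (b : 'I_(k j).+1) := s a * s b + r a * r b.
have fE (x : idx) : (forall l, l \notin S -> x l = o l) -> f x = c * h (x i) (x j).
  move=> xo; rewrite /f /c (@tensP_eq _ _ _ _ v x o) //; congr (_ * _).
  by rewrite SE !tensP_pair.
have out (x : idx) p : tag p \in S -> (forall l, l \notin S -> x l = o l) ->
    forall l, l \notin S -> upd x p l = o l.
  by move=> pS xo l lS; rewrite upd_out ?xo //; apply: contraNneq lS => <-.
have oo l : l \notin S -> o l = o l by [].
have v1 d : f (upd o (pnt (l := i) d)) = c * h d (o j).
  rewrite fE; last exact: out.
  by congr (c * h _ _); [exact: (upd_in o (pnt d))|exact: upd_out].
have v2 e : f (upd o (pnt (l := j) e)) = c * h (o i) e.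
  rewrite fE; last exact: out.
  by congr (c * h _ _); [exact: upd_out|exact: (upd_in o (pnt e))].
have v3 d e : f (upd (upd o (pnt (l := i) d)) (pnt (l := j) e)) = c * h d e.
  rewrite fE; last by apply: (out) => //; exact: out.
  congr (c * h _ _); last exact: (upd_in _ (pnt e)).
  by rewrite upd_out //; exact: (upd_in o (pnt d)).
have qE d e : quad f o (pnt d) (pnt e) = c ^+ 2 * (h d (o j) * h (o i) e - h (o i) (o j) * h d e).
  by rewrite /quad v1 v2 v3 (fE o oo); ring.
rewrite !qE /h; ring.
Qed.
End Rel.

Lemma rmorph_secf (A B : comNzRingType) (g : {rmorphism A -> B}) S (v s r : mvec k A) x :
  g (secf S v s r x) = secf S (fun l i => g (v l i)) (fun l i => g (s l i)) (fun l i => g (r l i)) x.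
Proof. by rewrite /secf rmorphM rmorphD !rmorph_tensP. Qed.

Variable K : fieldType.
Local Notation V := (vec K (PP idx)).

Definition secants (S : {set J}) : set V :=
  [set u | points K (PP idx) u /\ exists v s r : mvec k K, u =1 secf S v s r].

Lemma rank1_factor (P1 P2 : pred pt) (D : pt -> pt -> K) :
  (forall p p' q q', P1 p -> P1 p' -> P2 q -> P2 q' ->
     D p q * D p' q' = D p q' * D p' q) ->
  exists a b, forall p q, P1 p -> P2 q -> D p q = a p * b q.
Proof.
move=> H; have [[p0 [q0 [Pp Pq D0]]]|n] := pselect (exists p q, [/\ P1 p, P2 q & D p q != 0]).
  exists (fun p => D p q0), (fun q => D p0 q / D p0 q0) => p q hp hq.
  by rewrite mulrA -(H p p0 q q0) // mulfK.
exists (fun _ => 0), (fun _ => 0) => p q hp hq; rewrite mul0r.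
by apply/eqP; apply: contraT => ne; case: n; exists p, q.
Qed.

(** Each vanishing [flat] resets one factor outside [S] to [o] at the cost of the ratio
    [u (upd o _) / u o]. What remains is the entry of the slice in [i] and [j], expressed through
    [quad]. *)
Lemma flat_formula S i j (u : idx -> K) o x : S = i |: [set j] -> i != j ->
  u o != 0 -> (forall x l, l \notin S -> flat u o x l = 0) ->
  u x = tensP (fun l => l \notin S) (fun l c => u (upd o (pnt c)) / u o) x *
    ((u (upd o (at_ x i)) * u (upd o (at_ x j)) - quad u o (at_ x i) (at_ x j)) / u o).
Proof.
move=> SE ij uo fl; pose v : mvec k K := fun l c => u (upd o (pnt c)) / u o.
have red (t : seq J) : uniq t -> (forall l, l \in t -> l \notin S) ->
    u x = u (foldr (fun l y => upd y (at_ o l)) x t) * \prod_(l <- t) v l (x l).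
  elim: t => [|l t IH] /=; first by rewrite big_nil mulr1.
  move=> /andP[lt ut] tS; rewrite big_cons IH //; last by move=> m mt; apply: tS; rewrite inE mt orbT.
  set y := foldr _ _ _; have yl : y l = x l.
    rewrite /y; elim: (t) lt => [|m t' IH'] //=.
    by rewrite inE negb_or => /andP[lm lt']; rewrite upd_out ?IH' // eq_sym.
  have /eqP := fl y l (tS l (mem_head _ _)); rewrite subr_eq0 => /eqP E.
  have -> : u y = u (upd y (at_ o l)) * v l (x l).
    by rewrite /v mulrA -yl -/(at_ y l) -E mulfK.
  by rewrite -!mulrA.
have tS l : (l \in enum (~: S)) = (l \notin S) by rewrite mem_enum inE.
rewrite {1}(red (enum (~: S))) ?enum_uniq //; last by move=> l; rewrite tS.
set y := foldr _ _ _; have yE l : y l = if l \in S then x l else o l.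
  rewrite -[l \in S]negbK -tS if_neg /y; elim: (enum _) => [|m t IH] //=.
  rewrite inE; case: (eqVneq l m) => [<-|lm] /=; first by rewrite (upd_in _ (at_ o l)).
  by rewrite upd_out // eq_sym.
have -> : y = upd (upd o (at_ x i)) (at_ x j).
  apply/ffunP => l; rewrite yE SE !inE; case: (eqVneq l j) => [->|lj].
    by rewrite orbT (upd_in _ (at_ x j)).
  rewrite orbF upd_out 1?eq_sym //; case: (eqVneq l i) => [->|li].
    by rewrite (upd_in _ (at_ x i)).
  by rewrite upd_out // eq_sym.
rewrite mulrC; congr (_ * _); last by rewrite /quad; field.
by rewrite big_enum_cond /=; apply: eq_bigl => l; rewrite inE andbT.
Qed.

(** The slice in [i] and [j] is, after division by [u o], the outer product of its row and column
    through [o] minus [quad], which has rank one by the minors: two rank one terms. *)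
Lemma secfI S i j (u : idx -> K) o : S = i |: [set j] -> i != j -> u o != 0 ->
  (forall x l, l \notin S -> flat u o x l = 0) ->
  (forall p p' q q', tag p = i -> tag p' = i -> tag q = j -> tag q' = j ->
     quad u o p q * quad u o p' q' = quad u o p q' * quad u o p' q) ->
  exists v s r : mvec k K, u =1 secf S v s r.
Proof.
move=> SE ij uo fl mi; have ji : j != i by rewrite eq_sym.
have [a [b ab]] : exists a b, forall p q, tag p == i -> tag q == j ->
    quad u o p q = a p * b q.
  by apply: rank1_factor => p p' q q' /eqP hp /eqP hp' /eqP hq /eqP hq'; exact: mi.
exists (fun l c => u (upd o (pnt c)) / u o),
  (fun l c => if l == i then u (upd o (pnt c)) else u (upd o (pnt c)) / u o),
  (fun l c => if l == i then - a (pnt c) else b (pnt c) / u o) => x.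
rewrite (flat_formula x SE ij uo fl) /secf; congr (_ * _).
rewrite SE !tensP_pair // eqxx (negPf ji) ab ?eqxx //.
by field.
Qed.

Lemma secf_determined S i j (u u' : idx -> K) o : S = i |: [set j] -> i != j ->
  u o != 0 -> u' o = u o -> (forall p, u' (upd o p) = u (upd o p)) ->
  (forall p q, tag p = i -> tag q = j -> quad u' o p q = quad u o p q) ->
  (forall x l, l \notin S -> flat u o x l = 0) ->
  (forall x l, l \notin S -> flat u' o x l = 0) -> u =1 u'.
Proof.
move=> SE ij uo oE pE qE fl fl' x.
rewrite (flat_formula x SE ij uo fl) (flat_formula (u := u') (o := o) x SE ij) ?oE //.
rewrite !pE qE //; congr (_ * _).
by apply: tensP_ext => l _ c; rewrite pE.
Qed.

Lemma pev_mvar (u : idx -> K) : pev u \o @mvar K idx = u.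
Proof. by apply/funext => x; exact: pev_var. Qed.

Lemma secants_cone i j : i != j -> cone (secants (i |: [set j])).
Proof.
move=> ij c u c0 [/pointsPP[x ux] [v [s [r uE]]]]; split.
  by apply/pointsPP; exists x; rewrite scaleffE mulf_neq0.
pose d l := if l == i then c else 1.
have dE : \prod_(l | l \in i |: [set j]) d l = c.
  rewrite (bigD1 i) ?inE ?eqxx //= /d eqxx big1 ?mulr1 // => l /andP[_ /negPf ->] //.
exists v, (fun l a => d l * s l a), (fun l a => d l * r l a) => y.
rewrite scaleffE uE /secf (tensP_scale _ d s) (tensP_scale _ d r) dE; ring.
Qed.

Variable ch0 : forall n, n.+1%:R != 0 :> K.

Lemma zclosure_secants i j : i != j ->
  zclosure (secants (i |: [set j])) `<=` secants (i |: [set j]).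
Proof.
move=> ij u cu; have [pu _] := cu; split=> //; have /pointsPP[o uo] := pu.
pose U : idx -> K := u.
have van f : (forall v s r, pev (secf (i |: [set j]) v s r) f = 0) -> pev U f = 0.
  move=> H; apply: (zclosure_vanish ch0 (secants_cone ij) _ cu) => w [_ [v [s [r wE]]]].
  by rewrite -(H v s r); exact: pev_ext.
apply: (@secfI _ i j U o) => // [x l lS|[i' a] [i'' a'] [j' b] [j'' b'] /= e0 e1 e2 e3].
  rewrite -(pev_mvar U) -rmorph_flat; apply: van => v s r.
  by rewrite rmorph_flat pev_mvar secf_flat.
subst i' i'' j' j''.
rewrite -(pev_mvar U) -!rmorph_quad -!rmorphM; apply/eqP; rewrite -subr_eq0 -rmorphB.
apply/eqP/van => v s r; rewrite rmorphB !rmorphM !rmorph_quad pev_mvar.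
by apply/eqP; rewrite subr_eq0 (secf_minor v s r o a a' b b' erefl ij).
Qed.

Lemma secants_closed i j : i != j -> zclosed (secants (i |: [set j])).
Proof.
move=> ij; suff -> : secants (i |: [set j]) = zclosure (secants (i |: [set j])).
  exact: zclosure_closed.
apply/seteqP; split; last exact: zclosure_secants.
by apply: subset_zclosure => u [].
Qed.

End Secants.
Arguments secants {J} k K S _.

(** * Relations on the closure of the tangential variety *)

Section Closure.
Variables (K : fieldType) (ch0 : forall n, n.+1%:R != 0 :> K).
Variables (J : finType) (k : J -> nat) (l0 : J).
Local Notation idx := (tensor_index k).
Local Notation V := (vec K (PP idx)).
Local Notation pt := {l : J & 'I_(k l).+1}.
Implicit Types (v w X Y : mvec k K) (o x : idx) (f : {mpoly K[#|idx|]}).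

Lemma two_neq0 : 2 != 0 :> K. Proof. exact: ch0. Qed.

Definition in_closure (u : idx -> K) := forall f, vanT f -> pev u f = 0.

Lemma in_closureI (u : V) : zclosure (tangents K k) u -> in_closure u.
Proof.
move=> cu f vf; apply: zclosure_vanish cu => //; first exact: tangents_cone.
exact/(vanTP ch0 l0).
Qed.

Section At.
Variables (u : idx -> K).
Hypothesis cu : in_closure u.

Lemma closure_inv p1 p2 p3 o x : tag p1 != tag p2 -> tag p1 != tag p3 ->
  tag p2 != tag p3 -> inv_rel p1 p2 p3 u o x = 0.
Proof.
move=> t12 t13 t23; rewrite -(pev_mvar u) -rmorph_inv_rel; apply: cu.
apply: (chart_dense ch0 (o := o)) => a X Y oXY.
by rewrite rmorph_inv_rel pev_mvar inv_rel_par.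
Qed.

Lemma closure_minor o p q r s : tag p != tag q -> tag r != tag s ->
  tag p != tag s -> tag r != tag q ->
  quad u o p q * quad u o r s = quad u o p s * quad u o r q.
Proof.
move=> pq rs ps rq; rewrite -(pev_mvar u) -!rmorph_quad -!rmorphM.
apply/eqP; rewrite -subr_eq0 -rmorphB; apply/eqP/cu.
apply: (chart_dense ch0 (o := o)) => a X Y oXY.
rewrite rmorphB !rmorphM !rmorph_quad pev_mvar !(quad_par _ oXY) //; ring.
Qed.

(** The difference of the two sides is [u o ^+ 2] times Cayley's hyperdeterminant of a 2x2x2
    subtensor, the equation of the tangential variety of a product of three lines. *)
Lemma closure_cubic o p q r : tag p != tag q -> tag p != tag r ->
  tag q != tag r ->
  cubic u o p q r ^+ 2 = 4 * (quad u o p q * quad u o p r * quad u o q r).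
Proof.
move=> pq pr qr; rewrite -(pev_mvar u) -!rmorph_quad -rmorph_cubic.
apply/eqP; rewrite -subr_eq0 -!rmorphM -[4](rmorph_nat (pev u)) -rmorphM -rmorphXn -rmorphB.
apply/eqP/cu; apply: (chart_dense ch0 (o := o)) => a X Y oXY.
rewrite rmorphB rmorphXn !rmorphM !rmorph_quad rmorph_cubic rmorph_nat pev_mvar.
rewrite !(quad_par _ oXY) // (cubic_par _ oXY) //; ring.
Qed.

Lemma closure_flat2 o x l m : l != m ->
  flat2 u o x l m ^+ 2 = 4 * flat u o (upd x (at_ o m)) l *
    quad u o (at_ x l) (at_ x m) * flat u o (upd x (at_ o l)) m.
Proof.
move=> lm; rewrite -(pev_mvar u) -!rmorph_quad -!rmorph_flat -rmorph_flat2.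
rewrite -[4](rmorph_nat (pev u)).
apply/eqP; rewrite -subr_eq0 -!rmorphM -rmorphXn -rmorphB.
apply/eqP/cu; apply: (chart_dense ch0 (o := o)) => a X Y oXY.
rewrite rmorphB rmorphXn !rmorphM !rmorph_quad !rmorph_flat rmorph_flat2 rmorph_nat pev_mvar.
by rewrite (flat2_par _ oXY) // subrr.
Qed.

Definition triple o := exists p q r,
  [/\ [/\ tag p != tag q, tag p != tag r & tag q != tag r],
    quad u o p q != 0, quad u o p r != 0 & quad u o q r != 0].

(** Three nonzero [quad] make every [invD] invertible, and then [inv_rel], which holds on the
    closure, says that [u] is the chart point with its own rational inverse as parameters. *)
Lemma triple_chart o : triple o ->
  exists a X Y, chart o X Y /\ u =1 par a X Y.
Proof.
case=> p [q [r [[pq pr qr] Dpq Dpr Dqr]]].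
have D0 l : invD p q r u o l != 0 by exact: invD_neq0 two_neq0 Dpq Dpr Dqr.
pose d l := (invD p q r u o l)^-1.
have dD l : d l * invD p q r u o l = 1 by rewrite mulVf.
exists (u o); do 2!eexists; split; last first.
  by apply: inv_par dD => x; exact: closure_inv.
exact: inv_chart.
Qed.

Lemma quadC o p q : tag p != tag q -> quad u o p q = quad u o q p.
Proof. by move=> pq; rewrite /quad updC // mulrC. Qed.

(* If [quad] is nonzero on two of three pairs of factors, moving the base point
   in their common factor makes it nonzero on all three. *)
Lemma triple_move o p q r : tag p != tag q -> tag p != tag r -> tag q != tag r ->
  u o != 0 -> quad u o p q != 0 -> quad u o p r != 0 ->
  triple o \/ triple (upd o p).
Proof.
move=> pq pr qr uo Dpq Dpr; case: (eqVneq (quad u o q r) 0) => Dqr; last first.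
  by left; exists p, q, r.
right; have /eqP := closure_cubic o pq pr qr.
rewrite Dqr !mulr0 sqrf_eq0 => /eqP C0.
have qp : tag q != tag p by rewrite eq_sym.
have rp : tag r != tag p by rewrite eq_sym.
have back : upd (upd o p) (at_ o (tag p)) = o.
  by rewrite upd_upd // upd_id.
have D1 z : tag p != tag z -> quad u (upd o p) (at_ o (tag p)) z = - quad u o p z.
  move=> pz; rewrite /quad back; ring.
exists (at_ o (tag p)), q, r; split; first by split.
- by rewrite D1 // oppr_eq0.
- by rewrite D1 // oppr_eq0.
(* [quad] at the moved base point, expanded at the old one. As [quad u o q r] and with it [cubic]
   vanish, only the first term survives, and it is nonzero. *)
have E : u o ^+ 2 * quad u (upd o p) q r = quad u o p q * quad u o p r
    - u (upd o p) * cubic u o p q r + u (upd o p) ^+ 2 * quad u o q r.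
  by rewrite /quad /cubic; ring.
apply: contraTneq isT => D0; move: E.
rewrite D0 C0 Dqr !mulr0 subr0 addr0 => /esym/eqP.
by rewrite mulf_eq0 (negPf Dpq) (negPf Dpr).
Qed.

(** Induction on the number of factors in which [x] differs from [o]. If a factor [m] other than [l]
    differs, resetting it gives a zero [flat], so [closure_flat2] makes [flat2] zero; since [quad]
    vanishes at [l], only [u o * flat u o x l] is left of it. *)
Lemma flat_eq0 (S : {set J}) o : u o != 0 ->
  (forall p q, tag p != tag q -> tag p \notin S -> quad u o p q = 0) ->
  forall x l, l \notin S -> flat u o x l = 0.
Proof.
move=> uo Q0 x l lS; have [n] := ubnP #|[pred m | x m != o m]|.
elim: n x => [//|n IH] x le.
case: (pickP [pred m | (m != l) && (x m != o m)]) => [m /andP[ml xm]|x0].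
  have lm : l != m by rewrite eq_sym.
  have F0 : flat u o (upd x (at_ o m)) l = 0.
    apply: IH; rewrite -ltnS; apply: leq_trans le; rewrite ltnS; apply: proper_card.
    apply/properP; split; last first.
      by exists m; rewrite ?inE //= (upd_in _ (at_ o m)) eqxx.
    apply/fintype.subsetP => z; rewrite !inE; apply: contraNN => /eqP xz.
    case: (eqVneq m z) => [<-|mz]; first by rewrite (upd_in _ (at_ o m)).
    by rewrite upd_out // xz.
  have /eqP := closure_flat2 o x lm; rewrite F0 mulr0 !mul0r sqrf_eq0 /flat2 F0 mulr0 subr0.
  by rewrite Q0 // mulr0 addr0 mulf_eq0 (negPf uo) => /eqP.
have xE : upd x (at_ o l) = o.
  apply/ffunP => m; case: (eqVneq l m) => [<-|lm]; first by rewrite (upd_in _ (at_ o l)).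
  by rewrite upd_out //; have := x0 m; rewrite /= eq_sym lm => /negbFE/eqP.
have xE' : upd o (at_ x l) = x by rewrite -{1}xE upd_upd // upd_id.
by rewrite /flat xE xE' mulrC subrr.
Qed.

(** Fix a nonzero [quad u o p q]. By [triple_move] no third factor has a nonzero [quad] with [p] or
    with [q], and [closure_minor] extends this to all other indices: every nonzero [quad] lives on
    one pair of factors. *)
Lemma closure_secf (i0 j0 : J) : i0 != j0 -> (exists o, u o != 0) ->
  (forall o, ~ triple o) ->
  exists i j, i != j /\ exists v s r : mvec k K, u =1 secf (i |: [set j]) v s r.
Proof.
move=> ij0 [o uo] nt.
have star p q r : tag p != tag q -> tag p != tag r -> tag q != tag r ->
    quad u o p q != 0 -> quad u o p r = 0.
  move=> pq pr qr Dpq; apply/eqP; apply: contraT => Dpr.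
  by case: (triple_move pq pr qr uo Dpq Dpr) => /nt.
have [i [j [ij Q0]]] : exists i j, i != j /\ forall p q, tag p != tag q ->
    tag p \notin i |: [set j] -> quad u o p q = 0.
  have [[p [q [pq Dpq]]]|n] := pselect (exists p q, tag p != tag q /\ quad u o p q != 0); last first.
    (* If all [quad] vanish, any pair of factors will do. *)
    exists i0, j0; split=> // p q pq _; apply/eqP; apply: contraT => ne.
    by case: n; exists p, q.
  exists (tag p), (tag q); split=> // r s rs; rewrite !inE negb_or => /andP[rp rq].
  have pr : tag p != tag r by rewrite eq_sym.
  have qr : tag q != tag r by rewrite eq_sym.
  have pr0 : quad u o p r = 0 by exact: star qr Dpq.
  have qr0 : quad u o q r = 0.
    by apply: (star q p r) => //; [rewrite eq_sym|rewrite -quadC].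
  have sr : tag s != tag r by rewrite eq_sym.
  rewrite quadC //; apply/eqP; case: (eqVneq (tag s) (tag q)) => [sq|sq].
    have qp : tag q != tag p by rewrite eq_sym.
    have sp : tag s != tag p by rewrite sq.
    have /eqP := closure_minor o qp sr qr sp.
    by rewrite qr0 mul0r mulf_eq0 -quadC // (negPf Dpq).
  have /eqP := closure_minor o pq sr pr sq.
  by rewrite pr0 mul0r mulf_eq0 (negPf Dpq).
exists i, j; split=> //; apply: (@secfI _ _ _ _ i j u o) => //.
  by apply: flat_eq0.
move=> p p' q q' pi pi' qj qj'; apply: closure_minor; rewrite ?pi ?pi' ?qj ?qj' //.
Qed.

End At.
End Closure.

Section TangentsClosed.
Variables (K : fieldType) (ch0 : forall n, n.+1%:R != 0 :> K).
Variables (J : finType) (k : J -> nat).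
Local Notation idx := (tensor_index k).
Local Notation V := (vec K (PP idx)).
Implicit Types (v w s r X Y : mvec k K) (o x : idx) (f : {mpoly K[#|idx|]}).

Lemma dten_pair i j (A : comNzRingType) (v w : mvec k A) x : i != j ->
  (forall l, l \notin i |: [set j] -> forall a, w l a = 0) ->
  dten v w x = tensP (fun l => l \notin i |: [set j]) v x *
    (w i (x i) * v j (x j) + v i (x i) * w j (x j)).
Proof.
move=> ij w0; have Qj : less predT i j by rewrite /less eq_sym.
rewrite /dten (dtenP_D1 v w x (isT : predT i)) (dtenP_D1 v w x Qj) (tensP_D1 v x Qj).
rewrite [X in _ + _ * (_ + _ * X)](_ : _ = 0); last first.
  rewrite /dtenP big1 // => l; rewrite /less /= => /andP[li lj].
  by rewrite w0 ?mul0r // !inE negb_or li.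
have -> : tensP (fun l => l \notin i |: [set j]) v x = tensP (less (less predT i) j) v x.
  by apply: tensP_pred => l; rewrite /less !inE negb_or.
ring.
Qed.

Lemma par_secf i j (A : comNzRingType) (a : A) (X Y : mvec k A) : i != j ->
  (forall l, l \notin i |: [set j] -> forall c, Y l c = 0) ->
  par a X Y =1 secf (i |: [set j]) X
    (fun l c => if l == i then a * X l c + Y l c else X l c)
    (fun l c => if l == i then X l c else Y l c).
Proof.
move=> ij Y0 x; have ji : j != i by rewrite eq_sym.
rewrite /par (dten_pair X x ij Y0) /secf !(tensP_pair _ x ij) !eqxx (negPf ji).
rewrite /tens (_ : tensP predT X x = tensP (fun l => l \notin i |: [set j]) X x * (X i (x i) * X j (x j))).
  by ring.
rewrite -(tensP_pair X x ij) mulrC /tensP.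
by rewrite (bigID (fun l => l \in i |: [set j])).
Qed.

(** For two factors secants are tangents: [s_i s_j + r_i r_j] is the derivative at [(s_i, r_j)] in
    the direction [(r_i, s_j)]. If [s_i] or [r_j] is zero the tensor has rank one, hence lies on the
    Segre cone. *)
Lemma secf_tangent (l0 i j : J) v s r x0 : i != j ->
  let S := i |: [set j] in secf S v s r x0 != 0 ->
  exists v' w', nondeg v' /\ secf S v s r =1 dten v' w'.
Proof.
move=> ij /=; set S := i |: [set j]; move=> nz.
have ji : j != i by rewrite eq_sym.
have tvv (z : mvec k K) x : tens (fun l => if l \in S then z l else v l) x =
    tensP (fun l => l \notin S) v x * (z i (x i) * z j (x j)).
  rewrite -(tensP_pair z x ij) /tens /tensP (bigID (fun l => l \in S)) /= mulrC.
  by congr (_ * _); apply: eq_bigr => l; [move=> /negPf ->|move=> ->].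
have seg (z : mvec k K) : (forall x, secf S v s r x = tensP (fun l => l \notin S) v x * (z i (x i) * z j (x j))) ->
    exists v' w', nondeg v' /\ secf S v s r =1 dten v' w'.
  move=> E; pose v' : mvec k K := fun l => if l \in S then z l else v l.
  exists v', (fun l i => if l == l0 then v' l i else 0); split; last first.
    by move=> x; rewrite -tens_dten E -tvv.
  by apply: (@tens_nondeg _ _ _ v' x0); rewrite /v' tvv -E.
have sE x : secf S v s r x = tensP (fun l => l \notin S) v x *
    (s i (x i) * s j (x j) + r i (x i) * r j (x j)) by rewrite /secf !tensP_pair.
have [[a sa]|s0] := pselect (exists a, s i a != 0); last first.
  apply: (seg r) => x; rewrite sE (_ : s i _ = 0) ?mul0r ?add0r //.
  by apply/eqP; apply: contraT => ne; case: s0; exists (x i).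
have [[b rb]|r0] := pselect (exists b, r j b != 0); last first.
  apply: (seg s) => x; rewrite sE (_ : r j _ = 0) ?mulr0 ?addr0 //.
  by apply/eqP; apply: contraT => ne; case: r0; exists (x j).
pose v' : mvec k K := fun l => if l == i then s l else if l == j then r l else v l.
pose w' : mvec k K := fun l c => if l == i then r l c else if l == j then s l c else 0.
exists v', w'; split.
  move=> l; rewrite /v'; case: (eqVneq l i) => [->|li]; first by exists a.
  case: (eqVneq l j) => [->|lj]; first by exists b.
  move: nz; rewrite /secf mulf_eq0 negb_or => /andP[/prodf_neq0 /(_ l) nz _].
  by exists (x0 l); apply: nz; rewrite !inE negb_or li.
move=> x; rewrite (dten_pair _ _ ij); last first.
  by move=> l; rewrite !inE negb_or => /andP[/negPf li /negPf lj] c; rewrite /w' li lj.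
rewrite sE -/S; congr (_ * _); last by rewrite /v' /w' !eqxx (negPf ji) addrC; ring.
apply: tensP_ext => l; rewrite !inE negb_or => /andP[/negPf li /negPf lj] c.
by rewrite /v' li lj.
Qed.

Lemma secants_tangents (i j : J) : i != j -> secants k K (i |: [set j]) `<=` tangents K k.
Proof.
move=> ij u [pu [v [s [r uE]]]]; split=> //; have /pointsPP[x ux] := pu.
rewrite uE in ux; have [v' [w' [nv E]]] := secf_tangent i ij ux.
by exists v', w'; split=> // y; rewrite uE E.
Qed.

Lemma chart_tangents (u : V) o a X Y : points K (PP idx) u -> chart o X Y ->
  u =1 par a X Y -> J -> tangents K k u.
Proof.
move=> pu oXY uE l0; split=> //; exists X.
exists (fun m i => if m == l0 then a * X m i + Y m i else Y m i); split.
  by move=> l; exists (o l); rewrite (oXY l).1 oner_neq0.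
by move=> x; rewrite uE (par_dten a X Y l0).
Qed.

Variables (i0 j0 : J).
Hypothesis ij0 : i0 != j0.

Lemma zclosure_tangents : zclosure (tangents K k) `<=` tangents K k.
Proof.
move=> u cu; have pu := cu.1; have H := in_closureI ch0 i0 cu.
have [[o to]|nt] := pselect (exists o, triple u o).
  have [a [X [Y [oXY uE]]]] := triple_chart ch0 H to.
  exact: chart_tangents oXY uE i0.
have n o : ~ triple u o by move=> h; apply: nt; exists o.
have [i [j [ij [v [s [r uE]]]]]] := closure_secf ch0 H ij0 ((pointsPP u).1 pu) n.
apply: (secants_tangents ij); split=> //; by exists v, s, r.
Qed.

Lemma tangents_closed : zclosed (tangents K k).
Proof.
suff -> : tangents K k = zclosure (tangents K k) by exact: zclosure_closed.
apply/seteqP; split; last exact: zclosure_tangents.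
by apply: subset_zclosure => u [].
Qed.

End TangentsClosed.

(** * Smooth points *)

Section ChartPolynomials.
Variables (K : fieldType) (ch0 : forall n, n.+1%:R != 0 :> K).
Variables (J : finType) (k : J -> nat).
Local Notation idx := (tensor_index k).
Local Notation V := (vec K (PP idx)).
Implicit Types (X Y : mvec k K) (o x : idx) (f : {mpoly K[#|idx|]}).

(* [None] stands for the scalar [a] of [par a X Y], and [Some (b, (l, j))] for
   the [j]-th free entry of [X l] (b = false) or [Y l] (b = true). *)
Definition param : finType := option (bool * {l : J & 'I_(k l)}).

Lemma card_param : #|param| = (2 * \sum_l k l).+1.
Proof.
rewrite card_option card_prod card_bool card_tagged sumnE big_map big_enum /=.
by congr (2 * _).+1; apply: eq_bigr => l _; rewrite card_ord.
Qed.

Section Chartpar.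
Variable (A : comNzRingType).
Implicit Types (z : param -> A).
Definition ppnt l (j : 'I_(k l)) : {l : J & 'I_(k l)} := Tagged (fun l => 'I_(k l)) j.
Definition chartX o z : mvec k A := fun l i =>
  if unlift (o l) i is Some j then z (Some (false, ppnt j)) else 1.
Definition chartY o z : mvec k A := fun l i =>
  if unlift (o l) i is Some j then z (Some (true, ppnt j)) else 0.

Lemma chartXY o z : chart o (chartX o z) (chartY o z).
Proof. by move=> l; rewrite /chartX /chartY unlift_none. Qed.

Definition chart_inv o a (X Y : mvec k A) : param -> A := fun c =>
  match c with
  | None => a
  | Some (b, q) => (if b then Y else X) (tag q) (lift (o (tag q)) (tagged q))
  end.

Lemma chart_invX o a (X Y : mvec k A) : chart o X Y ->
  forall l i, chartX o (chart_inv o a X Y) i = X l i.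
Proof.
move=> oXY l i; rewrite /chartX; case: unliftP => [j ->|->] //.
by case: (oXY l).
Qed.
Lemma chart_invY o a (X Y : mvec k A) : chart o X Y ->
  forall l i, chartY o (chart_inv o a X Y) i = Y l i.
Proof.
move=> oXY l i; rewrite /chartY; case: unliftP => [j ->|->] //.
by case: (oXY l).
Qed.
End Chartpar.

Definition chart_pol o x : {mpoly K[#|param|]} :=
  par (mvar K None) (chartX o (@mvar K param)) (chartY o (@mvar K param)) x.

Lemma ev_chart_pol (A : comAlgType K) (z : param -> A) o x :
  ev z (chart_pol o x) = par (z None) (chartX o z) (chartY o z) x.
Proof.
rewrite rmorph_par /= ev_var; congr (par _ _ _ x);
  apply: functional_extensionality_dep => l; apply/funext => i.
  by rewrite /chartX; case: unlift => [j|]; rewrite /= ?ev_var ?rmorph1.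
by rewrite /chartY; case: unlift => [j|]; rewrite /= ?ev_var ?rmorph0.
Qed.

Lemma pev_chart_pol (z : param -> K) o x :
  pev z (chart_pol o x) = par (z None) (chartX o z) (chartY o z) x.
Proof. exact: (@ev_chart_pol K^o z o x). Qed.

Lemma pev_ev (I P : finType) (z : P -> K) (phi : I -> {mpoly K[#|P|]}) (f' : {mpoly K[#|I|]}) :
  pev z (ev phi f') = pev (fun y => pev z (phi y)) f'.
Proof.
apply: (@ev_morph K I {mpoly K[#|P|]} K^o (@ev K P K^o z) phi f') => c.
by rewrite /= ev_scale rmorph1.
Qed.

Lemma chart_pol_dense o f : (forall z, pev (fun x => pev z (chart_pol o x)) f = 0) ->
  vanT f.
Proof.
move=> H; apply: (chart_dense ch0 (o := o)) => a X Y oXY.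
rewrite -[RHS](H (chart_inv o a X Y)); apply: pev_ext => x.
rewrite pev_chart_pol /= /par; congr (_ * _ + _).
  by apply: tensP_ext => l _ i; rewrite (chart_invX a oXY).
by apply: dtenP_ext => l _ i; rewrite ?(chart_invX a oXY) ?(chart_invY a oXY).
Qed.

Lemma tangents_chain_bound Z r : J -> chain_between Z (tangents K k) r ->
  (r <= 2 * \sum_l k l)%N.
Proof.
move=> l0 cZ; rewrite -ltnS -card_param.
pose o : idx := finfun (fun _ => ord0).
apply: (chain_bound ch0 (phi := chart_pol o) cZ) => f f0.
apply/(vanTP ch0 l0)/(@chart_pol_dense o) => z.
by rewrite -pev_ev f0 rmorph0.
Qed.

End ChartPolynomials.

Section VectorDim.
Variables (K : fieldType) (I P : finType).
Variable F : {ffun P -> K^o} -> vec K (PP I).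
Hypothesis linF : linear F.
Hypothesis injF : forall d, F d = 0 -> d = 0.

HB.instance Definition _ := GRing.isLinear.Build K {ffun P -> K^o} (vec K (PP I)) *:%R F linF.

Lemma dim_limg : \dim (limg (linfun F)) = #|P|.
Proof.
rewrite limg_dim_eq ?dimvf /=; last first.
  apply/eqP; rewrite -subv0; apply/subvP => v; rewrite memv_cap => /andP[_].
  by rewrite memv_ker lfunE memv0 => /eqP/injF ->.
by rewrite /dim /= muln1.
Qed.

Lemma has_vdim_image : has_vdim [set w | exists d, w = F d] #|P|.
Proof.
exists (limg (linfun F)); last exact: dim_limg.
apply/seteqP; split=> w /=.
  by case=> d ->; apply/memv_imgP; exists d; rewrite ?memvf ?lfunE.
by case/memv_imgP => d _ ->; exists d; rewrite lfunE.
Qed.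

Lemma has_vdim_ge S n : has_vdim S n -> (forall d, S (F d)) -> (#|P| <= n)%N.
Proof.
case=> U -> <- H; rewrite -dim_limg; apply: dimvS; apply/subvP => w.
by case/memv_imgP => d _ ->; rewrite lfunE; exact: H.
Qed.

End VectorDim.

Section Smooth.
Variables (K : fieldType) (ch0 : forall n, n.+1%:R != 0 :> K).
Variables (J : finType) (k : J -> nat).
Local Notation idx := (tensor_index k).
Local Notation V := (vec K (PP idx)).
Local Notation pt := {l : J & 'I_(k l).+1}.
Local Notation T := (tangents K k).
Variables (o : idx) (b : param k -> K) (p1 p2 p3 : pt).
Hypotheses (t12 : tag p1 != tag p2) (t13 : tag p1 != tag p3) (t23 : tag p2 != tag p3).
Local Notation X := (chartX o b).
Local Notation Y := (chartY o b).
Hypotheses (Y1 : Y (tagged p1) != 0) (Y2 : Y (tagged p2) != 0) (Y3 : Y (tagged p3) != 0).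
Variable u : V.
Hypothesis uE : u =1 fun x => pev b (chart_pol K o x).
Hypothesis Tu : T u.
Hypothesis T_closed : zclosed T.

Let oXY := chartXY o b.
Let l0 := tag p1.

Let up x : (u x : K) = par (b None) X Y x.
Proof. by rewrite uE pev_chart_pol. Qed.

Definition dchart (d : {ffun param k -> K^o}) : V :=
  [ffun x => dird b d (chart_pol K o x)].

Lemma dchart_linear : linear dchart.
Proof.
move=> c d e; apply/ffunP => x; rewrite !ffunE /dird /GRing.scale /= mulr_sumr -big_split.
by apply: eq_bigr => t _; rewrite !ffunE /=; rewrite mulrDr mulrCA.
Qed.

Let up' : (fun x => u x : K) = par (b None) X Y.
Proof. by apply/funext. Qed.

Let D0 l : invD p1 p2 p3 (fun x => u x : K) o l != 0.
Proof.
apply: invD_neq0; first exact: two_neq0.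
- by rewrite up' (quad_par _ oXY) // mulf_neq0.
- by rewrite up' (quad_par _ oXY) // mulf_neq0.
- by rewrite up' (quad_par _ oXY) // mulf_neq0.
Qed.

Let bd (d : param k -> K) (c : param k) : dual K := (b c, d c).

Let ev_bd d x : ev (bd d) (chart_pol K o x) = (u x, dird b d (chart_pol K o x)).
Proof. by rewrite ev_dual uE. Qed.

Lemma dchart_tangent d : cone_tangent T u (dchart d).
Proof.
apply/(cone_tangentE ch0 u _ (@tangents_cone _ _ _)) => f /(vanTP ch0 l0) vf.
pose zt (c : param k) := (b c)%:P + 'X * (d c : K)%:P.
have z0 : (fun c => (zt c).[0]) = b by apply/funext => c; rewrite !hornerE.
have z1 : (fun c => ((zt c)^`()).[0]) = d :> (param k -> K).
  by apply/funext => c; rewrite derivD derivM !derivC derivX !hornerE.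
have := curve_dird ch0 (f := f) (g := fun x => ev zt (chart_pol K o x)) (oner_neq0 _).
have -> : (fun x => (ev zt (chart_pol K o x)).[0]) = u.
  by apply/funext => x; rewrite pev_horner z0 uE.
have -> : (fun x => ((ev zt (chart_pol K o x))^`()).[0]) = dchart d.
  by apply/funext => x; rewrite ev_deriv0 z0 z1 ffunE.
apply=> t _; under pev_ext => x do rewrite pev_horner pev_chart_pol.
rewrite (pev_ext f (par_dten _ _ _ l0)); exact: vf.
Qed.

Let invD_dual (U : idx -> dual K) l : (forall x, (U x).1 = u x) ->
  (invD p1 p2 p3 U o l).1 != 0.
Proof.
move=> U1; rewrite -[_.1]/(dfst _) rmorph_invD.
rewrite (_ : _ \o _ = (fun x => u x : K)) //.
by apply/funext => x; exact: U1.
Qed.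

(** The dual point [u + e w] satisfies [inv_rel], and its denominators are units because their first
    components are nonzero. The rational inverse yields parameters [b + e d] over the dual numbers,
    and [d] is the required preimage. *)
Lemma tangent_dchart w : cone_tangent T u w -> exists d, w = dchart d.
Proof.
move/(cone_tangentE ch0 u _ (@tangents_cone _ _ _)) => H.
pose U x : dual K := (u x, w x).
have rel x : inv_rel p1 p2 p3 U o x = 0.
  rewrite (_ : U = ev U \o @mvar K idx); last by apply/funext => y; rewrite /= ev_var.
  rewrite -rmorph_inv_rel.
  have vf : vanT (inv_rel p1 p2 p3 (@mvar K idx) o x).
    apply: (chart_dense ch0 (o := o)) => a X' Y' oXY'.
    by rewrite rmorph_inv_rel pev_mvar inv_rel_par.
  apply: dird_dual; last by apply: H; exact/(vanTP ch0 l0).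
  by rewrite (pev_ext _ up) (pev_ext _ (par_dten _ _ _ l0)) vf.
pose dd l := dinv (invD p1 p2 p3 U o l).
have ddD l : dd l * invD p1 p2 p3 U o l = 1 by apply: dinvP; exact: invD_dual.
have UE := inv_par rel ddD; have ch := inv_chart ddD.
pose z := chart_inv o (U o) (fun l i => dd l * invX p1 p2 p3 U o i)
  (fun l i => dd l * invY p1 p2 p3 U o i).
have Uz x : U x = ev z (chart_pol K o x).
  rewrite ev_chart_pol UE /par /z /=; congr (_ * _ + _).
    by apply: tensP_ext => l _ i; rewrite (chart_invX _ ch).
  by apply: dtenP_ext => l _ i; rewrite ?(chart_invX _ ch) ?(chart_invY _ ch).
have U1 : @dfst K \o U = par (b None) X Y by apply/funext => x /=; rewrite -up.
have dd1 l : (dd l).1 * invD p1 p2 p3 (par (b None) X Y) o l = 1.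
  by have := congr1 (@dfst K) (ddD l); rewrite rmorphM rmorph1 rmorph_invD U1.
have z1 c : (z c).1 = b c.
  case: c => [[[] [l j]]|].
  - rewrite (_ : (z _).1 = dfst (dd l * invY p1 p2 p3 U o (lift (o l) j))) //.
    rewrite rmorphM rmorph_invY U1 invY_par // mulrA.
    by rewrite [_ * invD _ _ _ _ _ _]dd1 mul1r /chartY liftK.
  - rewrite (_ : (z _).1 = dfst (dd l * invX p1 p2 p3 U o (lift (o l) j))) //.
    rewrite rmorphM rmorph_invX U1 invX_par // mulrA.
    by rewrite [_ * invD _ _ _ _ _ _]dd1 mul1r /chartX liftK.
  by rewrite -[LHS]/(u o : K) up (par0 _ oXY).
exists [ffun c => (z c).2]; apply/ffunP => x; rewrite ffunE.
rewrite -[LHS]/((U x).2) Uz -[X in _ = dird _ X _](_ : (fun c => (z c).2) = _); last first.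
  by apply/funext => c; rewrite ffunE.
have -> : z = bd (fun c => (z c).2).
  by apply/funext => c; rewrite /bd -z1 -surjective_pairing.
by rewrite ev_bd.
Qed.

(** If the differential kills [d], the chart at [b + e d] has all its entries in [K]; the
    parameters, being rational in the entries, then lie in [K] too. *)
Lemma dchart_inj d : dchart d = 0 -> d = 0.
Proof.
move=> dd0; have U0 x : ev (bd d) (chart_pol K o x) = (u x)%:A.
  rewrite ev_bd dualA; congr pair.
  by have := congr1 (fun z : V => z x) dd0; rewrite !ffunE.
pose U := par (bd d None) (chartX o (bd d)) (chartY o (bd d)).
have UE : U = in_alg (dual K) \o (fun x => u x : K).
  by apply/funext => x; rewrite /U -ev_chart_pol U0.
have ch := chartXY o (bd d).
have A2 (a : K) : (in_alg (dual K) a).2 = 0 by exact: (congr1 (@dsnd K) (dualA a)).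
have A1 (a : K) : (in_alg (dual K) a).1 = a by exact: (congr1 (@dfst K) (dualA a)).
have D2 l : (invD p1 p2 p3 U o l).2 = 0 by rewrite UE -rmorph_invD; exact: A2.
have D1 l : (invD p1 p2 p3 U o l).1 != 0.
  by apply: invD_dual => x; rewrite UE; exact: A1.
apply/ffunP => -[[[] [l j]]|].
- have : (invY p1 p2 p3 U o (lift (o l) j)).2 = 0 by rewrite UE -rmorph_invY; exact: A2.
  rewrite invY_par // -/U dualM2 D2 mul0r addr0 /chartY liftK => /eqP.
  by rewrite mulf_eq0 (negPf (D1 l)) ffunE => /eqP.
- have : (invX p1 p2 p3 U o (lift (o l) j)).2 = 0 by rewrite UE -rmorph_invX; exact: A2.
  rewrite invX_par // -/U dualM2 D2 mul0r addr0 /chartX liftK => /eqP.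
  by rewrite mulf_eq0 (negPf (D1 l)) ffunE => /eqP.
have : (U o).2 = 0 by rewrite UE; exact: A2.
by rewrite /U (par0 _ ch) /= ffunE.
Qed.

Lemma tangent_dim : has_vdim (cone_tangent T u) (2 * \sum_l k l).+1.
Proof.
rewrite -card_param.
rewrite (_ : cone_tangent T u = [set w | exists d, w = dchart d]).
  exact: has_vdim_image dchart_linear dchart_inj.
apply/seteqP; split=> w; first exact: tangent_dchart.
by case=> d ->; exact: dchart_tangent.
Qed.

End Smooth.

Section Homogeneous.
Variables (K : fieldType) (J : finType) (k : J -> nat).
Local Notation idx := (tensor_index k).

Lemma mvar_homog (I : finType) (x : I) : mvar K x \is 1.-homog.
Proof. by rewrite /mvar dhomogX /= mdeg1. Qed.

Lemma quad_homog o p q : quad (@mvar K idx) o p q \is 2.-homog.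
Proof. by rewrite /quad rpredB // (@dhomogM _ _ _ 1 _ 1) ?mvar_homog. Qed.

Lemma base_homog o p q r : base (@mvar K idx) o p q r \is 2.-homog.
Proof.
by rewrite /base !rpredB ?rpredD // (@dhomogM _ _ _ 1 _ 1) ?mvar_homog.
Qed.

Lemma cubic_homog o p q r : cubic (@mvar K idx) o p q r \is 3.-homog.
Proof.
have m1 (I : finType) (x : I) := mvar_homog x.
have m2 (I : finType) (x y : I) : mvar K x * mvar K y \is 2.-homog.
  by rewrite (@dhomogM _ _ _ 1 _ 1).
rewrite /cubic expr2 rpredD ?rpredB // ?mulr_natl ?rpredMn //.
- by rewrite (@dhomogM _ _ _ 2 _ 1) ?m1 ?m2.
- by rewrite (@dhomogM _ _ _ 1 _ 2) ?m1 ?rpredD ?m2.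
by rewrite (@dhomogM _ _ _ 2 _ 1) ?m1 ?m2.
Qed.

End Homogeneous.

(** * Chains of full length at a smooth point *)

Section SmoothChain.
Variables (K : fieldType) (ch0 : forall n, n.+1%:R != 0 :> K).
Variables (J : finType) (k : J -> nat).
Local Notation idx := (tensor_index k).
Local Notation V := (vec K (PP idx)).
Local Notation pt := {l : J & 'I_(k l).+1}.
Local Notation T := (tangents K k).
Hypothesis T_closed : zclosed T.

Lemma scaled_chart_tangents (o : idx) (a c : K) (X Y : mvec k K) (u : V) :
  J -> points K (PP idx) u ->
  chart o X Y -> (forall x, u x = c * par a X Y x) -> T u.
Proof.
move=> l0 pu oXY uE.
apply: (@chart_tangents _ _ _ u o (c * a) X (fun l i => c * Y l i)) => //.
  by move=> l; case: (oXY l) => -> ->; rewrite mulr0; split.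
by move=> x; rewrite uE /par mulrDr mulrA dten_scale.
Qed.

Lemma point_closed (u : V) : points K (PP idx) u -> zclosed [set v | peq v u].
Proof.
move=> pu; rewrite (_ : [set v | _] = zclosure [set v | peq v u]).
  exact: zclosure_closed.
have sub : [set v | peq v u] `<=` points K (PP idx).
  move=> v /peqPP[c c0 ->]; have /pointsPP[x ux] := pu.
  by apply/pointsPP; exists x; rewrite scaleffE mulf_neq0.
apply/seteqP; split; first exact: subset_zclosure.
move=> v [/pointsPP[y vy] H]; have /pointsPP[x ux] := pu; apply/peqPP.
pose U : idx -> K := u; pose W : idx -> K := v.
have E z : W z * U x = W x * U z.
  have := H (U x *: mvar K z - U z *: mvar K x).
  rewrite rmorphB /= !pev_scale !pev_var => h; apply/eqP; rewrite -subr_eq0.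
  rewrite (mulrC (W z)) (mulrC (W x)); apply/eqP; apply: h.
    apply/is_mhomogP; exists 1%N.
    by rewrite rpredB // dhomogZ // mvar_homog.
  move=> w /peqPP[c c0 ->]; rewrite rmorphB /= !pev_scale !pev_var !scaleffE.
  by rewrite /U; ring.
exists (W x / U x).
  rewrite mulf_neq0 ?invr_eq0 //; apply: contraNneq vy => Wx.
  by have /eqP := E y; rewrite Wx mul0r mulf_eq0 (negPf ux) orbF.
by apply/ffunP => z; rewrite scaleffE mulrAC -[u z]/(U z) -E mulfK.
Qed.

Variables (o : idx) (b : param k -> K) (l1 : J) (j1 : 'I_(k l1)) (p2 p3 : pt).
Let p1 : pt := pnt (lift (o l1) j1).
Let c0 : param k := Some (true, ppnt j1).
Hypotheses (t12 : l1 != tag p2) (t13 : l1 != tag p3) (t23 : tag p2 != tag p3).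
Local Notation X := (chartX o b).
Local Notation Y := (chartY o b).
Hypotheses (b0 : b c0 != 0) (Y2 : Y (tagged p2) != 0) (Y3 : Y (tagged p3) != 0).

Let C (z : param k -> K) x := pev z (chart_pol K o x).
Let Cpar z : C z = par (z None) (chartX o z) (chartY o z).
Proof. by apply/funext => x; exact: pev_chart_pol. Qed.
Let Y1 (z : param k -> K) : chartY o z (tagged p1) = z c0.
Proof. by rewrite /chartY liftK. Qed.
Let incr (c c' : param k) : K := if c' == c then b c + 1 else b c'.

Let Cquad (z : param k -> K) p q : tag p != tag q ->
  pev (C z) (quad (@mvar K idx) o p q) = chartY o z (tagged p) * chartY o z (tagged q).
Proof. by move=> pq; rewrite rmorph_quad pev_mvar Cpar (quad_par _ (chartXY o z)). Qed.

Let Yincr (c : param k) (p : pt) : (if c is Some (true, q) then tag p != tag q else true) ->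
  chartY o (incr c) (tagged p) = Y (tagged p).
Proof.
case: p => l i /= cp; rewrite /chartY; case: unlift => [j|] //.
rewrite /incr; case: eqP => // e; move: cp; rewrite -e /=.
by rewrite eqxx.
Qed.

(** Scaling a tensor scales [a] and [Y] together, and fixing [c0] removes this freedom. Each other
    parameter is then, up to constants, a quotient of forms of equal degree: [quad / quad] for [Y],
    [base / quad] for [X], [u_o * quad / cubic] for [a]. The form compares the quotient with its
    value at [b], denominators cleared. *)
Lemma chart_sep c : c != c0 -> exists f, [/\ @is_multihomog K (PP idx) f,
    forall z, z c0 = b c0 -> z c = b c -> pev (C z) f = 0 &
    pev (C (incr c)) f != 0].
Proof.
move=> cc0; have n2 := two_neq0 ch0.
have i0 : incr c c0 = b c0 by rewrite /incr eq_sym (negPf cc0).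
have ic : incr c c = b c + 1 by rewrite /incr eqxx.
case: c cc0 i0 ic => [[[] [l j]]|] cc0 i0 ic.
- pose p := pnt (lift (o l) j); pose r := if l == tag p2 then p3 else p2.
  have pr : tag p != tag r by rewrite /r /p /=; case: (eqVneq l (tag p2)) => [e|//]; rewrite e.
  have p1r : tag p1 != tag r by rewrite /r; case: ifP.
  have Yr : Y (tagged r) != 0 by rewrite /r; case: ifP.
  have Yp z : chartY o z (tagged p) = z (Some (true, ppnt j)) by rewrite /chartY liftK.
  exists (b c0 *: quad (@mvar K idx) o p r - b (Some (true, ppnt j)) *: quad (@mvar K idx) o p1 r).
  split.
  + apply/is_mhomogP; exists 2%N.
    by rewrite rpredB // dhomogZ // quad_homog.
  + move=> z z0 zc; rewrite rmorphB /= !pev_scale !Cquad // Y1 Yp z0 [z _]zc; ring.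
  rewrite rmorphB /= !pev_scale !Cquad // Y1 Yp i0 [incr _ _]ic Yincr; last by rewrite /= eq_sym.
  rewrite (_ : _ - _ = b c0 * Y (tagged r)) ?mulf_neq0 //; ring.
- pose p := pnt (lift (o l) j); pose a := aux p1 p2 p3 l.
  have [h1 h2 h3] := @auxP _ _ p1 p2 p3 t12 t13 t23 l.
  have Xp z : chartX o z (tagged p) = z (Some (false, ppnt j)) by rewrite /chartX liftK.
  have Cb z : pev (C z) (base (@mvar K idx) o p a.1 a.2) =
      z (Some (false, ppnt j)) * (2 * (chartY o z (tagged a.1) * chartY o z (tagged a.2))).
    by rewrite rmorph_base pev_mvar Cpar (base_par _ (chartXY o z)) // Xp.
  exists (base (@mvar K idx) o p a.1 a.2 - (2 * b (Some (false, ppnt j))) *: quad (@mvar K idx) o a.1 a.2).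
  split.
  + apply/is_mhomogP; exists 2%N.
    by rewrite rpredB ?base_homog // dhomogZ // quad_homog.
  + move=> z z0 zc; rewrite rmorphB /= pev_scale Cquad // Cb [z (Some (false, _))]zc; ring.
  rewrite rmorphB /= pev_scale Cquad // Cb [incr _ (Some (false, _))]ic !Yincr //.
  rewrite (_ : _ - _ = 2 * (Y (tagged a.1) * Y (tagged a.2))); last ring.
  have Y1' : Y (tagged p1) != 0 by rewrite Y1.
  by rewrite !mulf_neq0 // /a /aux; case: ifP => // _; case: ifP.
exists ((2 * b c0) *: (mvar K o * quad (@mvar K idx) o p2 p3) - b None *: cubic (@mvar K idx) o p1 p2 p3).
have Co z : pev (C z) (mvar K o) = z None.
  by rewrite pev_var Cpar (par0 _ (chartXY o z)).
have Cc z : pev (C z) (cubic (@mvar K idx) o p1 p2 p3) =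
    2 * (z c0 * chartY o z (tagged p2) * chartY o z (tagged p3)).
  by rewrite rmorph_cubic pev_mvar Cpar (cubic_par _ (chartXY o z)) // Y1.
split.
- apply/is_mhomogP; exists 3%N.
  rewrite rpredB // dhomogZ ?cubic_homog // (@dhomogM _ _ _ 1 _ 2) ?mvar_homog //.
  exact: quad_homog.
- move=> z z0 zc; rewrite rmorphB /= !pev_scale rmorphM /= Cquad // Cc Co z0 zc; ring.
rewrite rmorphB /= !pev_scale rmorphM /= Cquad // Cc Co i0 ic !Yincr //.
rewrite (_ : _ - _ = 2 * b c0 * (Y (tagged p2) * Y (tagged p3))); last ring.
by rewrite !mulf_neq0.
Qed.

Variable u : V.
Hypothesis uE : u =1 fun x => pev b (chart_pol K o x).
Hypothesis pu : points K (PP idx) u.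

(** All parameters but [c0] are freed one by one, starting from the single point [b]. The one that
    is kept accounts for projective scaling. *)
Lemma smooth_chain : chain_between [set v | peq v u] T (2 * \sum_l k l).
Proof.
pose s := [seq c <- enum (param k) | c != c0].
have us : uniq s by rewrite filter_uniq ?enum_uniq.
have ss : size s = (2 * \sum_l k l)%N.
  have := count_predC (pred1 c0) (enum (param k)).
  rewrite -cardE card_param count_uniq_mem ?enum_uniq // mem_enum add1n => -[<-].
  by rewrite size_filter.
have /pointsPP[x0 ux0] := pu.
have := @flag_chain _ ch0 idx (param k) (chart_pol K o) b s T T_closed.
have H1 v l z : points K (PP idx) v -> (forall x, v x = l * pev z (chart_pol K o x)) -> T v.
  move=> pv vE; apply: (scaled_chart_tangents l1 pv (chartXY o z)) => x.
  by rewrite vE pev_chart_pol.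
move=> /(_ H1 (ex_intro _ x0 _)) H.
have {H} ch : chain (fun i => zclosure (fimage (chart_pol K o) b s i)) T (size s).
  apply: H; first by rewrite -uE.
  move=> i ilt; pose c := nth c0 s i; have cs : c \in s by exact: mem_nth.
  have cc0 : c != c0 by move: cs; rewrite mem_filter => /andP[].
  have c0s m : c0 \notin take m s.
    by apply: contraT => /negPn/mem_take; rewrite mem_filter eqxx.
  have ct : c \notin take i s.
    move: us; rewrite -{1}(cat_take_drop i s) (drop_nth c0 ilt) cat_uniq.
    by case/and3P => _ /hasPn /(_ c (mem_head _ _)).
  have [f [hf f0 fn]] := chart_sep cc0; exists f; split=> //.
    by move=> z hz; apply: f0; apply: hz.
  exists (incr c) => // c' c't; rewrite /incr; case: eqP => // e; move: c't.
  by rewrite e (take_nth c0) // mem_rcons mem_head.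
have := chain_drop ch (leq0n _); rewrite subn0 ss.
rewrite (_ : zclosure _ = [set v | peq v u]) //.
have im v : fimage (chart_pol K o) b s 0 v <-> peq v u.
  split.
    case=> pv [l [z [hz vE]]]; apply/peqPP; exists l.
      apply/eqP => l00; have /pointsPP[x] := pv.
      by rewrite vE l00 mul0r eqxx.
    have zb : z = b by apply/funext => c; apply: hz; rewrite take0.
    by apply/ffunP => x; rewrite scaleffE vE zb -uE.
  case/peqPP => c cn ->; split.
    by apply/pointsPP; exists x0; rewrite scaleffE mulf_neq0.
  by exists c, b; split=> // x; rewrite scaleffE uE.
apply/seteqP; split.
  by apply: zclosure_min => [|v /im//]; exact: point_closed.
move=> v /im; apply: subset_zclosure; exact: fimage_points.
Qed.

Lemma smooth_tangent_point : T u -> smooth_at T u.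
Proof.
move=> Tu; exists (2 * \sum_l k l)%N; last first.
  apply: (@tangent_dim _ ch0 _ _ o b p1 p2 p3) => //.
  by rewrite Y1.
split; first exact: smooth_chain.
by move=> s; exact: (tangents_chain_bound ch0 l1).
Qed.

End SmoothChain.

(** * Singular points *)

Section DirdLinear.
Variables (K : fieldType) (I : finType).
Implicit Types (p w : I -> K) (f : {mpoly K[#|I|]}).

Lemma dird_lin p (n : finType) (c : n -> K) (w : n -> I -> K) f :
  dird p (fun x => \sum_q c q * w q x) f = \sum_q c q * dird p (w q) f.
Proof.
rewrite /dird; under eq_bigr do rewrite mulr_sumr.
rewrite exchange_big; apply: eq_bigr => q _; rewrite mulr_sumr.
by apply: eq_bigr => t _; rewrite mulrCA.
Qed.

Lemma dirdD p w w' f : dird p (fun x => w x + w' x) f = dird p w f + dird p w' f.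
Proof. by rewrite /dird -big_split; apply: eq_bigr => t _; rewrite /= mulrDr. Qed.

Lemma dirdZ p c w f : dird p (fun x => c * w x) f = c * dird p w f.
Proof. by rewrite /dird mulr_sumr; apply: eq_bigr => t _; rewrite mulrCA. Qed.

Lemma dird_ext p p' w w' f : p =1 p' -> w =1 w' -> dird p w f = dird p' w' f.
Proof. by move=> /funext -> /funext ->. Qed.

Lemma dird_horner (g : I -> {poly K}) w f t :
  (\sum_s ev g (f^`M(s)) * (w (enum_val s))%:P).[t] = dird (fun x => (g x).[t]) w f.
Proof.
rewrite horner_sum; apply: eq_bigr => s _.
by rewrite hornerM hornerC pev_horner.
Qed.
End DirdLinear.

(** * Tangent vectors at points of rank at most two in a pair of factors *)

Section SecantTangents.
Variables (K : fieldType) (ch0 : forall n, n.+1%:R != 0 :> K).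
Variables (J : finType) (k : J -> nat) (i j : J).
Hypothesis ij : i != j.
Local Notation idx := (tensor_index k).
Local Notation S := (i |: [set j]).
Implicit Types (v w g h e : mvec k K) (f : {mpoly K[#|idx|]}) (x : idx).

Definition elem v g h x : K :=
  tensP (fun l => l \notin S) v x * (g i (x i) * h j (x j)).
Definition repl v l w : mvec k K := fun m => if m == l then w m else v m.
Definition comb (a b : K) g h : mvec k K := fun l c => a * g l c + b * h l c.

Let ji : j != i. Proof. by rewrite eq_sym. Qed.

Lemma tens_elem v g h x :
  tens (fun l => if l == i then g l else if l == j then h l else v l) x = elem v g h x.
Proof.
rewrite /tens /tensP (bigID (fun l => l \in S)) /= mulrC /elem; congr (_ * _).
  apply: eq_bigr => l; rewrite !inE negb_or => /andP[/negPf -> /negPf ->] //.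
apply: etrans (tensP_pair (fun l => if l == i then g l else if l == j then h l else v l) x ij) _.
by rewrite !eqxx (negPf ji).
Qed.

Lemma dten_single v w l x :
  dten v (fun m => if m == l then w m else fun _ => 0) x = tens (repl v l w) x.
Proof.
rewrite /dten (dtenP_D1 _ _ _ (isT : predT l)) eqxx.
rewrite [dtenP _ _ _ _]big1 ?mulr0 ?addr0; last first.
  by move=> m /andP[_ /negPf ->]; rewrite mul0r.
rewrite /tens (tensP_D1 _ _ (isT : predT l)) /repl eqxx; congr (_ * _).
by apply: tensP_ext => m /andP[_ /negPf ->].
Qed.

Lemma elem_dten v g1 h1 g2 h2 x : elem v g1 h1 x + elem v g2 h2 x =
  dten (fun l => if l == i then g1 l else if l == j then h2 l else v l)
    (fun l => if l == i then g2 l else if l == j then h1 l else fun _ => 0) x.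
Proof.
rewrite (dten_pair _ _ ij); last first.
  by move=> l; rewrite !inE negb_or => /andP[/negPf -> /negPf ->].
rewrite !eqxx (negPf ji) /elem -mulrDr [g2 _ _ * _ + _]addrC; congr (_ * _).
apply: tensP_ext => l; rewrite !inE negb_or => /andP[/negPf -> /negPf ->] //.
Qed.

Section Functional.
Variable f : {mpoly K[#|idx|]}.
Hypothesis vf : vanT f.

Lemma vanT_elem v g1 h1 g2 h2 :
  pev (fun x => elem v g1 h1 x + elem v g2 h2 x) f = 0.
Proof. by rewrite (pev_ext f (elem_dten v g1 h1 g2 h2)). Qed.

Lemma dird_left v g1 h1 g2 h2 g :
  dird (fun x => elem v g1 h1 x + elem v g2 h2 x) (elem v g h2) f = 0.
Proof.
apply: (line_dird ch0) => t; rewrite -[RHS](vanT_elem v g1 h1 (comb 1 t g2 g) h2).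
by apply: pev_ext => x; rewrite /elem /comb; ring.
Qed.

Lemma dird_right v g1 h1 g2 h2 h :
  dird (fun x => elem v g1 h1 x + elem v g2 h2 x) (elem v g2 h) f = 0.
Proof.
apply: (line_dird ch0) => t; rewrite -[RHS](vanT_elem v g1 h1 g2 (comb 1 t h2 h)).
by apply: pev_ext => x; rewrite /elem /comb; ring.
Qed.

Lemma tensP_repl v w l x : l \notin S ->
  tensP (fun l => l \notin S) (repl v l w) x =
  w l (x l) * tensP (less (fun l => l \notin S) l) v x.
Proof.
move=> lS; rewrite (tensP_D1 (repl v l w) x (lS : (fun l => l \notin S) l)) /repl eqxx.
by congr (_ * _); apply: tensP_ext => m /andP[_ /negPf ->].
Qed.

(** The point is the derivative at [(v, g1, h2)] in the direction [(g2, h1)], and to this direction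
    a component [w] in a further factor [l] may be added. The resulting line stays in [T] but in
    general leaves [secants]. *)
Lemma dird_cross v g1 h1 g2 h2 l w : l \notin S ->
  dird (fun x => elem v g1 h1 x + elem v g2 h2 x) (elem (repl v l w) g1 h2) f = 0.
Proof.
move=> lS; have : l != i /\ l != j.
  by move: lS; rewrite !inE negb_or => /andP.
case=> li lj; apply: (line_dird ch0) => t.
pose v' : mvec k K := fun l => if l == i then g1 l else if l == j then h2 l else v l.
pose w' : mvec k K := fun l => if l == i then g2 l else if l == j then h1 l else fun _ => 0.
pose d : mvec k K := fun m => if m == l then w m else fun _ => 0.
rewrite -[RHS](vf v' (fun m a => t * d m a + w' m a)); apply: pev_ext => x.
rewrite dten_linear -elem_dten addrC dten_single -tens_elem; congr (_ * _ + _).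
apply: tensP_ext => m _; rewrite /repl /v'.
by case: (eqVneq m i) => [->|mi]; [rewrite eq_sym (negPf li)|
  case: (eqVneq m j) => [->|mj]; [rewrite eq_sym (negPf lj)|]].
Qed.

Lemma dird_outer v g1 h1 g2 h2 l w : l \notin S ->
  dird (fun x => elem v g1 h1 x + elem v g2 h2 x)
    (fun x => elem (repl v l w) g1 h1 x + elem (repl v l w) g2 h2 x) f = 0.
Proof.
move=> lS; apply: (line_dird ch0) => t.
rewrite -[RHS](vanT_elem (repl v l (comb 1 t v w)) g1 h1 g2 h2); apply: pev_ext => x.
rewrite /elem !tensP_repl // (tensP_D1 v x (lS : (fun l => l \notin S) l)) /comb; ring.
Qed.

Variables (e0 e1 : mvec k K).

Definition mat (m00 m01 m10 m11 : K) v x :=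
  elem v e0 (comb m00 m01 e0 e1) x + elem v e1 (comb m10 m11 e0 e1) x.

Lemma mat_row m00 m01 m10 m11 v x : mat m00 m01 m10 m11 v x =
  elem v e1 (comb m10 m11 e0 e1) x + elem v e0 (comb m00 m01 e0 e1) x.
Proof. exact: addrC. Qed.

Lemma mat_col m00 m01 m10 m11 v x : mat m00 m01 m10 m11 v x =
  elem v (comb m00 m10 e0 e1) e0 x + elem v (comb m01 m11 e0 e1) e1 x.
Proof. by rewrite /mat /elem /comb; ring. Qed.

Lemma mat_col' m00 m01 m10 m11 v x : mat m00 m01 m10 m11 v x =
  elem v (comb m01 m11 e0 e1) e1 x + elem v (comb m00 m10 e0 e1) e0 x.
Proof. by rewrite mat_col addrC. Qed.

(** The unknowns are the derivatives [q00], [q01], [q10], [q11] along the four products of [e0] and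
    [e1]. Splitting the matrix by rows in both orders and by columns gives three linear relations
    through [dird_cross], moving [v l] a fourth; together they give [2 * m01 * det * q00 = 0]. *)
Lemma dird_corner_generic m00 m01 m10 m11 v l w : l \notin S ->
  m01 * (m00 * m11 - m01 * m10) != 0 ->
  dird (mat m00 m01 m10 m11 v) (elem (repl v l w) e0 e0) f = 0.
Proof.
move=> lS nz; set p := mat _ _ _ _ v; pose V := repl v l w.
have split_r g a b : dird p (elem V g (comb a b e0 e1)) f =
    a * dird p (elem V g e0) f + b * dird p (elem V g e1) f.
  rewrite -!dirdZ -dirdD; apply: dird_ext => // x.
  by rewrite /elem /comb; ring.
have split_l a b h : dird p (elem V (comb a b e0 e1) h) f =
    a * dird p (elem V e0 h) f + b * dird p (elem V e1 h) f.
  rewrite -!dirdZ -dirdD; apply: dird_ext => // x.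
  by rewrite /elem /comb; ring.
have r1 := dird_cross v e0 (comb m00 m01 e0 e1) e1 (comb m10 m11 e0 e1) w lS.
have r2 := dird_cross v e1 (comb m10 m11 e0 e1) e0 (comb m00 m01 e0 e1) w lS.
have r3 := dird_cross v (comb m01 m11 e0 e1) e1 (comb m00 m10 e0 e1) e0 w lS.
have r5 := dird_outer v e0 (comb m00 m01 e0 e1) e1 (comb m10 m11 e0 e1) w lS.
rewrite -/V -/(mat m00 m01 m10 m11 v) -/p split_r in r1.
rewrite -/V -(dird_ext (p := p) (w := elem V e1 (comb m00 m01 e0 e1)) f (mat_row _ _ _ _ v) (fun=> erefl)) split_r in r2.
rewrite -/V -(dird_ext (p := p) (w := elem V (comb m01 m11 e0 e1) e0) f (mat_col' _ _ _ _ v) (fun=> erefl)) split_l in r3.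
rewrite -/V -/(mat m00 m01 m10 m11 v) -/p dirdD !split_r in r5.
move: r1 r2 r3 r5; set q00 := dird p (elem V e0 e0) f; set q01 := dird p (elem V e0 e1) f.
set q10 := dird p (elem V e1 e0) f; set q11 := dird p (elem V e1 e1) f => r1 r2 r3 r5.
have E : 2 * (m01 * (m00 * m11 - m01 * m10)) * q00 =
    m01 * m11 * (m00 * q00 + m01 * q01 + (m10 * q10 + m11 * q11))
    - m01 ^+ 2 * (m10 * q00 + m11 * q01) - m11 ^+ 2 * (m00 * q10 + m01 * q11)
    - (m10 * m01 - m00 * m11) * (m01 * q00 + m11 * q10) by ring.
move/eqP: E; rewrite r1 r2 r3 r5 !mulr0 !subr0 mulf_eq0 (negPf (mulf_neq0 _ nz)) /=.
  by move/eqP.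
exact: two_neq0.
Qed.

(** Adding [t] to both antidiagonal entries makes any matrix generic: [q] has degree 3 in [t]
    whatever the entries. The derivative in the fixed direction is a polynomial in [t], so its
    vanishing extends to [t = 0]. *)
Lemma dird_corner m00 m01 m10 m11 v l w : l \notin S ->
  dird (mat m00 m01 m10 m11 v) (elem (repl v l w) e0 e0) f = 0.
Proof.
move=> lS; pose P (a : K) : {poly K} := a%:P + 'X.
pose gam x : {poly K} := (mat m00 m01 m10 m11 v x)%:P + 'X * (mat 0 1 1 0 v x)%:P.
have gamt t x : (gam x).[t] = mat m00 (m01 + t) (m10 + t) m11 v x.
  by rewrite /gam !hornerE /mat /elem /comb; ring.
pose hp : {poly K} := \sum_s ev gam (f^`M(s)) * (elem (repl v l w) e0 e0 (enum_val s))%:P.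
pose q := P m01 * ((m00 * m11)%:P - P m01 * P m10).
have qt t : q.[t] = (m01 + t) * (m00 * m11 - (m01 + t) * (m10 + t)).
  by rewrite /q /P !hornerE.
have q0 : q != 0.
  have sP a : size (P a) = 2 by rewrite /P addrC size_XaddC.
  have P0 a : P a != 0 by rewrite -size_poly_eq0 sP.
  rewrite mulf_neq0 // subr_eq0; apply/eqP => /(congr1 (fun p : {poly K} => size p)).
  by rewrite size_mul // !sP size_polyC; case: (_ != 0).
have : hp = 0.
  apply: (poly_generic_eq0 ch0 q0) => t; rewrite qt => nz; rewrite dird_horner.
  rewrite (dird_ext f (gamt t) (fun=> erefl)).
  exact: dird_corner_generic.
move/(congr1 (fun p : {poly K} => p.[0])); rewrite dird_horner horner0.
by rewrite (dird_ext f (gamt 0) (fun=> erefl)) !addr0.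
Qed.

End Functional.
End SecantTangents.

(** Two vectors whose span contains [s] and [r], dual to two coordinates. If [s] and [r] are
    independent, a nonzero 2x2 minor is inverted; otherwise a vector spanning both is completed by a
    basis vector, which exists as [0 < n]. *)
Lemma dual_pair (K : fieldType) n (s r : 'I_n.+1 -> K) : (0 < n)%N ->
  exists ae : (bool -> 'I_n.+1) * (bool -> 'I_n.+1 -> K),
    (forall a a', ae.2 a (ae.1 a') = (a == a')%:R) /\
    (forall c, s c = s (ae.1 false) * ae.2 false c + s (ae.1 true) * ae.2 true c) /\
    (forall c, r c = r (ae.1 false) * ae.2 false c + r (ae.1 true) * ae.2 true c).
Proof.
move=> n0; have [[a0 [a1 D0]]|nD] :=
    pselect (exists a0 a1, s a0 * r a1 - s a1 * r a0 != 0).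
  exists (fun b => if b then a1 else a0, fun b c =>
    if b then (r c * s a0 - s c * r a0) / (s a0 * r a1 - s a1 * r a0)
    else (s c * r a1 - r c * s a1) / (s a0 * r a1 - s a1 * r a0)) => /=; split.
    by move=> [] [] /=; field.
  by split=> c; field.
have {nD} D a b : s a * r b = s b * r a.
  apply/eqP; rewrite -subr_eq0; apply: contraT => ne.
  by case: nD; exists a, b.
have [g [a0 [g1 [sg rg]]]] : exists g a0, g a0 = 1 /\
    (forall c, s c = s a0 * g c) /\ (forall c, r c = r a0 * g c).
  have [[a0 s0]|s0] := pselect (exists a, s a != 0).
    exists (fun c => s c / s a0), a0; split; first by rewrite divff.
    split=> c; first by rewrite mulrCA divff ?mulr1.
    by apply: (mulfI s0); rewrite D; field.
  have sz c : s c = 0 by apply/eqP; apply: contraT => ne; case: s0; exists c.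
  have [[a0 r0]|r0] := pselect (exists a, r a != 0).
    exists (fun c => r c / r a0), a0; split; first by rewrite divff.
    by split=> c; rewrite ?sz ?mul0r // mulrCA divff ?mulr1.
  have rz c : r c = 0 by apply/eqP; apply: contraT => ne; case: r0; exists c.
  exists (fun c => (c == ord0)%:R), ord0; split; first by rewrite eqxx.
  by split=> c; rewrite ?sz ?rz mul0r.
have [a1 a10] := other_index a0 n0.
exists (fun b => if b then a1 else a0, fun b c =>
  if b then (c == a1)%:R else g c - g a1 * (c == a1)%:R) => /=; split.
  move=> [] [] /=; rewrite ?eqxx ?mulr1 ?subrr // eq_sym (negPf a10) //.
  by rewrite mulr0 subr0.
by split=> c; [rewrite (sg c) (sg a1)|rewrite (rg c) (rg a1)]; ring.
Qed.

(* Evaluating at the coordinates [pos], the matrix of the family is block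
   triangular with invertible diagonal blocks. *)
Lemma triangular_free (K : fieldType) (I Q : finType) (w : Q -> I -> K)
    (pos : Q -> I) (lvl : Q -> bool) (d : Q -> K) :
  (forall q, w q (pos q) != 0) ->
  (forall q q', q' != q -> lvl q' || ~~ lvl q -> w q' (pos q) = 0) ->
  (forall x, \sum_q d q * w q x = 0) -> forall q, d q = 0.
Proof.
move=> w1 w0 dw.
have step q : (forall q', q' != q -> d q' * w q' (pos q) = 0) -> d q = 0.
  move=> H; have := dw (pos q); rewrite (bigD1 q) //= big1 ?addr0 => [/eqP|q' /H //].
  by rewrite mulf_eq0 (negPf (w1 q)) orbF => /eqP.
have d0 q : lvl q = false -> d q = 0.
  by move=> lq; apply: step => q' ne; rewrite w0 ?mulr0 // lq orbT.
move=> q; apply: step => q' ne; case lq': (lvl q'); last by rewrite d0 ?mul0r.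
by rewrite w0 ?mulr0 // lq'.
Qed.

Section Singular.
Variables (K : fieldType) (ch0 : forall n, n.+1%:R != 0 :> K).
Variables (J : finType) (k : J -> nat) (i j m0 : J).
Hypothesis k1 : forall l, (0 < k l)%N.
Hypothesis ij : i != j.
Local Notation idx := (tensor_index k).
Local Notation S := (i |: [set j]).
Hypothesis m0S : m0 \notin S.
Local Notation V := (vec K (PP idx)).
Local Notation T := (tangents K k).
Local Notation pt := {l : J & 'I_(k l).+1}.
Unset Implicit Arguments.
Variables (v s r : mvec k K) (u : V) (o : idx).
Hypothesis uE : u =1 secf S v s r.
Hypothesis vo : forall l, l \notin S -> v l (o l) != 0.
Variables (al : bool -> forall l, 'I_(k l).+1) (e : bool -> mvec k K).
Set Implicit Arguments.
Hypothesis eal : forall a a' l, e a l (al a' l) = (a == a')%:R.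
Hypothesis sE : forall l c, s l c = s l (al false l) * e false l c + s l (al true l) * e true l c.
Hypothesis rE : forall l c, r l c = r l (al false l) * e false l c + r l (al true l) * e true l c.

Let ji : j != i. Proof. by rewrite eq_sym. Qed.

Definition delta (p : pt) : mvec k K := fun l a => (pnt a == p)%:R.

Definition free_j : finType := {c : 'I_(k j).+1 | c \notin [:: al false j; al true j]}.
Definition free_out : finType := {l : {l : J | l \notin S} & 'I_(k (val l))}.
(** The three families have [2 (k i + 1)], [2 (k j - 1)] and [4 \sum_l k l] members, the sum being
    over [l] outside [S]. The second omits the two indices [al] of the factor [j], whose directions
    the first already spans. *)
Definition dirs : finType :=
  ('I_(k i).+1 * bool + free_j * bool + free_out * (bool * bool))%type.

Definition out_pnt (q : free_out) : pt := pnt (lift (o (val (tag q))) (tagged q)).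

Definition dir (q : dirs) : idx -> K :=
  match q with
  | inl (inl (c, b)) => elem i j v (delta (pnt c)) (e b)
  | inl (inr (c, a)) => elem i j v (e a) (delta (pnt (val c)))
  | inr (p, (a, b)) =>
      elem i j (repl v (val (tag p)) (delta (out_pnt p))) (e a) (e b)
  end.

Definition dir_pos (q : dirs) : idx :=
  match q with
  | inl (inl (c, b)) => upd (upd o (pnt c)) (pnt (al b j))
  | inl (inr (c, a)) => upd (upd o (pnt (al a i))) (pnt (val c))
  | inr (p, (a, b)) => upd (upd (upd o (out_pnt p)) (pnt (al a i))) (pnt (al b j))
  end.

(** Only the first family may be nonzero at positions of another family: neither [e b] away from
    [al] nor [v] away from [o] is controlled. *)
Definition dir_lvl (q : dirs) := if q is inl (inl _) then false else true.

Lemma elem_upd (w g h : mvec k K) x (a : 'I_(k i).+1) (b : 'I_(k j).+1) :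
  elem i j w g h (upd (upd x (pnt a)) (pnt b)) =
  tensP (fun l => l \notin S) w x * (g i a * h j b).
Proof.
rewrite /elem !(tensP_out (Q := fun l => l \notin S)) /= ?inE ?eqxx ?orbT //.
congr (_ * (g i _ * h j _)); last exact: (upd_in _ (pnt b)).
by rewrite upd_out //; exact: (upd_in _ (pnt a)).
Qed.

Lemma delta_pnt l (a c : 'I_(k l).+1) : delta (pnt c) a = (a == c)%:R.
Proof. by rewrite /delta eq_Tagged. Qed.

Let R0 : tensP (fun l => l \notin S) v o != 0.
Proof. by apply/prodf_neq0 => l; exact: vo. Qed.

Let repl0 (q : free_out) : tensP (fun l => l \notin S) (repl v (val (tag q)) (delta (out_pnt q))) o = 0.
Proof.
case: q => [[l lS] c] /=; rewrite tensP_repl // /out_pnt /= delta_pnt.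
by rewrite (negPf (neq_lift _ _)) mul0r.
Qed.

Let al_notin (c : free_j) b : (al b j == val c) = false.
Proof.
by case: c => c /=; rewrite !inE negb_or => /andP[h h']; apply/negbTE;
  case: b; rewrite eq_sym.
Qed.

Lemma dir_pos_neq0 q : dir q (dir_pos q) != 0.
Proof.
case: q => [[[c b]|[c a]]|[[[l lS] c] [a b]]]; rewrite /dir /dir_pos elem_upd.
- by rewrite delta_pnt eal !eqxx !mulr1.
- by rewrite delta_pnt eal !eqxx !mulr1.
rewrite !eal !eqxx !mulr1 /= tensP_repl // (upd_in o (pnt (lift (o l) c))) delta_pnt eqxx mul1r.
rewrite tensP_out /less ?eqxx ?andbF //.
by apply/prodf_neq0 => z /andP[zS _]; exact: vo.
Qed.

Lemma dir_pos_eq0 q q' : q' != q -> dir_lvl q' || ~~ dir_lvl q -> dir q' (dir_pos q) = 0.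
Proof.
case: q => [[[c b]|[c a]]|[p [a b]]];
  case: q' => [[[c' b']|[c' a']]|[p' [a' b']]] ne //= _; rewrite elem_upd.
- rewrite delta_pnt eal; move: ne; rewrite -[_ != _]/(~~ ((c' == c) && (b' == b))).
  rewrite negb_and eq_sym => /orP[] /negPf ->; by rewrite ?mul0r !mulr0.
- by rewrite delta_pnt al_notin !mulr0.
- by rewrite repl0 mul0r.
- rewrite delta_pnt eal; move: ne; rewrite -[_ != _]/(~~ ((c' == c) && (a' == a))).
  rewrite negb_and -val_eqE [val c' == _]eq_sym => /orP[] /negPf ->; by rewrite ?mul0r !mulr0.
- by rewrite repl0 mul0r.
- by rewrite delta_pnt al_notin !mulr0.
rewrite !eal; move: ne; rewrite -[_ != _]/(~~ ((p' == p) && ((a' == a) && (b' == b)))).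
case: (eqVneq p' p) => [->|pp] /=.
  by rewrite negb_and => /orP[] /negPf ->; rewrite ?mul0r !mulr0.
move=> _; case: p p' pp => [[l lS] c] [[l' lS'] c'] pp /=; rewrite /out_pnt /= tensP_repl //.
case: (eqVneq l l') => [e'|ll]; last first.
  by rewrite upd_out // delta_pnt (negPf (neq_lift _ _)) !mul0r.
subst l'; rewrite (bool_irrelevance lS' lS) in pp *.
rewrite (upd_in o (pnt (lift (o l) c))) delta_pnt (inj_eq lift_inj).
move: pp; rewrite eq_Tagged /= eq_sym => /negPf ->; by rewrite !mul0r.
Qed.

Definition dir_map (d : {ffun dirs -> K^o}) : V := [ffun x => \sum_q d q * dir q x].

Lemma dir_map_linear : linear dir_map.
Proof.
move=> c d d'; apply/ffunP => x; rewrite !ffunE /GRing.scale /= mulr_sumr -big_split.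
by apply: eq_bigr => q _; rewrite !ffunE /= mulrDl mulrA.
Qed.

Lemma dir_map_inj d : dir_map d = 0 -> d = 0.
Proof.
move=> d0; apply/ffunP => q; rewrite ffunE.
apply: (triangular_free (w := dir) (d := d) dir_pos_neq0 dir_pos_eq0) => x.
by have := congr1 (fun z : V => z x) d0; rewrite !ffunE.
Qed.

Let mu a b := s i (al a i) * s j (al b j) + r i (al a i) * r j (al b j).
Let emix a b : mvec k K := fun l => if l == i then e a l else e b l.

(** Any of the four corners may be listed first, so that [dird_corner], which treats one corner,
    applies to every pair [e a], [e b]. *)
Lemma u_mat a b x : u x = mat i j (emix a b) (emix (~~ a) (~~ b))
  (mu a b) (mu a (~~ b)) (mu (~~ a) b) (mu (~~ a) (~~ b)) v x.
Proof.
rewrite uE /secf !(tensP_pair _ x ij) (sE (x i)) (sE (x j)) (rE (x i)) (rE (x j)).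
by rewrite /mat /elem /comb /emix !eqxx (negPf ji) /mu; case: a; case: b => /=; ring.
Qed.

Lemma dir_tangent f q : vanT f -> dird (fun x => u x : K) (dir q) f = 0.
Proof.
move=> vf; case: q => [[[c b]|[c a]]|[[[l lS] c] [a b]]] /=.
- rewrite -[RHS](dird_left ch0 ij vf v
    (comb (mu false (~~ b)) (mu true (~~ b)) (e false) (e true)) (e (~~ b))
    (comb (mu false b) (mu true b) (e false) (e true)) (e b) (delta (pnt c))).
  apply: dird_ext => // x; rewrite (u_mat false b) /mat /elem /comb /emix !eqxx (negPf ji) /=.
  by ring.
- rewrite -[RHS](dird_right ch0 ij vf v
    (e (~~ a)) (comb (mu (~~ a) false) (mu (~~ a) true) (e false) (e true))
    (e a) (comb (mu a false) (mu a true) (e false) (e true)) (delta (pnt (val c)))).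
  apply: dird_ext => // x; rewrite (u_mat a false) /mat /elem /comb /emix !eqxx (negPf ji) /=.
  by ring.
rewrite -[RHS](dird_corner ch0 ij vf (emix a b) (emix (~~ a) (~~ b))
  (mu a b) (mu a (~~ b)) (mu (~~ a) b) (mu (~~ a) (~~ b)) v (delta (out_pnt (existT _ (exist _ l lS) c))) lS).
apply: dird_ext => x; first exact: u_mat.
by rewrite /elem /emix eqxx (negPf ji).
Qed.

Lemma dir_map_tangent d : cone_tangent T u (dir_map d).
Proof.
apply/(cone_tangentE ch0 u _ (@tangents_cone _ _ _)) => f /(vanTP ch0 i) vf.
have E : (fun x => dir_map d x : K) =1 fun x => \sum_q (d q : K) * dir q x.
  by move=> x; rewrite ffunE.
rewrite (dird_ext f (fun=> erefl) E) dird_lin big1 // => q _.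
by rewrite dir_tangent ?mulr0.
Qed.

(** The excess is [2 \sum_l k l - 1] with [l] outside [S]; the factor [m0] makes it positive. *)
Lemma card_dirs : ((2 * \sum_l k l).+1 < #|dirs|)%N.
Proof.
rewrite !card_sum !card_prod !card_bool card_ord.
have -> : #|free_out| = (\sum_(l | l \notin S) k l)%N.
  rewrite card_tagged sumnE big_map big_enum /=.
  rewrite (eq_bigr (fun l : {l : J | l \notin S} => k (val l))) => [|l _]; last by rewrite card_ord.
  rewrite [RHS](reindex_omap (val : {l : J | l \notin S} -> J) insub) /=; last first.
    by move=> l lS; rewrite insubT.
  by apply: eq_bigl => -[l lS] /=; rewrite insubT lS /= eqxx.
have -> : #|free_j| = (k j).-1.
  rewrite card_sig; have := cardC (mem [:: al false j; al true j]).
  have -> : #|[:: al false j; al true j]| = 2.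
    have ne : al false j != al true j.
      apply/eqP => h; have := eal false true j; rewrite -h eal eqxx => /eqP.
      by rewrite oner_eq0.
    by rewrite (card_uniqP _) //= inE ne.
  rewrite card_ord => h; rewrite (_ : (k j).-1 = ((k j).+1 - 2)%N); last by lia.
  have -> : #|[pred c | c \notin [:: al false j; al true j]]| =
      #|[predC [:: al false j; al true j]]| by apply: eq_card => c; rewrite !inE.
  by move: h; set N := #|_|; lia.
have -> : (\sum_l k l = k i + k j + \sum_(l | l \notin S) k l)%N.
  rewrite (bigID (fun l => l \in S)) /= (bigD1 i) ?inE ?eqxx //= (bigD1 j) /=.
    by rewrite big1 ?addn0 // => l; rewrite !inE; case: (l == i); case: (l == j).
  by rewrite !inE eqxx orbT ji.
have : (k m0 <= \sum_(l | l \notin S) k l)%N by rewrite (bigD1 m0) //= leq_addr.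
by have := k1 i; have := k1 j; have := k1 m0; lia.
Qed.

(** Smoothness would make [d.+1] the dimension of the tangent space, hence at least [#|dirs|], while
    chains in [T] bound [d] by [2 * \sum_l k l]. *)
Lemma singular_point : ~ smooth_at T u.
Proof.
case=> d [cd _] vd.
have dle := tangents_chain_bound ch0 i cd.
have := has_vdim_ge dir_map_linear dir_map_inj vd dir_map_tangent.
have := card_dirs; lia.
Qed.

End Singular.

Section SingularLocus.
Variables (K : fieldType) (ch0 : forall n, n.+1%:R != 0 :> K).
Variables (J : finType) (k : J -> nat).
Hypothesis k1 : forall l, (0 < k l)%N.
Local Notation idx := (tensor_index k).
Local Notation V := (vec K (PP idx)).
Local Notation T := (tangents K k).

Lemma secants_singular (i j m0 : J) (u : V) : i != j -> m0 \notin i |: [set j] ->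
  secants k K (i |: [set j]) u -> ~ smooth_at T u.
Proof.
move=> ij m0S [/pointsPP[o uo] [v [s [r uE]]]].
have vo l : l \notin i |: [set j] -> v l (o l) != 0.
  by move: uo; rewrite uE mulf_eq0 negb_or => /andP[/prodf_neq0 h _]; exact: h.
pose ae l := cid (dual_pair (s l) (r l) (k1 l)).
apply: (@singular_point K ch0 J k i j m0 k1 ij m0S v s r u o uE vo
  (fun b l => (sval (ae l)).1 b) (fun b l => (sval (ae l)).2 b)).
- by move=> a a' l; case: (svalP (ae l)).
- by move=> l; case: (svalP (ae l)) => _ [].
- by move=> l; case: (svalP (ae l)) => _ [].
Qed.

Variables (i0 j0 : J).
Hypothesis ij0 : i0 != j0.

Lemma smooth_or_secant (u : V) : T u ->
  smooth_at T u \/ exists i j, i != j /\ secants k K (i |: [set j]) u.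
Proof.
move=> Tu; have [pu [v [w [nv uE]]]] := Tu; have [o vo] := nondegP nv.
have [a [X [Y [oXY pE _]]]] := dten_chart w vo.
have up : u =1 par a X Y by move=> x; rewrite uE pE.
have [[l1 [l2 [l3 [[h12 h13 h23] [c1 n1] [c2 n2] [c3 n3]]]]]|n3] := pselect (exists l1 l2 l3,
  [/\ [/\ l1 != l2, l1 != l3 & l2 != l3], exists c, Y l1 c != 0,
    exists c, Y l2 c != 0 & exists c, Y l3 c != 0]).
  left; pose b := chart_inv o a X Y.
  have YE l c : chartY o b c = Y l c by exact: chart_invY.
  have [j1 c1E] : exists j1, c1 = lift (o l1) j1.
    case: (unliftP (o l1) c1) => [j1 ->|E]; first by exists j1.
    by case/eqP: n1; rewrite E; case: (oXY l1).
  refine (@smooth_tangent_point K ch0 J k (tangents_closed ch0 k ij0) o b l1 j1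
    (pnt c2) (pnt c3) h12 h13 h23 _ _ _ u _ pu Tu).
  - by rewrite /b /= -c1E.
  - by rewrite YE.
  - by rewrite YE.
  move=> x; rewrite up pev_chart_pol /par; congr (_ * _ + _).
    by apply: tensP_ext => l _ c; rewrite (chart_invX a oXY).
  by apply: dtenP_ext => l _ c; rewrite ?(chart_invX a oXY) ?(chart_invY a oXY).
(* At most two factors carry a nonzero [Y]; a smaller support is enlarged to a pair with the help of
   [i0] and [j0]. *)
right; have [i [j [ij Y0]]] : exists i j, i != j /\
    forall l, l \notin i |: [set j] -> forall c, Y l c = 0.
  have z l : ~ (exists c, Y l c != 0) -> forall c, Y l c = 0.
    by move=> h c; apply/eqP; apply: contraT => ne; case: h; exists c.
  have [[l1 s1]|s0] := pselect (exists l, exists c, Y l c != 0); last first.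
    by exists i0, j0; split=> // l _; apply: z => h; apply: s0; exists l.
  have [[l2 [l12 s2]]|s0] := pselect (exists l, l1 != l /\ exists c, Y l c != 0).
    exists l1, l2; split=> // l; rewrite !inE negb_or => /andP[h1 h2]; apply: z => h.
    apply: n3; exists l1, l2, l; split=> //; split=> //; by rewrite eq_sym.
  have [m lm] : exists m, l1 != m.
    case: (eqVneq l1 i0) => [->|ne]; first by exists j0.
    by exists i0.
  exists l1, m; split=> // l; rewrite !inE negb_or => /andP[h1 h2]; apply: z => h.
  by apply: s0; exists l; split=> //; rewrite eq_sym.
exists i, j; split=> //; split=> //; exists X; do 2!eexists.
by move=> x; rewrite up (par_secf a X ij Y0 x).
Qed.

Hypothesis third : forall i j : J, exists m, m \notin i |: [set j].

Lemma sing_tangents : sing T =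
  [set u | exists i j, i != j /\ secants k K (i |: [set j]) u].
Proof.
apply/seteqP; split=> u.
  by case=> Tu ns; case: (smooth_or_secant Tu).
case=> i [j [ij su]]; split; first exact: secants_tangents su.
by have [m mS] := third i j; exact: secants_singular mS su.
Qed.

End SingularLocus.

(** * Components of the singular locus and their codimension *)

Section RankedSeq.
Variables (T : finType) (rk : T -> nat).

(** Lists the variables rank by rank, so that freeing a prefix of the list means freeing all lower
    ranks before a higher one. *)
Definition rseq (rs : seq nat) : seq T :=
  flatten [seq [seq c <- enum T | rk c == r] | r <- rs].

Lemma mem_rseq rs c : (c \in rseq rs) = (rk c \in rs).
Proof.
apply/flattenP/idP => [[_ /mapP[r rrs ->]]|h].
  by rewrite mem_filter => /andP[/eqP -> _].
by exists [seq c' <- enum T | rk c' == rk c]; [exact: map_f|rewrite mem_filter eqxx mem_enum].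
Qed.

Lemma rseq_cat r1 r2 : rseq (r1 ++ r2) = rseq r1 ++ rseq r2.
Proof. by rewrite /rseq map_cat flatten_cat. Qed.

Lemma uniq_rseq rs : uniq rs -> uniq (rseq rs).
Proof.
elim: rs => //= r rs IH /andP[rrs urs].
rewrite -[rseq _]/([seq c <- enum T | rk c == r] ++ rseq rs) cat_uniq IH // andbT.
rewrite filter_uniq ?enum_uniq //=; apply/hasPn => c; rewrite mem_rseq mem_filter.
by case: eqP => // ->; rewrite (negPf rrs).
Qed.

Lemma index_rseq n c c' : (rk c' < rk c)%N -> (rk c < n)%N ->
  (index c' (rseq (iota 0 n)) < index c (rseq (iota 0 n)))%N.
Proof.
move=> lt cn; have -> : iota 0 n = iota 0 (rk c) ++ iota (rk c) (n - rk c).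
  by rewrite -iotaD subnKC // ltnW.
rewrite rseq_cat !index_cat !mem_rseq !mem_iota /= !add0n lt ltnn.
by apply: leq_trans (leq_addr _ _); rewrite index_mem mem_rseq mem_iota.
Qed.
End RankedSeq.

(** * A maximal chain through the locus of a pair of factors *)

Section SecantChain.
Variables (K : fieldType) (ch0 : forall n, n.+1%:R != 0 :> K).
Variables (J : finType) (k : J -> nat) (i j m0 : J).
Hypothesis k1 : forall l, (0 < k l)%N.
Hypothesis ij : i != j.
Local Notation idx := (tensor_index k).
Local Notation S := (i |: [set j]).
Hypothesis m0S : m0 \notin S.
Local Notation V := (vec K (PP idx)).
Local Notation T := (tangents K k).
Local Notation pt := {l : J & 'I_(k l).+1}.

Let ji : j != i. Proof. by rewrite eq_sym. Qed.
Let T_closed : zclosed T := tangents_closed ch0 k ij.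

Let o : idx := finfun (fun _ => ord0).
Let a0 : 'I_(k i) := Ordinal (k1 i).
Let b0 : 'I_(k j) := Ordinal (k1 j).
Let r0 : 'I_(k m0) := Ordinal (k1 m0).
Let p0 : pt := pnt (lift (o i) a0).
Let q0 : pt := pnt (lift (o j) b0).
Let w0 : pt := pnt (lift (o m0) r0).
Let cp : param k := Some (true, ppnt a0).
Let cq : param k := Some (true, ppnt b0).
Let cw : param k := Some (true, ppnt r0).

(* In these coordinates the entries next to the base point are the [chartX z],
   whatever the [chartY z]. *)
Definition zpar (A : comNzRingType) (z : param k -> A) : idx -> A :=
  par 1 (fun l c => chartX o z c - chartY o z c) (chartY o z).

Definition zpol x : {mpoly K[#|param k|]} := zpar (@mvar K (param k)) x.

Lemma pev_zpol (z : param k -> K) x : pev z (zpol x) = zpar z x.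
Proof.
rewrite /zpol /zpar rmorph_par rmorph1 /=; congr (par _ _ _ x);
  apply: functional_extensionality_dep => l; apply/funext => c.
  rewrite rmorphB /chartX /chartY; case: unlift => [a|].
    by rewrite /= !pev_var.
  by rewrite rmorph1 rmorph0.
by rewrite /chartY; case: unlift => [a|]; rewrite /= ?pev_var ?rmorph0.
Qed.

Lemma zchart (z : param k -> K) :
  chart o (fun l c => chartX o z c - chartY o z c) (chartY o z).
Proof. by move=> l; case: (chartXY o z l) => -> ->; rewrite subr0. Qed.

Lemma zpar0 (z : param k -> K) : zpar z o = 1.
Proof. exact: (par0 1 (zchart z)). Qed.

Lemma zpar1 (z : param k -> K) p : zpar z (upd o p) = chartX o z (tagged p).
Proof. by rewrite /zpar (par1 _ (zchart z)) mul1r subrK. Qed.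

Lemma zquad (z : param k -> K) p q : tag p != tag q ->
  quad (zpar z) o p q = chartY o z (tagged p) * chartY o z (tagged q).
Proof. exact: (quad_par 1 (zchart z)). Qed.

Let C (z : param k -> K) x := pev z (zpol x).
Let CE z : C z = zpar z. Proof. by apply/funext => x; exact: pev_zpol. Qed.

(** The order of freeing. Ranks 0 to 2 sweep out [secants k K S], where [Y] is zero outside [S];
    ranks 3 and 4 then count the codimension. The coordinate [cp] keeps the value 1 up to the end:
    as long as [Y] lives on [i] and [j], rescaling [Y_i] against [Y_j] changes no product
    [Y_p * Y_q], so fixing it costs nothing. The scalar [None] is not freed, [zpar] having set it to
    1. *)
Definition rk (c : param k) : nat :=
  (match c with
  | None => 5
  | Some (false, _) => 0
  | Some (true, q) =>
      if tag q == j then 1 else if tag q == i then (if Some (true, q) == cp then 4 else 2)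
      else 3
  end)%N.

Let s := rseq rk (iota 0 5).
Let b (c : param k) : K := (c == cp)%:R.
Let incr c (c' : param k) : K := if c' == c then 1 else b c'.

Let Yb (z : param k -> K) l (c : 'I_(k l)) : chartY o z (lift (o l) c) = z (Some (true, ppnt c)).
Proof. by rewrite /chartY liftK. Qed.

Let rkp : rk cp = 4%N. Proof. by rewrite /rk /= (negPf ij) !eqxx. Qed.
Let rkq : rk cq = 1%N. Proof. by rewrite /rk /= eqxx. Qed.
Let rkw : rk cw = 3%N.
Proof. move: m0S; rewrite /rk !inE negb_or /= => /andP[/negPf -> /negPf ->]. by []. Qed.

Let szs : size s = (2 * \sum_l k l)%N.
Proof.
have us : uniq s by apply/uniq_rseq/iota_uniq.
have : s =i predC1 None.
  move=> c; rewrite mem_rseq mem_iota !inE /=.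
  case: c => [[[] q]|] //; rewrite /rk; case: (tag q == j) => //.
  by case: (tag q == i) => //; case: (_ == cp).
move/eq_card; rewrite (card_uniqP us) cardC1 card_param => ->.
by [].
Qed.

Let hi := rseq rk (iota 3 2).
Let lo := rseq rk (iota 0 3).
Let sE : s = lo ++ hi. Proof. exact: rseq_cat rk (iota 0 3) (iota 3 2). Qed.

Let szhi : size hi = (\sum_(l | l \notin S) k l).+1.
Proof.
have uh : uniq hi by apply/uniq_rseq/iota_uniq.
pose D := [seq Some (true, q) | q <- enum [pred q : {l : J & 'I_(k l)} | tag q \notin S]].
have hiD : hi =i cp :: D.
  move=> c; rewrite mem_rseq mem_iota inE; case: c => [[[] q]|] /=; last 2 first.
  - by apply/esym/mapP => -[].
  - by apply/esym/mapP => -[].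
  rewrite mem_map => [|x y []//]; rewrite mem_enum inE !inE.
  case: (eqVneq (tag q) j) => [qj|qj].
    rewrite orbT /= orbF; apply/esym/eqP => -[] e; move: qj; rewrite e /= => e'.
    by move: ij; rewrite e' eqxx.
  case: (eqVneq (tag q) i) => [qi|qi] /=; first by rewrite orbF; case: (_ == cp).
  by rewrite orbT.
have uD : uniq (cp :: D).
  rewrite /= map_inj_uniq => [|x y []//]; rewrite enum_uniq andbT.
  by apply/mapP => -[q]; rewrite mem_enum !inE => + [] e; rewrite -e /= eqxx.
rewrite (perm_size (uniq_perm uh uD hiD)) /= size_map -cardE -sum1_card; congr _.+1.
transitivity (\sum_(l | l \notin S) \sum_(x : 'I_(k l) | true) 1)%N; last first.
  by apply: eq_bigr => l _; rewrite sum1_card card_ord.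
by rewrite sig_big_dep /=; apply: eq_bigl => q; rewrite andbT.
Qed.

Let us : uniq s. Proof. by apply/uniq_rseq/iota_uniq. Qed.

Let inS c : (rk c < 5)%N -> c \in s.
Proof. by move=> h; rewrite mem_rseq mem_iota. Qed.

Let rk4 c : rk c = 4%N -> c = cp.
Proof.
case: c => [[[] q]|] //=; case: (tag q == j) => //; case: (tag q == i) => //.
by case: eqP.
Qed.

Let last_cp c : c \in s -> (index c s <= index cp s)%N.
Proof.
rewrite mem_rseq mem_iota /= add0n => c5; case: (eqVneq c cp) => [->//|ne].
apply/ltnW/index_rseq; last by rewrite rkp.
by rewrite rkp ltn_neqAle -ltnS c5 andbT; apply: contraNneq ne => /rk4 ->.
Qed.

Let fsl_cp t z : fslice b s t z -> (t < size s)%N -> z cp = 1.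
Proof.
move=> h ts; rewrite h ?/b ?eqxx // in_take ?inS ?rkp // -leqNgt.
by have := last_cp (mem_nth cp ts); rewrite index_uniq.
Qed.

Let cubic_z (z : param k -> K) : cubic (zpar z) o p0 q0 w0 = 2 * (z cp * z cq * z cw).
Proof.
have [mi mj] : m0 != i /\ m0 != j by move: m0S; rewrite !inE negb_or => /andP.
by rewrite /zpar (cubic_par _ (zchart z)) ?Yb //= eq_sym.
Qed.

(** A coordinate of [X] is an entry next to [o]. One of [Y] is read off by [quad] against [p0] or
    [q0], the partner [cp] being 1 and [cq] already free when needed. For [cp] itself the form
    [cubic - 2 * u_o * quad] equals [2 * (z cq * z cw) * (z cp - 1)], which requires the third
    factor [m0]. *)
Lemma zsep t : (t < size s)%N -> exists f,
  [/\ @is_multihomog K (PP idx) f,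
      forall z, fslice b s t z -> pev (C z) f = 0 &
      exists2 z, fslice b s t.+1 z & pev (C z) f != 0].
Proof.
move=> ts; pose c := nth cp s t; have cs : c \in s by exact: mem_nth.
have ic : index c s = t by rewrite index_uniq.
have c5 : (rk c < 5)%N by move: cs; rewrite mem_rseq mem_iota.
have ct : c \notin take t s by rewrite in_take // ic ltnn.
have ctS : c \in take t.+1 s by rewrite in_take // ic.
have before c' : (rk c' < rk c)%N -> c' \in take t.+1 s.
  move=> lt; rewrite in_take; last exact: inS (ltn_trans lt c5).
  by rewrite ltnS ltnW // -[X in (_ < X)%N]ic; exact: index_rseq.
have [mi mj] : m0 != i /\ m0 != j by move: m0S; rewrite !inE negb_or => /andP.
have homq p q : @is_multihomog K (PP idx) (quad (@mvar K idx) o p q).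
  by apply/is_mhomogP; exists 2%N; exact: quad_homog.
have Cq z p q : tag p != tag q -> pev (C z) (quad (@mvar K idx) o p q) =
    chartY o z (tagged p) * chartY o z (tagged q).
  by move=> pq; rewrite rmorph_quad pev_mvar CE zquad.
have fi : fslice b s t.+1 (incr c).
  move=> c' c't; rewrite /incr; case: eqP => // e; by rewrite e ctS in c't.
have ip : c != cp -> incr c cp = 1.
  by move=> ne; rewrite /incr eq_sym (negPf ne) /b eqxx.
have zc0 z : c != cp -> fslice b s t z -> z c = 0.
  by move=> ne h; rewrite h // /b (negPf ne).
have icc : incr c c = 1 by rewrite /incr eqxx.
clearbody c; case: c cs ic c5 ct ctS before fi ip zc0 icc => [[[] [l x]]|] // cs ic c5 ct ctS before fi ip zc0 icc.
- pose p := pnt (lift (o l) x).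
  case: (eqVneq (Some (true, existT _ l x)) cp) => [e|ne].
    exists (cubic (@mvar K idx) o p0 q0 w0 - 2 *: (mvar K o * quad (@mvar K idx) o q0 w0)).
    have val z : pev (C z) (cubic (@mvar K idx) o p0 q0 w0 - 2 *: (mvar K o * quad (@mvar K idx) o q0 w0)) =
        2 * (z cq * z cw) * (z cp - 1).
      rewrite rmorphB /= pev_scale rmorphM /= rmorph_cubic pev_mvar Cq 1?eq_sym //.
      by rewrite pev_var CE cubic_z zpar0 !Yb; ring.
    split.
    + apply/is_mhomogP; exists 3%N.
      rewrite rpredB ?cubic_homog // dhomogZ // (@dhomogM _ _ _ 1 _ 2) ?mvar_homog //.
      exact: quad_homog.
    + by move=> z h; rewrite val (fsl_cp h ts) subrr mulr0.
    (* Ranks 1 and 3 precede 4, so [cq] and [cw] are free and may be set to 1; [cp = 2] then gives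
       the form the value 2. *)
    exists (fun c' => if c' == cp then 2 else if (c' == cq) || (c' == cw) then 1 else 0).
      move=> c' c't; rewrite /b; case: (eqVneq c' cp) => [e'|ne'].
        by rewrite e' -e ctS in c't.
      case: (eqVneq c' cq) => [e'|nq] /=.
        by rewrite e' before ?e ?rkp ?rkq in c't.
      by case: (eqVneq c' cw) => [e'|//]; rewrite e' before ?e ?rkp ?rkw in c't.
    have nqp : cq == cp = false by apply/eqP => h; have := rkp; rewrite -h rkq.
    have nwp : cw == cp = false by apply/eqP => h; have := rkp; rewrite -h rkw.
    rewrite val !eqxx nqp nwp orbT /= !mulr1 -[2 - 1]/(1 + 1 - 1) addrK mulr1.
    exact: two_neq0.
  case: (eqVneq l j) => [lj|lj].
    have pp : tag p0 != tag p by rewrite /= lj.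
    exists (quad (@mvar K idx) o p0 p); split=> //.
      by move=> z h; rewrite Cq // !Yb (zc0 z) // mulr0.
    by exists (incr (Some (true, existT _ l x))); rewrite // Cq // !Yb ip // icc mulr1 oner_neq0.
  case: (eqVneq l i) => [li|li].
    have pp : tag p != tag q0 by rewrite /= li.
    exists (quad (@mvar K idx) o p q0); split=> //.
      by move=> z h; rewrite Cq // !Yb (zc0 z) // mul0r.
    exists (fun c' => if c' == cq then 1 else incr (Some (true, existT _ l x)) c').
      move=> c' c't; case: eqP => [e|_]; last exact: fi.
      rewrite e before // in c't; rewrite rkq /rk /= (negPf lj) (_ : (l == i) = true); last exact/eqP.
      by case: (_ == cp).
    by rewrite Cq // !Yb eqxx mulr1; case: ifP => _; rewrite ?icc oner_neq0.
  have pp : tag p0 != tag p by rewrite /= eq_sym.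
  exists (quad (@mvar K idx) o p0 p); split=> //.
    by move=> z h; rewrite Cq // !Yb (zc0 z) // mulr0.
  by exists (incr (Some (true, existT _ l x))); rewrite // Cq // !Yb ip // icc mulr1 oner_neq0.
exists (mvar K (upd o (pnt (lift (o l) x)))).
have val z : pev (C z) (mvar K (upd o (pnt (lift (o l) x)))) = z (Some (false, ppnt x)).
  by rewrite pev_var CE zpar1 /chartX liftK.
split.
- by apply/is_mhomogP; exists 1%N; exact: mvar_homog.
- by move=> z h; rewrite val (zc0 z).
by exists (incr (Some (false, existT _ l x))); rewrite // val icc oner_neq0.
Qed.

Let F t := zclosure (fimage zpol b s t).

Lemma zchain : chain F T (size s).
Proof.
apply: (flag_chain ch0 T_closed).
- move=> u l z pu uE; apply: (scaled_chart_tangents i pu (zchart z)) => x.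
  by rewrite uE pev_zpol.
- by exists o; rewrite pev_zpol zpar0 oner_neq0.
exact: zsep.
Qed.

Lemma fimage_secants : fimage zpol b s (size lo) `<=` secants k K S.
Proof.
move=> u [pu [l [z [hz uE]]]]; split=> //.
have Y0 m : m \notin S -> forall c : 'I_(k m).+1, chartY o z c = 0.
  move=> mS c; rewrite /chartY; case: unlift => [x|] //.
  move: mS; rewrite !inE negb_or => /andP[/negPf mi /negPf mj].
  have rx : rk (Some (true, Tagged (fun l => 'I_(k l)) (x : 'I_(k m)))) = 3%N by rewrite /rk /= mj mi.
  rewrite hz ?sE ?take_size_cat // ?mem_rseq ?mem_iota ?rx //.
  rewrite /b; case: eqP => // e; have := rkp; by rewrite -e rx.
exists (fun m c => chartX o z c - chartY o z c).
exists (fun m c => if m == i then l * (1 * (chartX o z c - chartY o z c) + chartY o z c)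
   else (chartX o z c - chartY o z c)).
exists (fun m c => if m == i then l * (chartX o z c - chartY o z c) else chartY o z c) => x.
rewrite uE pev_zpol /zpar (par_secf _ _ ij Y0) /secf mulrCA mulrDr !(tensP_pair _ x ij).
by rewrite !eqxx (negPf ji) !mulrA.
Qed.

(** On this open part the parameters can be solved for. As [quad] has rank one, its column through
    [q0] and its row through [p0] give [Y_i] and [Y_j]; dividing the column by [D] normalizes the
    coordinate [cp] to 1, as the slice demands. *)
Lemma secants_fimage u : secants k K S u -> u o != 0 -> quad (fun x => u x : K) o p0 q0 != 0 ->
  fimage zpol b s (size lo) u.
Proof.
case=> pu [v [s' [r' uE]]]; pose U : idx -> K := fun x => u x.
have US : U = secf S v s' r' by apply/funext => x; exact: uE.
rewrite -/U => uo D0; split=> //; rewrite -[u o]/(U o) in uo.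
have qr p l : tag p != l -> quad U o p (at_ o l) = 0.
  by move=> ne; rewrite /quad updC // !upd_id mulrC subrr.
have ql p l : quad U o (at_ o l) p = 0 by rewrite /quad upd_id subrr.
pose D := quad U o p0 q0; pose Z : mvec k K := fun l c => U (upd o (pnt c)) / U o.
pose Y : mvec k K := fun l c => if l == i then quad U o (pnt c) q0 / D
  else if l == j then quad U o p0 (pnt c) / U o ^+ 2 else 0.
have ch : chart o Z Y.
  move=> l; split; first by rewrite /Z (upd_id o l) divff.
  rewrite /Y -[pnt (o l)]/(at_ o l); case: (eqVneq l i) => _; first by rewrite ql mul0r.
  by case: (eqVneq l j) => [->|//]; rewrite qr ?mul0r.
pose z := chart_inv o 0 Z Y.
have zX l (c : 'I_(k l).+1) : chartX o z c = Z l c by exact: chart_invX.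
have zY l (c : 'I_(k l).+1) : chartY o z c = Y l c by exact: chart_invY.
exists (U o), z; split.
  rewrite /fslice /= sE take_size_cat // => c; rewrite mem_rseq.
  case: c => [[[] [l x]]|] //= h.
  move: h; rewrite /b /Y; case: (eqVneq l j) => [//|lj].
  case: (eqVneq l i) => [li|li _].
    case: eqP => // e _; move: e; rewrite /cp; subst l => e.
    have -> : x = a0.
      have := congr1 (fun c : param k => if c is Some (_, q) then q else ppnt a0) e.
      by move/eqP; rewrite eq_Tagged => /eqP.
    by rewrite divff.
  by case: eqP => // e; move: li; case: e => e _; rewrite e eqxx.
suff E : U =1 fun x => U o * zpar z x by move=> x; rewrite pev_zpol -E.
apply: (@secf_determined _ _ K S i j U _ o erefl ij uo).
- by rewrite zpar0 mulr1.
- by move=> [l c]; rewrite zpar1 zX /Z /= mulrCA divff ?mulr1.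
- move=> [i' c] [j' c'] /= ei ej; subst i' j'.
  have -> : quad (fun x => U o * zpar z x) o (existT _ i c) (existT _ j c') =
      U o ^+ 2 * quad (zpar z) o (pnt c) (pnt c') by rewrite /quad; ring.
  rewrite zquad // !zY /Y !eqxx (negPf ji).
  have E : quad U o (pnt c) (pnt c') * D = quad U o (pnt c) q0 * quad U o p0 (pnt c').
    by rewrite /D US; exact: secf_minor.
  apply: (mulIf D0); apply: etrans (esym E); rewrite -/D /=; field.
  by rewrite D0 uo.
- by move=> x l lS; rewrite US secf_flat.
move=> x l lS; have -> : flat (fun x => U o * zpar z x) o x l = U o ^+ 2 * flat (zpar z) o x l.
  by rewrite /flat; ring.
rewrite (flat_par _ (zchart z)) /at_ /= zY /Y.
by move: lS; rewrite !inE negb_or => /andP[/negPf -> /negPf ->]; rewrite mul0r oppr0 mulr0.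
Qed.

Lemma secants_curve : curve_conn (secants k K S).
Proof.
move=> u1 u2 [p1 [v1 [s1 [r1 E1]]]] [p2 [v2 [s2 [r2 E2]]]].
pose ln (v w : mvec k K) : mvec k {poly K} := fun l c => (v l c)%:P + 'X * (w l c - v l c)%:P.
have E t x : (secf S (ln v1 v2) (ln s1 s2) (ln r1 r2) x).[t] =
    secf S (fun l c => v1 l c + t * (v2 l c - v1 l c)) (fun l c => s1 l c + t * (s2 l c - s1 l c))
      (fun l c => r1 l c + t * (r2 l c - r1 l c)) x.
  rewrite -horner_evalE rmorph_secf /secf; congr (_ * (_ + _));
    by apply: tensP_ext => l _ c /=; rewrite horner_evalE /ln !hornerE.
exists (secf S (ln v1 v2) (ln s1 s2) (ln r1 r2)); split.
- move=> x; rewrite E E1 /secf; congr (_ * (_ + _));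
    by apply: tensP_ext => l _ c; rewrite mul0r addr0.
- move=> x; rewrite E E2 /secf; congr (_ * (_ + _));
    by apply: tensP_ext => l _ c; rewrite mul1r addrC subrK.
move=> t u uE pu; split; first exact/pointsPP.
by do 3!eexists; move=> x; rewrite uE E.
Qed.

(** The image contains only the open part of [secants]. A form vanishing on it but not at some [u1]
    is excluded by a curve from [u1] to a point [u2] of the open part: some point of the curve would
    lie in the open part with the form nonzero. *)
Lemma secants_zclosure : F (size lo) = secants k K S.
Proof.
have sub : secants k K S `<=` points K (PP idx) by move=> u [].
apply/seteqP; split.
  by apply: zclosure_min fimage_secants; exact: secants_closed.
move=> u1 s1; split=> [|f _ vf]; first exact: sub.
apply/eqP; apply: contraT => f1.
(* With [cp = cq = 1] the entry at [o] and [quad] at [p0], [q0] are both 1, so the open part is not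
   empty. *)
pose z (c : param k) : K := ((c == cp) || (c == cq))%:R.
pose u2 : V := [ffun x => zpar z x].
have u2E x : u2 x = zpar z x by rewrite ffunE.
have D1 : quad (zpar z) o p0 q0 = 1 by rewrite zquad // !Yb /z !eqxx orbT mulr1.
have s2 : secants k K S u2.
  apply: fimage_secants; split.
    by apply/pointsPP; exists o; rewrite u2E zpar0 oner_neq0.
  exists 1, z; split; last by move=> x; rewrite u2E mul1r pev_zpol.
  rewrite /fslice /= sE take_size_cat // => c; rewrite mem_rseq /z /b => h.
  by case: (eqVneq c cq) h => [->|_]; rewrite ?rkq // orbF.
pose g := mvar K o * quad (@mvar K idx) o p0 q0.
have gE (u : idx -> K) : pev u g = u o * quad u o p0 q0.
  by rewrite rmorphM /= pev_var rmorph_quad pev_mvar.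
have g2 : pev u2 g != 0.
  have -> : pev u2 g = pev (zpar z) g by exact: pev_ext.
  by rewrite gE zpar0 D1 mulr1 oner_neq0.
have [u [su fu]] := curve_conn_mul ch0 secants_curve sub s1 s2 f1 g2.
rewrite gE mulf_eq0 negb_or => /andP[uo uD].
by move: fu; rewrite (vf _ (secants_fimage su uo uD)) eqxx.
Qed.

Let lo_le : (size lo <= size s)%N. Proof. by rewrite sE size_cat leq_addr. Qed.

Lemma secants_irreducible : irreducible (secants k K S).
Proof. by rewrite -secants_zclosure; case: (zchain.1 _ lo_le). Qed.

Lemma secants_codim : is_codim (secants k K S) T (1 + \sum_(l | l \notin S) k l).
Proof.
have hs : (size s - size lo)%N = (1 + \sum_(l | l \notin S) k l)%N.
  by rewrite sE size_cat addKn szhi.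
split; first by rewrite -hs -secants_zclosure; exact: chain_drop zchain _.
move=> r cr; rewrite -hs leq_subRL // szs; apply: (tangents_chain_bound ch0 i).
apply: (chain_cat (chain_take zchain lo_le)).
by move: cr; rewrite -secants_zclosure.
Qed.

End SecantChain.

Section Components.
Variables (K : fieldType) (ch0 : forall n, n.+1%:R != 0 :> K).
Variables (J : finType) (k : J -> nat).
Hypothesis k1 : forall l, (0 < k l)%N.
Hypothesis third : forall i j : J, exists m, m \notin i |: [set j].
Local Notation idx := (tensor_index k).
Local Notation V := (vec K (PP idx)).
Local Notation T := (tangents K k).

(** For [i] in [A] but not in [B], the tensor equal to a 2x2 identity matrix in the factors of [A]
    has a nonzero [flat] at the factor [i], which every member of [secants k K B] lacks. *)
Lemma secants_incl (A B : {set J}) : #|A| = 2%N -> #|B| = 2%N ->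
  secants k K A `<=` secants k K B -> A = B.
Proof.
move=> A2 B2 AB; apply/eqP; rewrite eqEcard A2 B2 leqnn andbT.
apply/fintype.subsetP => i iA; apply: contraT => iB.
have [j [jA ij]] : exists j, j \in A /\ i != j.
  have /card_gt0P[j] : (0 < #|A :\ i|)%N by move: A2; rewrite (cardsD1 i) iA add1n => -[->].
  by rewrite !inE eq_sym => /andP[ij jA]; exists j.
have AE : A = i |: [set j].
  apply/esym/eqP; rewrite eqEcard A2 cards2 ij leqnn andbT.
  by apply/fintype.subsetP => l; rewrite !inE => /orP[] /eqP ->.
have ji : j != i by rewrite eq_sym.
pose o : idx := finfun (fun _ => ord0).
pose v : mvec k K := fun l c => (c == ord0)%:R.
pose r : mvec k K := fun l c => (c == ord_max)%:R.
pose f := secf A v v r; pose u : V := [ffun x => f x].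
have uE : u =1 f by move=> x; rewrite ffunE.
pose x := upd (upd o (pnt (ord_max : 'I_(k i).+1))) (pnt (ord_max : 'I_(k j).+1)).
have m0 l : (ord_max == ord0 :> 'I_(k l).+1) = false.
  by rewrite -val_eqE /=; apply/negbTE; rewrite -lt0n.
have vo : tensP (fun l => l \notin A) v o = 1.
  by rewrite /tensP big1 // => l _; rewrite /v ffunE eqxx.
have fE (y : idx) : (forall l, l \notin A -> y l = o l) ->
    f y = v i (y i) * v j (y j) + r i (y i) * r j (y j).
  by move=> yo; rewrite /f /secf AE !(tensP_pair _ y ij) -AE
    (@tensP_eq _ _ _ _ v y o) // vo mul1r.
have out (y : idx) p : tag p \in A -> (forall l, l \notin A -> y l = o l) ->
    forall l, l \notin A -> upd y p l = o l.
  by move=> pA yo l lA; rewrite upd_out ?yo //; apply: contraNneq lA => <-.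
have fo : f o = 1 by rewrite fE // /v /r !ffunE !eqxx ![_ == ord_max]eq_sym !m0 mulr1 mulr0 addr0.
have xi : x i = ord_max.
  by rewrite upd_out //; exact: (upd_in o (pnt ord_max)).
have xj : x j = ord_max by exact: (upd_in _ (pnt ord_max)).
have fx : f x = 1.
  rewrite fE; first by rewrite xi xj /v /r !eqxx !m0 mul0r add0r mulr1.
  by apply: (out) => //; exact: out.
have fi : f (upd o (at_ x i)) = 0.
  have oj : o j = ord0 by rewrite ffunE.
  rewrite fE; last exact: out.
  rewrite (upd_in o (at_ x i)) /at_ /= xi upd_out //= oj /v /r m0 mul0r add0r.
  by rewrite [ord0 == _]eq_sym m0 mulr0.
have su : secants k K A u.
  split; first by apply/pointsPP; exists o; rewrite uE fo oner_neq0.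
  by exists v, v, r.
have [_ [v' [s' [r' uE']]]] := AB _ su.
have ff : f = secf B v' s' r' by apply/funext => y; rewrite -uE' uE.
have := secf_flat v' s' r' o x iB; rewrite -ff /flat fx fo fi mulr0 subr0 mul1r => /eqP.
by rewrite oner_eq0.
Qed.

Lemma card2_pair (A : {set J}) : #|A| = 2%N -> exists i j, i != j /\ A = i |: [set j].
Proof. by move=> A2; apply/cards2P; rewrite A2. Qed.

Variables (i0 j0 : J).
Hypothesis ij0 : i0 != j0.

Lemma sing_secants (A : {set J}) : #|A| = 2%N -> secants k K A `<=` sing T.
Proof.
move=> /card2_pair[i [j [ij ->]]] u su.
by rewrite (sing_tangents ch0 k1 ij0 third); exists i, j.
Qed.

Lemma sub_sing_secants (Z : set V) : irreducible Z -> Z `<=` sing T ->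
  exists2 A : {set J}, #|A| = 2%N & Z `<=` secants k K A.
Proof.
move=> iZ sub; pose F (A : {A : {set J} | #|A| == 2%N}) := secants k K (val A).
have [A _ ZA] : exists2 A, A \in enum {: {A : {set J} | #|A| == 2%N}} & Z `<=` F A.
  apply: (irreducible_bigcup iZ) => [[A hA]|u /sub].
    rewrite /F /=; have [i [j [ij ->]]] := card2_pair (eqP hA).
    exact: secants_closed.
  rewrite (sing_tangents ch0 k1 ij0 third) => -[i [j [ij su]]].
  have h : #|i |: [set j]| == 2%N by rewrite cards2 ij.
  by exists (exist (fun A : {set J} => #|A| == 2%N) (i |: [set j]) h); rewrite ?mem_enum.
by exists (val A) => //; exact: eqP (valP A).
Qed.

Lemma secants_component (A : {set J}) : #|A| = 2%N ->
  irr_components (sing T) (secants k K A).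
Proof.
move=> A2; have [i [j [ij AE]]] := card2_pair A2; have [m mS] := third i j.
split; [|exact: sing_secants|].
  by rewrite AE; exact: (secants_irreducible ch0 k1 ij mS).
move=> Z' iZ' AZ' sub; have [B B2 ZB] := sub_sing_secants iZ' sub.
have AB : A = B by apply: secants_incl => // u /AZ' /ZB.
by apply/seteqP; split; [rewrite AB|].
Qed.

Lemma component_secants Z : irr_components (sing T) Z ->
  exists2 A : {set J}, #|A| = 2%N & secants k K A = Z.
Proof.
case=> iZ sub maxZ; have [A A2 ZA] := sub_sing_secants iZ sub.
exists A => //; apply: maxZ ZA _; last exact: sing_secants.
by case: (secants_component A2).
Qed.

Lemma components_bij :
  set_bij [set A : {set J} | #|A| = 2%N]%classic (irr_components (sing T)) (secants k K).
Proof.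
split.
- by move=> A /=; exact: secants_component.
- move=> A B; rewrite !inE /= => A2 B2 E; apply: secants_incl => //.
  by rewrite E.
- by move=> Z /component_secants[A A2 <-]; exists A.
Qed.

Lemma components_card :
  (irr_components (sing T) #= [set m | (m < 'C(#|J|, 2%N))%N])%classic%card.
Proof.
rewrite card_eq_sym; apply/card_set_bijP.
pose e := enum [set A : {set J} | #|A| == 2%N]%SET.
have sze : size e = 'C(#|J|, 2%N) by rewrite -cardE card_draws.
have ne m : (m < 'C(#|J|, 2%N))%N -> #|nth finset.set0 e m| = 2%N.
  rewrite -sze => me; have := mem_nth finset.set0 me.
  by rewrite mem_enum inE => /eqP.
exists (fun m => secants k K (nth finset.set0 e m)); split.
- by move=> m /= /ne h; exact: secants_component.
- move=> m m'; rewrite !inE /= => hm hm' E.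
  have /eqP : nth finset.set0 e m = nth finset.set0 e m'.
    by apply: secants_incl; rewrite ?ne // E.
  by rewrite nth_uniq ?sze ?enum_uniq // => /eqP.
- move=> Z /component_secants[A A2 <-].
  have Ae : A \in e by rewrite mem_enum inE A2.
  exists (index A e); last by rewrite nth_index.
  by rewrite /= -sze index_mem.
Qed.

End Components.

(** * The isomorphism *)

Section Multihomogeneous.
Variables (K : fieldType) (A : ambient).
Implicit Types (f g : pol K A) (d : blocks A -> nat).

Lemma multihomogM d1 d2 f g : multihomog d1 f -> multihomog d2 g ->
  multihomog (fun b => d1 b + d2 b)%N (f * g).
Proof.
move=> h1 h2 m /msuppM_le/allpairsP[[m1 m2] /= [s1 s2 ->]] b.
by rewrite -(h1 m1) // -(h2 m2) // -big_split; apply: eq_bigr => t _; rewrite mnmDE.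
Qed.

Lemma multihomog_mvar (x : Defs.coord A) : multihomog (fun b => (blk x == b : nat)) (mvar K x).
Proof.
move=> m; rewrite /mvar msuppX inE => /eqP -> b.
rewrite big_mkcond (bigD1 (enum_rank x)) //= enum_rankK mnm1E eqxx.
rewrite big1 ?addn0 => [|t ne]; first by case: (_ == b).
by rewrite mnm1E; case: eqVneq ne => [->|_]; rewrite ?eqxx //; case: ifP.
Qed.

Lemma multihomog_prod (I : finType) (d : I -> blocks A -> nat) (F : I -> pol K A) :
  (forall l, multihomog (d l) (F l)) ->
  multihomog (fun b => \sum_l d l b)%N (\prod_l F l).
Proof.
move=> h; elim: (index_enum I) => [|l r IH].
  move=> m; rewrite big_nil msupp1 inE => /eqP -> b; rewrite big_nil.
  by rewrite big1 // => t _; rewrite mnm0E.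
rewrite big_cons (_ : (fun b => _) = (fun b => d l b + \sum_(l <- r) d l b)%N).
  exact: multihomogM.
by apply/funext => b; rewrite big_cons.
Qed.

Lemma peq_refl (u : vec K A) : peq u u.
Proof. by exists (fun _ => 1) => [b|x]; rewrite ?oner_neq0 ?mul1r. Qed.
End Multihomogeneous.

Section Isomorphism.
Variables (K : fieldType) (ch0 : forall n, n.+1%:R != 0 :> K).
Variables (J : finType) (k : J -> nat) (i j : J).
Hypothesis k1 : forall l, (0 < k l)%N.
Hypothesis ij : i != j.
Local Notation idx := (tensor_index k).
Local Notation S := (i |: [set j])%SET.
Local Notation V := (vec K (PP idx)).
Local Notation JA := {l : J | l \in S}.
Local Notation JB := {l : J | l \notin S}.
Local Notation kA := (fun l : JA => k (val l)).
Local Notation kB := (fun l : JB => k (val l)).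
Local Notation idxA := (tensor_index kA).
Local Notation B := (ambient_prod (PP idxA) (multiproj kB)).
Local Notation W := (vec K B).
Local Notation pt := {l : J & 'I_(k l).+1}.
Local Notation ptB := {l : JB & 'I_(kB l).+1}.

Let ji : j != i. Proof. by rewrite eq_sym. Qed.
Fact iS : i \in S. Proof. by rewrite !inE eqxx. Qed.
Fact jS : j \in S. Proof. by rewrite !inE eqxx orbT. Qed.
Let iA : JA := exist _ i iS.
Let jA : JA := exist _ j jS.

Lemma sub_all (l : JA) : l \in iA |: [set jA]%SET.
Proof. by case: l => l lS; rewrite !inE -!val_eqE /=; move: lS; rewrite !inE. Qed.

Definition restr (x : idx) : idxA := finfun (fun l : JA => x (val l)).

(** The membership test is matched on its proof, which is needed to form the element of the subtype
    indexing [y]. *)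
Definition merge (y : idxA) (o : idx) : idx := finfun (fun l =>
  if decP (@idP (l \in S)) is left h then y (exist _ l h) else o l).

Definition pntB (l : JB) (c : 'I_(k (val l)).+1) : ptB :=
  Tagged (fun l : JB => 'I_(kB l).+1) c.

Arguments pntB l c : clear implicits.

Definition outp (q : ptB) : pt := pnt (tagged q : 'I_(k (val (tag q))).+1).

Definition extend (v : mvec kA K) : mvec k K := fun l c =>
  if decP (@idP (l \in S)) is left h then v (exist _ l h) c else 0.

Lemma merge_in y o (l : JA) : merge y o (val l) = y l.
Proof.
rewrite ffunE; case: decP => [h|]; last by case: l.
by case: l h => l lS h /=; rewrite (bool_irrelevance h lS).
Qed.

Lemma merge_out y o l : l \notin S -> merge y o l = o l.
Proof. by move=> lS; rewrite ffunE; case: decP => // h; rewrite h in lS. Qed.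

Lemma restr_merge y o : restr (merge y o) = y.
Proof. by apply/ffunP => l; rewrite ffunE merge_in. Qed.

Lemma merge_restr x : merge (restr x) x = x.
Proof.
apply/ffunP => l; rewrite ffunE; case: decP => // h.
by rewrite ffunE.
Qed.

Lemma extendE v (l : JA) c : extend v c = v l c :> K.
Proof.
rewrite /extend; case: decP => [h|]; last by case: l c.
by case: l h c => l lS h c /=; rewrite (bool_irrelevance h lS).
Qed.

Lemma tensP_in (v : mvec k K) x : tensP (fun l => l \in S) v x =
  tens (fun l : JA => v (val l)) (restr x).
Proof.
rewrite /tensP (reindex_omap (val : JA -> J) insub) /=; last first.
  by move=> l lS; rewrite insubT.
apply: eq_big => [[l lS]|l _] /=; last by rewrite ffunE.
by rewrite insubT lS /= eqxx.
Qed.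

Lemma tensP_notin (v : mvec k K) x : tensP (fun l => l \notin S) v x =
  \prod_(l : JB) v (val l) (x (val l)).
Proof.
rewrite /tensP (reindex_omap (val : JB -> J) insub) /=; last first.
  by move=> l lS; rewrite insubT.
by apply: eq_bigl => -[l lS] /=; rewrite insubT lS /= eqxx.
Qed.

Definition split_at (o : idx) (u : idx -> K) : W := [ffun y =>
  match y with inl a => u (merge a o) | inr q => u (upd o (outp q)) end].

(** The entry [o] is chosen depending on [u], so this is no single polynomial map; regularity rests
    on the comparison [split_at_peq] of two choices. *)
Definition split_map (u : V) : W :=
  if [pick o | u o != 0] is Some o then split_at o u else 0.

Definition join_map (y : W) : V :=
  [ffun x => y (inl (restr x)) * \prod_(l : JB) y (inr (pntB l (x (val l))))].

Lemma split_map_at u : points K (PP idx) u -> exists2 o, u o != 0 & split_map u = split_at o u.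
Proof.
case/pointsPP => x ux; rewrite /split_map; case: pickP => [o uo|/(_ x)]; last by rewrite ux.
by exists o.
Qed.

Section SecantPoint.
Unset Implicit Arguments.
Variables (v s r : mvec k K) (u : V).
Set Implicit Arguments.
Hypothesis uE : u =1 secf S v s r.
Let al o := tensP (fun l => l \notin S) v o.
Let M (y : idxA) := tens (fun l : JA => s (val l)) y + tens (fun l : JA => r (val l)) y.

Let uM x : (u x : K) = al x * M (restr x).
Proof. by rewrite uE /secf !tensP_in. Qed.

Let u_merge y o : (u (merge y o) : K) = al o * M y.
Proof.
rewrite uM restr_merge; congr (_ * _).
by apply: tensP_eq => l lS; rewrite merge_out.
Qed.

Let al_out o (q : ptB) : al (upd o (outp q)) =
  v (val (tag q)) (tagged q) * tensP (less (fun l => l \notin S) (val (tag q))) v o.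
Proof. by rewrite /al tensP_upd //; exact: (valP (tag q)). Qed.

Let restr_out o (q : ptB) : restr (upd o (outp q)) = restr o.
Proof.
apply/ffunP => l; rewrite !ffunE dfwith_out //.
by apply: contraNneq (valP (tag q)) => /= ->; exact: valP.
Qed.

Let u_out o (q : ptB) : (u (upd o (outp q)) : K) = v (val (tag q)) (tagged q) *
  (tensP (less (fun l => l \notin S) (val (tag q))) v o * M (restr o)).
Proof. by rewrite uM al_out restr_out mulrA. Qed.

(** Another base entry rescales each block separately: the block of [S] by the product of the outer
    factors at [o], the block of [l] by the same product without [l], times the part in [S]. These
    scalars are nonzero because each block has a nonzero entry. *)
Lemma split_at_peq o o' : points K B (split_at o u) -> points K B (split_at o' u) ->
  peq (split_at o' u) (split_at o u).
Proof.
pose be o l := tensP (less (fun l => l \notin S) l) v o * M (restr o).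
have al0 z : points K B (split_at z u) -> al z != 0.
  move=> /(_ (inl tt)) [[y|q] //= _]; rewrite ffunE u_merge.
  by rewrite mulf_eq0 negb_or => /andP[].
have be0 z (l : JB) : points K B (split_at z u) -> be z (val l) != 0.
  move=> /(_ (inr l)) [[y|q] //= [<-]]; rewrite ffunE u_out.
  by rewrite mulf_eq0 negb_or => /andP[].
move=> po po'; exists (fun c => match c with inl _ => al o' / al o | inr l => be o' (val l) / be o (val l) end).
  case=> [_|l]; first by rewrite mulf_neq0 ?invr_eq0 ?al0.
  by rewrite mulf_neq0 ?invr_eq0 ?be0.
case=> [y|q] /=; rewrite !ffunE.
  by rewrite !u_merge mulrA divfK ?al0.
rewrite !u_out -/(be _ _) -/(be _ _) [RHS]mulrCA; congr (_ * _).
by rewrite divfK // (be0 _ (tag q)).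
Qed.

Lemma split_at_points o : u o != 0 -> points K B (split_at o u).
Proof.
move=> uo; case=> [[]|l].
  by exists (inl (restr o)) => //; rewrite ffunE merge_restr.
exists (inr (pntB l (o (val l)))) => //; rewrite ffunE.
by rewrite [upd _ _](upd_id o (val l)).
Qed.

Lemma split_at_image o : u o != 0 ->
  var_prod (tan (segre K kA)) (points K (multiproj kB)) (split_at o u).
Proof.
move=> uo; have uo' : al o * M (restr o) != 0 by rewrite -uM.
split=> /=.
  rewrite (tan_segre ch0 (l0 := iA)) ?k1 //.
  have ijA : iA != jA by rewrite -val_eqE.
  apply: (secants_tangents ijA); split.
    apply/pointsPP; exists (restr o); rewrite !ffunE u_merge //.
  exists (fun _ _ => 1), (fun l c => (if l == iA then al o else 1) * s (val l) c),
    (fun l c => (if l == iA then al o else 1) * r (val l) c) => y.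
  have one : tensP (fun l => l \notin iA |: [set jA]%SET) (fun l (c : 'I_(kA l).+1) => 1 : K) y = 1.
    by rewrite /tensP big1.
  rewrite !ffunE u_merge /secf one mul1r.
  have tE w : tensP (fun l => l \in iA |: [set jA]%SET)
      (fun l c => (if l == iA then al o else 1) * w l c) y = al o * tens w y.
    rewrite (tensP_pred _ _ (Q' := predT)) => [|l]; last by rewrite sub_all.
    rewrite (tensP_scale predT (fun l => if l == iA then al o else 1)); congr (_ * _).
    by rewrite (bigD1 iA) //= eqxx big1 ?mulr1 // => l /negPf ->.
  rewrite (tE (fun l => s (val l))) (tE (fun l => r (val l))). exact: mulrDr.
move=> l; exists (pntB l (o (val l))) => //; rewrite !ffunE.
by rewrite [upd _ _](upd_id o (val l)).
Qed.

(** Every outer slice brings along the entries at [o] of all other factors, so the product of the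
    slices is [u] times a nonzero constant. *)
Lemma join_split o : u o != 0 -> peq (join_map (split_at o u)) u.
Proof.
move=> uo; have : al o * M (restr o) != 0 by rewrite -uM.
rewrite mulf_eq0 negb_or => /andP[ao mo].
have be0 (l : JB) : tensP (less (fun l => l \notin S) (val l)) v o != 0.
  move: ao; rewrite /al (tensP_D1 v o (valP l : (fun l => l \notin S) (val l))).
  by rewrite mulf_eq0 negb_or => /andP[].
apply/peqPP; exists (al o * \prod_(l : JB) (tensP (less (fun l => l \notin S) (val l)) v o * M (restr o))).
  rewrite mulf_neq0 //; apply/prodf_neq0 => l _; by rewrite mulf_neq0.
apply/ffunP => x; rewrite scaleffE uM ffunE ffunE u_merge.
rewrite (eq_bigr (fun l : JB => v (val l) (x (val l)) *
   (tensP (less (fun l => l \notin S) (val l)) v o * M (restr o)))) => [|l _]; last first.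
  by rewrite ffunE u_out.
rewrite big_split /= -tensP_notin -/(al x); ring.
Qed.

End SecantPoint.

Local Notation X := (secants k K S).
Local Notation Y := (var_prod (tan (segre K kA)) (points K (multiproj kB))).

Lemma split_map_image u : X u -> Y (split_map u).
Proof.
case=> pu [v [s [r uE]]]; have [o uo ->] := split_map_at pu.
exact: (split_at_image uE uo).
Qed.

Lemma split_map_regular : regular_map X Y split_map.
Proof.
split=> [u|u Xu]; first exact: split_map_image.
have [pu [v [s [r uE]]]] := Xu; have [o uo _] := split_map_at pu.
pose F (y : Defs.coord B) : pol K (PP idx) :=
  match y with inl a => mvar K (merge a o) | inr q => mvar K (upd o (outp q)) end.
have FE (z : V) : [ffun y => evalp (F y) z] = split_at o z.
  by apply/ffunP => -[a|q]; rewrite !ffunE pevE pev_var.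
exists F => Fv; split.
- exists (fun _ _ => 1%N) => -[a|q]; apply/mhomogP; exact: mvar_homog.
- by rewrite /Fv FE; exact: split_at_points.
move=> u' [pu' [v' [s' [r' uE']]]]; rewrite /Fv FE => pF.
have [o' uo' ->] := split_map_at pu'.
by apply: (split_at_peq uE') => //; exact: split_at_points.
Qed.

Lemma join_map_image y : Y y -> X (join_map y).
Proof.
case=> /=; rewrite (tan_segre ch0 (l0 := iA)) ?k1 // => -[/pointsPP[a ya] [v [w [_ NE]]]] pw.
have ijA : iA != jA by rewrite -val_eqE.
have jiA : jA != iA by rewrite eq_sym.
have coordB (l : JB) : exists c : 'I_(kB l).+1, y (inr (pntB l c)) != 0.
  have [[l' c] /= e] := pw l; subst l'; rewrite ffunE => yc.
  by exists c.
split.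
  pose o : idx := finfun (fun l => if decP (@idP (l \notin S)) is left h
    then sval (cid (coordB (exist _ l h))) else ord0).
  apply/pointsPP; exists (merge a o); rewrite ffunE restr_merge mulf_neq0 //.
    by move: ya; rewrite ffunE.
  apply/prodf_neq0 => -[l lS] _; rewrite merge_out //= ffunE.
  case: decP => [h|//]; rewrite (bool_irrelevance h lS).
  exact: (svalP (cid (coordB (exist _ l lS)))).
exists (fun l (c : 'I_(k l).+1) => if decP (@idP (l \notin S)) is left h
    then y (inr (pntB (exist _ l h) c)) else 0).
exists (extend (fun l => if l == iA then w l else v l)).
exists (extend (fun l => if l == iA then v l else w l)) => x.
rewrite ffunE mulrC /secf tensP_notin !tensP_in; congr (_ * _).
  apply: eq_bigr => -[l lS] _ /=; case: decP => [h|//].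
  by rewrite (bool_irrelevance h lS).
have -> : y (inl (restr x)) = dten v w (restr x) by rewrite -NE ffunE.
rewrite (dten_pair v (restr x) ijA) => [|l]; last by rewrite sub_all.
rewrite /tensP big_pred0 ?mul1r => [|l]; last by rewrite sub_all.
have tE (z : mvec kA K) : tens (fun l : JA => extend z (l := val l)) (restr x) =
    z iA (restr x iA) * z jA (restr x jA).
  rewrite -(tensP_pair z (restr x) ijA) /tens /tensP; apply: eq_big => l; first by rewrite sub_all.
  by rewrite extendE.
by rewrite !tE eqxx (negPf jiA).
Qed.

Lemma join_map_regular : regular_map Y X join_map.
Proof.
split=> [y|y Yy]; first exact: join_map_image.
pose F (x : Defs.coord (PP idx)) : pol K B := mvar K (inl (restr x) : Defs.coord B) *
  \prod_(l : JB) mvar K (inr (pntB l (x (val l))) : Defs.coord B).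
have FE (z : W) : [ffun x => evalp (F x) z] = join_map z.
  apply/ffunP => x; rewrite !ffunE /evalp /F rmorphM rmorph_prod /= /mvar mevalXU enum_rankK.
  by congr (_ * _); apply: eq_bigr => l _; rewrite mevalXU enum_rankK.
have pX u : X u -> points K (PP idx) u by case.
exists F => Fv; split.
- exists (fun _ _ => 1%N) => x.
  (* The polynomial is multilinear: it has one variable from each block. *)
  have -> : (fun=> 1%N) = (fun b : blocks B => (inl tt == b :> blocks B) +
      \sum_(l : JB) (inr l == b :> blocks B))%N.
    apply/funext => -[[]|l]; first by rewrite eqxx big1.
    rewrite (bigD1 l) // eqxx big1 // => l' /negPf nl; by rewrite -[LHS]/(nat_of_bool (l' == l)) nl.
  apply: multihomogM; first exact: multihomog_mvar.
  by apply: multihomog_prod => l; exact: multihomog_mvar.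
- by rewrite /Fv FE; apply/pX/join_map_image.
by move=> y' _ _; rewrite /Fv FE; exact: peq_refl.
Qed.

(** Each block of [y] comes back multiplied by the entries of the other blocks at [o], a nonzero
    scalar depending on the block only. *)
Lemma split_join y : Y y -> peq (split_map (join_map y)) y.
Proof.
move=> Yy; have [pj _] := join_map_image Yy; have [o jo ->] := split_map_at pj.
pose f (l : JB) (x : idx) : K := y (inr (pntB l (x (val l)))).
have jE x : (join_map y x : K) = y (inl (restr x)) * \prod_l f l x by rewrite ffunE.
move: jo; rewrite -[join_map y o]/(join_map y o : K) jE mulf_eq0 negb_or => /andP[ro po].
pose R (l : JB) := \prod_(m | m != l) f m o.
have R0 l : R l != 0.
  by apply/prodf_neq0 => m _; move/prodf_neq0: po; apply.
exists (fun b => match b with inl _ => \prod_l f l o | inr l => (y (inl (restr o)) : K) * R l end).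
  by case=> [_|l] //; rewrite mulf_neq0.
case=> [a|q] /=; rewrite ffunE jE.
  rewrite restr_merge mulrC; congr (_ * _); apply: eq_bigr => l _.
  by rewrite /f merge_out //; exact: valP l.
have -> : restr (upd o (outp q)) = restr o.
  apply/ffunP => l; rewrite !ffunE dfwith_out //.
  by apply: contraNneq (valP (tag q)) => /= ->; exact: valP.
have fq : f (tag q) (upd o (outp q)) = y (inr q).
  by case: q => l c; rewrite /f (upd_in o (outp (existT _ l c))).
have fR : \prod_(m | m != tag q) f m (upd o (outp q)) = R (tag q).
  apply: eq_bigr => m mq; rewrite /f upd_out //=.
  by rewrite (inj_eq val_inj) eq_sym.
by rewrite (bigD1 (tag q)) //= fq fR mulrA mulrAC.
Qed.

Lemma secants_isomorphic : isomorphic X Y.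
Proof.
exists split_map, join_map; split; [exact: split_map_regular|exact: join_map_regular| |exact: split_join].
move=> u [pu [v [s [r uE]]]]; have [o uo ->] := split_map_at pu.
exact: (join_split uE uo).
Qed.

End Isomorphism.

Lemma third_index (n : nat) (i j : 'I_n) : (3 <= n)%N -> exists m, m \notin (i |: [set j])%SET.
Proof.
move=> n3; have /card_gt0P[m] : (0 < #|~: (i |: [set j])%SET|)%N; last by rewrite inE; exists m.
rewrite cardsCs finset.setCK card_ord subn_gt0; apply: leq_trans n3.
by rewrite ltnS cards2; case: (_ != _).
Qed.

Local Close Scope ring_scope.
Local Close Scope classical_set_scope.

Theorem corollary8p8 (R : realType) (n : nat) (k : 'I_n -> nat)
    (hn : (3 <= n)%N)
    (hk1 : forall l : 'I_n, (1 <= k l)%N)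
    (hk : forall i j : 'I_n, (i <= j)%N -> (k i <= k j)%N) :
  let T := tan (segre (complex R) k) in
  (irr_components (sing T) #= [set m | (m < 'C(n, 2))%N])%classic%card /\
  exists Z : {set 'I_n} -> set (vec (complex R) (PP (tensor_index k))),
    set_bij [set A : {set 'I_n} | #|A| = 2]%classic
      (irr_components (sing T)) Z /\
    forall i j : 'I_n, (i < j)%N ->
      let ij := (i |: [set j])%SET in
      is_codim (Z ij) T (1 + \sum_(l | (l != i) && (l != j)) k l)%N /\
      isomorphic (Z ij)
        (var_prod
           (tan (segre (complex R) (fun l : {l | l \in ij} => k (val l))))
           (points (complex R)
              (multiproj (fun l : {l | l \notin ij} => k (val l))))).
Proof.
have ch0 m : (m.+1%:R != 0 :> complex R)%R by rewrite Num.Theory.pnatr_eq0.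
have third i j : exists m, m \notin (i |: [set j])%SET := third_index i j hn.
pose i0 : 'I_n := Ordinal (leq_trans (isT : 0 < 3) hn).
pose j0 : 'I_n := Ordinal (leq_trans (isT : 1 < 3) hn).
have ij0 : i0 != j0 by [].
rewrite /= (tan_segre ch0 (hk1 i0)); split.
  by have := components_card ch0 hk1 third ij0; rewrite card_ord.
exists (secants k (complex R)); split; first exact: (components_bij ch0 hk1 third ij0).
move=> i j lt_ij; have ij : i != j by rewrite -val_eqE neq_ltn lt_ij.
split; last exact: (secants_isomorphic ch0 hk1 ij).
have [m0 m0S] := third i j.
have := secants_codim ch0 hk1 ij m0S; congr (is_codim _ _ _).
by congr (_ + _); apply: eq_bigl => l; rewrite !inE negb_or.
Qed.
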